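(* Let $\ell\in\{1,2,3\}$. The map $T^{(\ell)}:Y_\ell\to V_\ell\cong\mathbb{C}$ is a branched double covering map and its branch points are exactly the zeros of $Q_\ell(T)$. In particular, $$Y_\ell\cong\Sigma_\ell:=\{(W,T)\in\mathbb{C}^2\mid W^2=Q_\ell(T)\}.$$
   Context: Let $\tau\in\mathbb{C}$ with $\mathrm{Im}\,\tau>0$, $\Lambda_\tau=\mathbb{Z}+\mathbb{Z}\tau$, $E_\tau=\mathbb{C}/\Lambda_\tau$; $\wp,\zeta$ are the Weierstrass functions of $\Lambda_\tau$ ($\zeta'=-\wp$, $\zeta$ odd). Put $\omega_0=0,\omega_1=1,\omega_2=\tau,\omega_3=1+\tau$, $\eta_0=0$, $\eta_i=\zeta(z+\omega_i)-\zeta(z)$ for $i=1,2,3$, and $E_\tau[2]=\{\omega_k/2\mid k=0,1,2,3\}\subset E_\tau$. For $\ell\in\{1,2,3\}$ let $\varepsilon^{(\ell)}_0=\varepsilon^{(\ell)}_\ell=1$ and $\varepsilon^{(\ell)}_j=-1$ for $j\in\{1,2,3\}\setminus\{\ell\}$. $V_\ell=\{(\varepsilon_0^{(\ell)}T,\varepsilon_1^{(\ell)}T,\varepsilon_2^{(\ell)}T,\varepsilon_3^{(\ell)}T,\,T^2-\eta_{3-\ell}T)\mid T\in\mathbb{C}\}$, identified with $\mathbb{C}$ via $T$. Put $$q_\ell(z;T)=\tfrac34\sum_{k=0}^3\wp(z-\tfrac{\omega_k}{2})+T\sum_{k=0}^3\varepsilon_k^{(\ell)}\zeta(z-\tfrac{\omega_k}{2})+T^2-\eta_{3-\ell}T,$$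 $$F^{(\ell)}(z;T)=-\sum_{k=0}^3\varepsilon_k^{(\ell)}\zeta(z-\tfrac{\omega_k}{2})+2T+\eta_{3-\ell}.$$ The spectral polynomial is $Q_\ell(T)=\big((F^{(\ell)})'\big)^2-2(F^{(\ell)})''F^{(\ell)}+4q_\ell(z;T)(F^{(\ell)})^2$ ($'=d/dz$), which is independent of $z$ and polynomial in $T$. $Y_\ell=\{\underline{a}\mid \underline{a}:=\{a,a-\tfrac{\omega_\ell}{2}\}\in\mathrm{Sym}^2(E_\tau\setminus E_\tau[2])\}$, i.e. the set of unordered pairs of points of $E_\tau\setminus E_\tau[2]$ differing by $\omega_\ell/2$. The map $T^{(\ell)}$ is $$T^{(\ell)}(\underline{a})=\zeta(a)+\zeta(a-\tfrac{\omega_\ell}{2})-\zeta(2a)+\tfrac12\eta_\ell,$$ which is well defined on $Y_\ell$. A branch point is a point of the target $V_\ell$ over which the covering ramifies. *)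

(* Defs.v *)
From HB Require Import structures.
From mathcomp Require Import all_boot all_order all_algebra.
From mathcomp Require Import generic_quotient ring_quotient.
From mathcomp Require Import complex.
From mathcomp Require Import all_classical all_reals all_analysis.
From mathcomp Require summability.

Set Implicit Arguments.
Unset Strict Implicit.
Unset Printing Implicit Defensive.

Import Order.TTheory GRing.Theory Num.Theory.
Import numFieldTopology.Exports numFieldNormedType.Exports.

Local Open Scope classical_set_scope.
Local Open Scope quotient_scope.
Local Open Scope ring_scope.

(* Packing [R[i]] as a [numClosedFieldType] gives it the topology of its norm;
   derivatives of functions [CC R -> CC R] are then complex derivatives. *)
Definition CC (R : realType) : numClosedFieldType := R[i].

Record chart (R : realType) (X : topologicalType) := Chart {
  dom : set X;
  coord : X -> CC R }.

Definition is_chart (R : realType) (X : topologicalType) (c : chart R X) :=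
  [/\ open (dom c),
      {within dom c, continuous (coord c)},
      set_inj (dom c) (coord c) &
      forall U : set X, open U -> U `<=` dom c -> open (coord c @` U)].

(* [f], read in the charts [c] and [d], is complex differentiable at [c x]. *)
Definition holomorphic_in_charts (R : realType) (X Y : topologicalType)
    (f : X -> Y) (c : chart R X) (d : chart R Y) (x : X) :=
  exists g : CC R -> CC R,
    derivable g (coord c x) 1 /\
    \forall x' \near x, coord d (f x') = g (coord c x').

Record curve (R : realType) := Curve {
  points :> topologicalType;
  atlas : set (chart R points) }.

Arguments atlas {R}.

Definition is_complex_curve (R : realType) (X : curve R) :=
  [/\ hausdorff_space X,
      forall x : X, exists2 c, atlas X c & dom c x,
      forall c, atlas X c -> is_chart c &
      forall c d (x : X), atlas X c -> atlas X d -> dom c x -> dom d x ->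
        holomorphic_in_charts id c d x].

Definition holomorphic (R : realType) (X Y : curve R) (f : X -> Y) :=
  continuous f /\
  forall c d (x : X), atlas X c -> atlas Y d -> dom c x -> dom d (f x) ->
    holomorphic_in_charts f c d x.

Definition biholomorphic (R : realType) (X Y : curve R) :=
  [/\ is_complex_curve X, is_complex_curve Y &
      exists (f : X -> Y) (g : Y -> X),
        [/\ cancel f g, cancel g f, holomorphic f & holomorphic g]].

Definition proper_map (X Y : topologicalType) (f : X -> Y) :=
  forall K : set Y, compact K -> compact (f @^-1` K).

Definition ramified_at (X Y : topologicalType) (f : X -> Y) (x : X) :=
  ~ exists2 U : set X, nbhs x U & set_inj U f.

Definition branch_points (X Y : topologicalType) (f : X -> Y) : set Y :=
  f @` [set x | ramified_at f x].

(* [V] is evenly covered: its preimage consists of [n] disjoint open sheets, each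
   mapped homeomorphically onto [V] by the continuous map [f]. *)
Definition evenly_covered (n : nat) (X Y : topologicalType) (f : X -> Y)
    (V : set Y) :=
  exists S : 'I_n -> set X,
    [/\ forall i, open (S i),
        trivIset setT S,
        f @^-1` V = \bigcup_i S i &
        forall i, set_bij (S i) V f /\
          forall U : set X, open U -> U `<=` S i -> open (f @` U)].

(* [limit_point B = set0] says that [B] is closed and discrete. *)
Definition branched_covering (R : realType) (n : nat) (X Y : curve R)
    (f : X -> Y) :=
  [/\ is_complex_curve X /\ is_complex_curve Y,
      holomorphic f,
      proper_map f,
      limit_point (branch_points f) = set0 &
      forall y : Y, ~ branch_points f y ->
        exists V : set Y, [/\ open V, V y & evenly_covered n f V]].

Section SymmetricSquare.
Variable X : topologicalType.

Definition swap_rel (p q : X * X) := (p == q) || (p == (q.2, q.1)).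

Lemma swap_rel_equiv : equiv_class_of swap_rel.
Proof.
split=> [p|p q|q p r]; first by rewrite /swap_rel eqxx.
- by case: p q => [a b] [c d]; rewrite /swap_rel !xpair_eqE /=;
    apply/idP/idP => /orP[]/andP[/eqP-> /eqP->]; rewrite !eqxx ?orbT.
- by case: p q r => [a b] [c d] [e f]; rewrite /swap_rel !xpair_eqE /=;
    move=> /orP[]/andP[/eqP-> /eqP->] /orP[]/andP[/eqP-> /eqP->];
    rewrite !eqxx ?orbT.
Qed.

Canonical swap_equiv := EquivRelPack swap_rel_equiv.

Definition Sym2 := quotient_topology {eq_quot swap_rel}.

Definition upair (x y : X) : Sym2 := \pi_Sym2 (x, y).

End SymmetricSquare.

Section Elliptic.
Variables (R : realType) (tau : CC R).
Local Notation C := (CC R).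

Definition lattice_point (p : int * int) : C := p.1%:~R + p.2%:~R * tau.

Definition lattice : {pred C} :=
  [pred z | `[< exists p : int * int, z = lattice_point p >]].

Lemma lattice_zmod_closed : zmod_closed lattice.
Proof.
split=> [|z w]; first by apply/asboolP; exists 0; rewrite /lattice_point mul0r addr0.
move=> /asboolP[p ->] /asboolP[q ->]; apply/asboolP; exists (p.1 - q.1, p.2 - q.2).
by rewrite /lattice_point /= !rmorphB mulrBl /= opprD addrACA.
Qed.

HB.instance Definition _ := GRing.isZmodClosed.Build C lattice lattice_zmod_closed.

Definition torus := quotient_topology (Quotient.quot lattice).

Definition toT (z : C) : torus := \pi_torus z.

(* Unordered sum over [Z + Z tau] without 0: the limit of the sums over finite
   sets of indices. *)
Definition lattice_sum (t : C -> C) : C :=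
  summability.sum
    (fun p : int * int => if p == 0 then 0 else t (lattice_point p)).

Definition wp (z : C) : C :=
  z ^- 2 + lattice_sum (fun w => (z - w) ^- 2 - w ^- 2).

Definition zeta (z : C) : C :=
  z^-1 + lattice_sum (fun w => (z - w)^-1 + w^-1 + z / w ^+ 2).

Definition omega (k : nat) : C := nth 0 [:: 0; 1; tau; 1 + tau] k.

(* The constant value of [zeta (z + omega k) - zeta z]; [eta 0 = 0]. *)
Definition eta (k : nat) : C :=
  xget 0 [set c | forall z, z \notin lattice -> zeta (z + omega k) - zeta z = c].

Definition two_torsion : set torus := [set toT (omega k / 2) | k in [set: 'I_4]].

Definition eps (l k : nat) : C := if (k == 0) || (k == l) then 1 else -1.

Definition q_pot (l : nat) (T z : C) : C :=
  3 / 4 * (\sum_(k < 4) wp (z - omega k / 2))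
  + T * (\sum_(k < 4) eps l k * zeta (z - omega k / 2))
  + T ^+ 2 - eta (3 - l) * T.

Definition F_sol (l : nat) (T z : C) : C :=
  - (\sum_(k < 4) eps l k * zeta (z - omega k / 2)) + 2 * T + eta (3 - l).

Definition spectral_expr (l : nat) (T z : C) : C :=
  derive1 (F_sol l T) z ^+ 2
  - 2 * derive1n 2 (F_sol l T) z * F_sol l T z
  + 4 * q_pot l T z * F_sol l T z ^+ 2.

(* The polynomial whose value at [T] is [spectral_expr l T z] for every [z] off the half-lattice. *)
Definition spectral_poly (l : nat) : {poly C} :=
  xget 0 [set Q : {poly C} | forall T z : C, ~ two_torsion (toT z) ->
                               Q.[T] = spectral_expr l T z].

Definition torus_minus_2tors : set torus := ~` two_torsion.

(* [s] is the unordered pair [{a, a - omega l / 2}] in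
   [Sym^2 (torus \ two_torsion)]. *)
Definition represents (l : nat) (s : Sym2 torus_minus_2tors) (a : C) :=
  exists x y : torus_minus_2tors,
    [/\ val x = toT a, val y = toT (a - omega l / 2) & s = upair x y].

Definition Y_set (l : nat) : set (Sym2 torus_minus_2tors) :=
  [set s | exists a, represents l s a].

(* The complex structure on [Y_set l] is the one for which
   [a |-> {a, a - omega l / 2}] is locally biholomorphic: the charts are the
   continuous local sections of this map. *)
Definition Y_curve (l : nat) : curve R :=
  @Curve R (Y_set l)
    [set c : chart R (Y_set l) | [/\ open (dom c), {within dom c, continuous (coord c)} &
      forall s : Y_set l, dom c s -> represents l (val s) (coord c s)]].

(* The value does not depend on the representative [a]. *)
Definition T_map (l : nat) (s : Y_set l) : C :=
  let a := xget 0 [set a | represents l (val s) a] in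
  zeta a + zeta (a - omega l / 2) - zeta (2 * a) + eta l / 2.

(* Pairs [(W, T)]. *)
Definition Sigma_set (l : nat) : set (C * C) :=
  [set p : C * C | p.1 ^+ 2 = (spectral_poly l).[p.2]].

End Elliptic.

Definition affine_line (R : realType) : curve R :=
  @Curve R (CC R) [set Chart setT id].

(* A subset [S] of [C^2] with, as charts, the inverses of its regular holomorphic
   parametrizations; these charts cover [S] exactly when [S] is a one-dimensional
   complex submanifold. *)
Definition embedded_curve (R : realType) (S : set (CC R * CC R)) : curve R :=
  @Curve R S
    [set c : chart R S | [/\ open (dom c),
                 {within dom c, continuous (coord c)},
                 open (coord c @` dom c) &
                 exists g1 g2 : CC R -> CC R, forall p, dom c p ->
                   let t := coord c p in
                   [/\ val p = (g1 t, g2 t),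
                       derivable g1 t 1, derivable g2 t 1 &
                       (derive1 g1 t, derive1 g2 t) != 0]]].

Definition Sigma_curve (R : realType) (tau : CC R) (l : nat) : curve R :=
  embedded_curve (Sigma_set tau l).

(* Main.v *)
Require Import Defs.
From mathcomp Require Import all_boot all_order all_algebra.
From mathcomp Require Import generic_quotient ring_quotient finmap.
From mathcomp Require Import complex.
From mathcomp Require Import cyclic separable cyclotomic.
From mathcomp Require Import all_classical all_reals all_analysis.
From mathcomp Require summability.
From mathcomp Require Import zify ring lra.
Import Defs.
Import Order.TTheory GRing.Theory Num.Theory.
Import numFieldTopology.Exports numFieldNormedType.Exports.
Local Open Scope classical_set_scope.
Local Open Scope ring_scope.

Set Implicit Arguments.
Unset Strict Implicit.
Unset Printing Implicit Defensive.

(** Let [L] be the half-lattice and [al = omega l / 2]. By the duplication formula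
    [2 * zeta (2 * z) = sum_k zeta (z - omega k / 2) + eta 3] the map [T] is one half
    of a single elliptic function, [h z = sum_k eps_k zeta (z - omega k / 2) - eta (3 - l)]
    ([twisted_zeta_half]). It is odd, has period [al], changes sign under a second
    half-period [be], and its only singularities are simple poles at the points of
    [L]: up to scale it is the Jacobi function ns ([ns_function]). Moreover [Y_l] is
    the quotient of the complement of [L] by the group [L2 = Z al + Z (2 be)], and
    [h] descends to it ([Y_quotient]).

    A doubly periodic function without poles is constant ([liouville_removable]).
    Comparing polar parts at 0 gives [4 wp (2 z) = h^2 + A], [h'^2 = h^4 + 3 A h^2 + D]
    and [h'' = 2 h^3 + 3 A h] ([h_ode]). Substituted in the definition of the
    spectral polynomial, where [F = 2 T - h], these equations give
    [Q_l (T) = 16 T^4 + 12 A T^2 + D] ([spectral_polyE]). Hence [h'^2 = Q_l (h / 2)], and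
    [a |-> (h' a, h a / 2)] maps [Y_l] to the curve [W^2 = Q_l (T)]. This map is the
    isomorphism of the last assertion:
    - it is onto, because [h] takes every value ([h_surjective]) and [be - a] has
      the same value of [h] as [a] and the opposite value of [h'];
    - it is injective, because two translates of [h] with the same value and
      derivative at 0 solve the same second order equation, so they coincide and
      the translations differ by a period ([h_injective]);
    - it is an immersion, because a common zero of [h'] and [h''] would force [h] to
      be constant ([h_regular]).
    In these terms the first two assertions concern the projection of
    [W^2 = Q_l (T)] to the [T]-line: its sheets are told apart by the sign of the
    real part of [W / sqrt (Q_l (t))], and it ramifies exactly where [W = 0]. It is
    proper because [h] tends to infinity at [L] ([T_proper]). Properness also
    replaces the inverse function theorem: once the points of a fibre are
    separated by open sets, nearby fibres lie in these sets ([proper_tube]), which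
    gives openness of [T] on the sheets and continuity of the inverse isomorphism.

    The function theory rests on [approx]: uniform limits of polynomials on a
    disc. The class is stable under sums, products and uniform limits, so that it
    contains [zeta] away from its poles ([zeta_split]), the lattice sums being dominated
    by the convergent sum of the [|w|^-3]. Averaging over roots of unity bounds the
    coefficients of a polynomial by its values on a circle ([poly_coef_le]), and this
    bound passes to the limit: Taylor expansions ([approx_taylor]), Cauchy's
    estimate, the local maximum principle and Liouville's theorem follow. *)

(** * Modulus and topology of the complex field *)

Section Modulus.
Variable R : realType.
Local Notation C := (CC R).

Definition md (z : C) : R := complex.Re `|z|.

Lemma norm_md (z : C) : `|z| = (md z)%:C%C.
Proof. by rewrite /md RRe_real // normr_real. Qed.

Lemma md_ge0 z : 0 <= md z.
Proof. by have := normr_ge0 z; rewrite norm_md lecR. Qed.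

Lemma mdM z w : md (z * w) = md z * md w.
Proof. by apply: complexI; rewrite rmorphM -!norm_md normrM. Qed.

Lemma md_eq0 z : (md z == 0) = (z == 0).
Proof.
rewrite -(normr_eq0 z) norm_md; apply/eqP/eqP => [->|]; first by [].
by move=> /complexI.
Qed.

Lemma md_gt0 z : (0 < md z) = (z != 0).
Proof. by rewrite lt_def md_ge0 andbT md_eq0. Qed.

Lemma md0 : md 0 = 0. Proof. by apply/eqP; rewrite md_eq0. Qed.

Lemma md1 : md 1 = 1.
Proof. by rewrite /md normr1. Qed.

Lemma mdN z : md (- z) = md z.
Proof. by rewrite /md normrN. Qed.

Lemma mdBC z w : md (z - w) = md (w - z).
Proof. by rewrite -mdN opprB. Qed.

Lemma mdV z : md z^-1 = (md z)^-1.
Proof.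
have [->|z0] := eqVneq z 0; first by rewrite invr0 md0 invr0.
have m0 : md z != 0 by rewrite md_eq0.
by apply: (mulfI m0); rewrite -mdM !mulfV// md1.
Qed.

Lemma mdX z n : md (z ^+ n) = md z ^+ n.
Proof. by elim: n => [|n IH]; rewrite ?expr0 ?md1// !exprS mdM IH. Qed.

Lemma mdD z w : md (z + w) <= md z + md w.
Proof. by rewrite -lecR rmorphD/= -!norm_md ler_normD. Qed.

Lemma mdB z w : md (z - w) <= md z + md w.
Proof. by rewrite -(mdN w) mdD. Qed.

Lemma md_subr z w : md z - md w <= md (z - w).
Proof. by rewrite lerBlDr -{1}(subrK w z) mdD. Qed.

Lemma md_tri x y z : md (x - z) <= md (x - y) + md (y - z).
Proof. by have := mdD (x - y) (y - z); rewrite addrA subrK. Qed.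

Lemma md_real (a : R) : md a%:C%C = `|a|.
Proof. by rewrite /md normc_def/= expr0n/= addr0 sqrtr_sqr. Qed.

Lemma md_nat n : md n%:R = n%:R.
Proof. by rewrite -[n%:R in LHS](rmorph_nat (real_complex R)) md_real normr_nat. Qed.

Lemma md_sum (I : Type) (s : seq I) (P : pred I) (F : I -> C) :
  md (\sum_(i <- s | P i) F i) <= \sum_(i <- s | P i) md (F i).
Proof.
elim/big_rec2: _ => [|i x y _ h]; first by rewrite md0.
by rewrite (le_trans (mdD _ _)) // lerD2l.
Qed.

Lemma md_Re z : `|complex.Re z| <= md z.
Proof.
rewrite /md normc_def/= -sqrtr_sqr ler_wsqrtr// lerDl sqr_ge0//.
Qed.

Lemma md_Im z : `|complex.Im z| <= md z.
Proof.
rewrite /md normc_def/= -sqrtr_sqr ler_wsqrtr// lerDr sqr_ge0//.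
Qed.

Lemma md_ReIm (a b : R) : md (a +i* b)%C <= `|a| + `|b|.
Proof.
have -> : (a +i* b)%C = a%:C%C + (0 +i* 1)%C * b%:C%C :> C.
  by apply/eqP; rewrite eq_complex /=; apply/andP; split; apply/eqP => /=; ring.
apply: (le_trans (mdD _ _)); rewrite mdM !md_real.
have -> : md (0 +i* 1)%C = 1.
  by rewrite /md normc_def/= expr0n expr1n/= add0r sqrtr1.
by rewrite mul1r.
Qed.

(** The norm of [C] takes its values in [C]; radii are moved to [R], where linear
    arithmetic is available. *)
Lemma nbhsC (z : C) (P : set C) :
  nbhs z P <-> exists2 e : R, 0 < e & forall w, md (w - z) < e -> P w.
Proof.
split=> [/nbhs_ballP[e /= e0 h]|[e e0 h]].
  have ee : (complex.Re e)%:C%C = e by rewrite RRe_real// gtr0_real.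
  exists (complex.Re e) => [|w hw]; first by rewrite -ltcR ee.
  apply: h; rewrite -ball_normE /= distrC norm_md -ee ltcR//.
apply/nbhs_ballP; exists e%:C%C => /=; first by rewrite ltcR.
move=> w; rewrite -ball_normE /= distrC norm_md ltcR; exact: h.
Qed.

Lemma nearC (z : C) (P : set C) (e : R) :
  0 < e -> (forall w, md (w - z) < e -> P w) -> \forall w \near z, P w.
Proof. by move=> e0 h; apply/nbhsC; exists e. Qed.

Lemma openC (P : set C) :
  (forall z, P z -> exists2 e : R, 0 < e & forall w, md (w - z) < e -> P w) ->
  open P.
Proof. by move=> h; rewrite openE => z /h ?; apply/nbhsC. Qed.

Lemma openC_ball (z : C) (e : R) : open [set w | md (w - z) < e].
Proof.
apply: openC => w /= hw; exists (e - md (w - z)); first by rewrite subr_gt0.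
by move=> v hv; rewrite (le_lt_trans (md_tri _ w _))// -ltrBrDr.
Qed.

Lemma dnbhsC (z : C) (P : set C) :
  nbhs z^' P <->
  exists2 e : R, 0 < e & forall w, w != z -> md (w - z) < e -> P w.
Proof.
rewrite /dnbhs /within /=; split.
  by move=> /nbhsC[e e0 h]; exists e => // w wz /h; apply.
by move=> [e e0 h]; apply/nbhsC; exists e => // w hw wz; exact: h.
Qed.

Lemma cvgC (T : Type) (F : set_system T) (f : T -> C) (l : C) : Filter F ->
  (f @ F --> l) <-> (forall e : R, 0 < e -> \forall x \near F, md (f x - l) < e).
Proof.
move=> FF; split=> [fl e e0|h].
  apply: (fl [set w | md (w - l) < e]); apply/nbhsC; exists e => //.
by move=> A /nbhsC[e e0 hA]; apply: (filterS _ (h _ e0)) => x; exact: hA.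
Qed.

Lemma continuousC (T : topologicalType) (f : T -> C) (x : T) :
  {for x, continuous f} <->
  (forall e : R, 0 < e -> \forall y \near x, md (f y - f x) < e).
Proof. exact: cvgC. Qed.

Lemma continuous_md : continuous (md : C -> R).
Proof.
move=> z A /nbhs_ballP[e /= e0 hA]; apply: (nearC e0) => w hw; apply: hA.
rewrite -ball_normE /= ltr_norml; have h1 := md_subr z w; have h2 := md_subr w z.
rewrite (mdBC z w) in h1; apply/andP; split; lra.
Qed.

Lemma complete_C (u : nat -> C) :
  (forall e : R, 0 < e -> exists N, forall n m, (N <= n)%N -> (N <= m)%N ->
     md (u n - u m) < e) ->
  exists l, forall e : R, 0 < e -> exists N, forall n, (N <= n)%N ->
     md (u n - l) < e.
Proof.
move=> cu.
have cR (f : C -> R) : (forall z w, `|f z - f w| <= md (z - w)) ->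
    exists a : R, forall e : R, 0 < e -> exists N, forall n, (N <= n)%N ->
     `|f (u n) - a| < e.
  move=> hf.
  have /cauchy_cvgP : cauchy ((f \o u) @ \oo).
    apply/cauchy_ballP => e e0.
    have [N hN] := cu _ e0.
    exists ([set x | exists2 n, (N <= n)%N & x = f (u n)],
            [set x | exists2 n, (N <= n)%N & x = f (u n)]) => /=.
      by split; exists N => // n /= hn; exists n.
    move=> [_ _] /= [[n hn ->] [m hm ->]].
    by rewrite -ball_normE /=; apply: le_lt_trans (hf _ _) _; exact: hN.
  move=> /cvg_ex[a /= ha]; exists a => e e0.
  move/cvgrPdist_lt : ha => /(_ _ e0)[N _ hN].
  by exists N => n /hN /=; rewrite distrC.
have [|a ha] := cR (@complex.Re R).
  by move=> z w; rewrite (le_trans _ (md_Re _))// raddfB.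
have [|b hb] := cR (@complex.Im R).
  by move=> z w; rewrite (le_trans _ (md_Im _))// raddfB.
exists (a +i* b)%C => e e0.
have e2 : 0 < e / 2 by rewrite divr_gt0.
have [N1 h1] := ha _ e2; have [N2 h2] := hb _ e2.
exists (maxn N1 N2) => n; rewrite geq_max => /andP[/h1 k1 /h2 k2].
have -> : u n - (a +i* b)%C
    = ((complex.Re (u n) - a) +i* (complex.Im (u n) - b))%C by case: (u n).
apply: (le_lt_trans (md_ReIm _ _)); lra.
Qed.

Lemma continuous_complexD (a b : C) :
  continuous (fun p : R * R => a * p.1%:C%C + b * p.2%:C%C).
Proof.
move=> p; apply/continuousC => e e0.
pose B := md a + md b + 1.
have B0 : 0 < B by have := md_ge0 a; have := md_ge0 b; rewrite /B; lra.
have d0 : 0 < e / B by rewrite divr_gt0.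
apply/nbhs_ballP; exists (e / B) => //= q [/= q1 q2].
rewrite -ball_normE /= in q1; rewrite -ball_normE /= in q2.
have -> : a * q.1%:C%C + b * q.2%:C%C - (a * p.1%:C%C + b * p.2%:C%C) =
  a * (q.1 - p.1)%:C%C + b * (q.2 - p.2)%:C%C by rewrite !rmorphB/=; ring.
apply: (le_lt_trans (mdD _ _)); rewrite !mdM !md_real.
rewrite distrC in q1; rewrite distrC in q2.
have -> : e = e / B * B by field; rewrite gt_eqF.
have := md_ge0 a; have := md_ge0 b; rewrite {2}/B.
set x := `|q.1 - _| in q1 *; set y := `|q.2 - _| in q2 *.
have x0 : 0 <= x by exact: normr_ge0.
have y0 : 0 <= y by exact: normr_ge0.
set d := e / B in d0 q1 q2 *.
move: (md a) (md b) => ma mb hb ha; nra.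
Qed.

Lemma compact_parallelogram (a b : C) (A B : R) :
  compact [set z | exists p : R * R,
    [/\ - A <= p.1 <= A, - B <= p.2 <= B & z = a * p.1%:C%C + b * p.2%:C%C]].
Proof.
have -> : [set z | exists p : R * R,
    [/\ - A <= p.1 <= A, - B <= p.2 <= B & z = a * p.1%:C%C + b * p.2%:C%C]]
  = [set a * p.1%:C%C + b * p.2%:C%C | p in `[-A, A] `*` `[-B, B]].
  apply/seteqP; split => z /=.
    by move=> [p [h1 h2 ->]]; exists p => //=; split; rewrite /= in_itv.
  by move=> [p /= [h1 h2] <-]; exists p; rewrite !in_itv /= in h1, h2; split.
apply: continuous_compact.
  by apply: continuous_subspaceT; exact: continuous_complexD.
by apply: compact_setX; exact: segment_compact.
Qed.

Lemma compact_disc (B : R) : compact [set z : C | md z <= B].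
Proof.
apply: (subclosed_compact _ (@compact_parallelogram 1 'i%C B B)).
  rewrite (_ : mkset _ = md @^-1` [set x | x <= B]) //.
  by apply: closed_comp => [z _|]; [exact: continuous_md|exact: closed_le].
move=> z /= hz; exists (complex.Re z, complex.Im z); rewrite -!ler_norml; split.
- by rewrite (le_trans (md_Re _)).
- by rewrite (le_trans (md_Im _)).
- by rewrite mul1r -complexE.
Qed.

(** Connectedness of the plane: on the segment from [z0] to [z], [P] cuts out an
    open and closed set of parameters. *)
Lemma clopenC (P : set C) (z0 : C) : P z0 ->
  (forall z, P z -> exists2 e : R, 0 < e & forall w, md (w - z) < e -> P w) ->
  (forall z, (forall e : R, 0 < e -> exists2 w, md (w - z) < e & P w) -> P z) ->
  forall z, P z.
Proof.
move=> P0 oP cP z.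
pose f (t : R) : C := z0 + (z - z0) * t%:C%C.
have cf : continuous f.
  move=> t; apply/continuousC => e e0.
  pose B := md (z - z0) + 1.
  have B0 : 0 < B by have := md_ge0 (z - z0); rewrite /B; lra.
  apply/nbhs_ballP; exists (e / B); first by rewrite /= divr_gt0.
  move=> s; rewrite -ball_normE /= distrC => hs.
  have -> : f s - f t = (z - z0) * (s - t)%:C%C by rewrite /f rmorphB/=; ring.
  rewrite mdM md_real.
  have -> : e = e / B * B by field; rewrite gt_eqF.
  have := md_ge0 (z - z0); have := normr_ge0 (s - t).
  have : 0 < e / B by rewrite divr_gt0.
  rewrite {3}/B; move: (md _) (`|_|) (e / B) hs => m x d; nra.
have cT : connected [set: R] by apply/connected_intervalP.
have opn : open (f @^-1` P).
  apply: open_comp => [t _|]; [exact: cf|exact: openC].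
have cls : closed (f @^-1` P).
  apply: closed_comp => [t _|]; first exact: cf.
  move=> w hw; apply: cP => e e0.
  have [v [Pv hv]] := hw _ ((nbhsC w [set v | md (v - w) < e]).2 (ex_intro2 _ _ e e0 (fun v h => h))).
  by exists v.
have : f @^-1` P = setT.
  have := cT; rewrite /connected; apply.
  - by exists 0 => /=; rewrite /f mulr0 addr0.
  - by exists (f @^-1` P) => //; rewrite setTI.
  - by exists (f @^-1` P) => //; rewrite setTI.
move=> /seteqP[_ /(_ 1 I)] /=; rewrite /f mulr1 addrC subrK //.
Qed.

End Modulus.

(** * Uniform limits of polynomials *)

Section Approx.
Variable R : realType.
Local Notation C := (CC R).
Local Notation md := (@md R).

Lemma prim_root_exists_C n : (0 < n)%N -> exists z : C, n.-primitive_root z.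
Proof.
move=> n0; pose p : {poly C} := 'X^n - 1; have [r Dp] := closed_field_poly_normal p.
rewrite (monicP _) ?monicXnsubC // scale1r in Dp.
have rn1 : all n.-unity_root r by apply/allP => z; rewrite -root_prod_XsubC -Dp.
have sr : (n < (size r).+1)%N.
  by rewrite -(size_prod_XsubC r id) -Dp size_XnsubC.
have [|z] := hasP (has_prim_root n0 rn1 _ sr); last by exists z.
by rewrite -separable_prod_XsubC -Dp separable_Xn_sub_1 // pnatr_eq0 -lt0n.
Qed.

(** Averaging [p] over the [N]-th roots of unity on the circle, against the
    [k]-th character, isolates the [k]-th coefficient once [N] exceeds the
    degree. *)
Lemma poly_coef_le (p : {poly C}) (r B : R) k : 0 < r ->
  (forall u, md u = r -> md p.[u] <= B) -> md p`_k * r ^+ k <= B.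
Proof.
move=> r0 hB.
pose N := (size p + k).+1.
have [z pz] := prim_root_exists_C (ltn0Sn (size p + k) : (0 < N)%N).
have mz : md z = 1.
  have : md z ^+ N = 1 by rewrite -mdX (prim_expr_order pz) md1.
  by move=> /eqP; rewrite pexpr_eq1 ?md_ge0// => /eqP.
have r0' : r != 0 by rewrite gt_eqF.
have e1 : \sum_(j < N) p.[r%:C%C * z ^+ j] * z ^+ (j * (N - k))
        = N%:R * (p`_k * r%:C%C ^+ k).
  under eq_bigr => j _ do rewrite horner_coef mulr_suml.
  rewrite exchange_big /=.
  have key (i : nat) : (i < size p)%N ->
     \sum_(j < N) p`_i * (r%:C%C * z ^+ j) ^+ i * z ^+ (j * (N - k)) =
     (if i == k then N%:R else 0) * (p`_i * r%:C%C ^+ i).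
    move=> hi.
    have -> : \sum_(j < N) p`_i * (r%:C%C * z ^+ j) ^+ i * z ^+ (j * (N - k))
      = (\sum_(j < N) (z ^+ (i + (N - k))) ^+ j) * (p`_i * r%:C%C ^+ i).
      rewrite mulr_suml; apply: eq_bigr => j _.
      rewrite exprMn -!exprM mulnDl exprD (mulnC i j) (mulnC (N - k)%N j).
      ring.
    congr (_ * _); case: ifP => [/eqP ik|/negbT ik].
      have -> : z ^+ (i + (N - k)) = 1.
        by rewrite ik subnKC ?(prim_expr_order pz)// /N; lia.
      by under eq_bigr do rewrite expr1n; rewrite sumr_const card_ord.
    set x := z ^+ _.
    have x1 : x - 1 != 0.
      rewrite subr_eq0 /x -(prim_order_dvd pz); apply/negP => /dvdnP[q].
      move: hi ik; rewrite /N; case: q => [|[|q]]; lia.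
    apply: (mulfI x1); rewrite mulr0 -subrX1 /x -exprM mulnC exprM.
    by rewrite (prim_expr_order pz) expr1n subrr.
  transitivity (\sum_(i < size p) (if (i : nat) == k then N%:R else 0) * (p`_i * r%:C%C ^+ i) : C).
    by apply: eq_bigr => i _; exact: key.
  have [kp|kp] := ltnP k (size p).
    rewrite (bigD1 (Ordinal kp)) //= eqxx big1 ?addr0// => i ik.
    rewrite ifF ?mul0r//; apply/negbTE; apply: contra ik => /eqP ik.
    by apply/eqP/val_inj.
  rewrite nth_default// mul0r mulr0 big1// => i _; rewrite ifF ?mul0r//.
  by apply/negbTE; rewrite neq_ltn (leq_trans (ltn_ord i) kp).
have e2 : md (N%:R * (p`_k * r%:C%C ^+ k)) <= N%:R * B.
  rewrite -e1 (le_trans (md_sum _ _ _))//.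
  have -> : N%:R * B = \sum_(j < N) B by rewrite sumr_const card_ord mulr_natl.
  apply: ler_sum => j _; rewrite mdM !mdX mz expr1n mulr1; apply: hB.
  by rewrite mdM mdX mz expr1n mulr1 md_real gtr0_norm.
move: e2; rewrite !mdM mdX md_nat md_real gtr0_norm//.
by rewrite ler_pM2l// ltr0n.
Qed.

Lemma geometric_half_le2 (q : R) n : 0 <= q <= 1 / 2 -> \sum_(j < n) q ^+ j <= 2.
Proof.
move=> /andP[q0 q1]; elim: n => [|n IH]; first by rewrite big_ord0.
rewrite big_ord_recl expr0.
under eq_bigr do rewrite lift0 exprS.
rewrite -mulr_sumr.
have : 0 <= \sum_(i < n) q ^+ i by apply: sumr_ge0 => i _; rewrite exprn_ge0.
move: (\sum_(_ < _) _) IH => S; nra.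
Qed.

(** Uniform limits of polynomials on the disc of centre [c] and radius [r]; the
    polynomials are written in the variable [z - c]. Up to shrinking the disc,
    these are the holomorphic functions, and the class is visibly stable under
    sums, products and uniform limits. *)
Definition approx (c : C) (r : R) (f : C -> C) := forall e : R, 0 < e ->
  exists p : {poly C}, forall u, md u < r -> md (f (c + u) - p.[u]) < e.

(** [a] is the sequence of Taylor coefficients of [f] at [c], with a geometric
    bound on the remainders on the disc of radius [r]. *)
Definition taylor (c : C) (r : R) (a : nat -> C) (M : R) (f : C -> C) :=
  (forall k, md (a k) * r ^+ k <= M) /\
  forall u, md u < r -> forall K,
    md (f (c + u) - \sum_(k < K) a k * u ^+ k) <= M * (md u / r) ^+ K.

Definition analytic (f : C -> C) (c : C) := exists2 r : R, 0 < r & approx c r f.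

(** By [poly_coef_le], the coefficients of close approximating polynomials are
    close; [a k] is the limit of the [k]-th coefficients. *)
Lemma coef_exists c r f : 0 < r -> approx c r f ->
  exists a : nat -> C, forall k (p : {poly C}) (e : R), 0 < e ->
    (forall u, md u < r -> md (f (c + u) - p.[u]) <= e) ->
    md (a k - p`_k) * (r / 2) ^+ k <= e.
Proof.
move=> r0 hf.
have r2 : 0 < r / 2 by lra.
have dif (p q : {poly C}) (e e' : R) k :
    (forall u, md u < r -> md (f (c + u) - p.[u]) <= e) ->
    (forall u, md u < r -> md (f (c + u) - q.[u]) <= e') ->
    md (p`_k - q`_k) * (r / 2) ^+ k <= e + e'.
  move=> hp hq; rewrite -coefB; apply: poly_coef_le => // u hu.
  have ur : md u < r by rewrite hu; lra.
  rewrite hornerD hornerN; have := hp _ ur; have := hq _ ur.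
  have := md_tri p.[u] (f (c + u)) q.[u]; rewrite (mdBC p.[u] (f _)); lra.
have e_pos n : 0 < (n.+1%:R^-1 : R) by rewrite invr_gt0.
pose p n := projT1 (cid (hf _ (e_pos n))).
have hp n u : md u < r -> md (f (c + u) - (p n).[u]) <= n.+1%:R^-1.
  by move=> ur; apply/ltW; rewrite /p; case: cid => /= ? ; apply.
have small (e : R) : 0 < e -> exists N, forall n, (N <= n)%N -> n.+1%:R^-1 < e.
  move=> e0; exists (Num.bound e^-1) => n hn.
  rewrite -[e]invrK ltf_pV2 ?posrE ?invr_gt0//.
  apply: (lt_le_trans (archi_boundP _)); first by rewrite invr_ge0 ltW.
  by rewrite ler_nat; lia.
have lim k : exists l, forall e : R, 0 < e -> exists N, forall n, (N <= n)%N ->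
     md ((p n)`_k - l) < e.
  apply: complete_C => e e0.
  have [|N hN] := small (e / 2 * (r / 2) ^+ k).
    by rewrite mulr_gt0 ?exprn_gt0// divr_gt0.
  exists N => n m /hN hn /hN hm.
  have := dif _ _ _ _ k (hp n) (hp m).
  have rk : 0 < (r / 2) ^+ k by rewrite exprn_gt0.
  move: ((r / 2) ^+ k) rk (md _) hn hm => t t0 x hn hm hx.
  rewrite -(ltr_pM2r t0); set d1 := n.+1%:R^-1 in hn hx; set d2 := m.+1%:R^-1 in hm hx. lra.
pose a k := projT1 (cid (lim k)).
exists a => k q e e0 hq.
have := projT2 (cid (lim k)); rewrite -/(a k) => ha.
apply/ler_addgt0Pr => d d0.
have rk : 0 < (r / 2) ^+ k by rewrite exprn_gt0.
have [|N1 h1] := ha (d / 2 / (r / 2) ^+ k); first by rewrite !divr_gt0.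
have [|N2 h2] := small (d / 2); first by rewrite divr_gt0.
have hn1 := h1 _ (leq_maxl N1 N2); have hn2 := h2 _ (leq_maxr N1 N2).
set n := maxn _ _ in hn1 hn2.
have hd := dif _ _ _ _ k (hp n) hq.
have ht := md_tri (a k) (p n)`_k q`_k.
rewrite (mdBC (a k) (p n)`_k) in ht; rewrite ltr_pdivlMr // in hn1.
apply: le_trans (_ : (md ((p n)`_k - a k) + md ((p n)`_k - q`_k)) * (r / 2) ^+ k <= _).
  by rewrite ler_wpM2r// ltW.
rewrite mulrDl; set d2 := _.+1%:R^-1 in hn2 hd; lra.
Qed.

(** On a smaller disc the tails of all the approximating polynomials are bounded
    by one geometric series, and so is the tail of their limit. *)
Lemma approx_taylor c r f B : 0 < r -> approx c r f ->
  (forall u, md u < r -> md (f (c + u)) <= B) ->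
  exists a, taylor c (r / 4) a (2 * B) f.
Proof.
move=> r0 hf hB; have [a ha] := coef_exists r0 hf.
have r2 : 0 < r / 2 by lra.
have B0 : 0 <= B by rewrite (le_trans (md_ge0 _) (hB 0 _))// md0.
have pcoef e p k : (forall u, md u < r -> md (f (c + u) - p.[u]) < e) ->
    md p`_k * (r / 2) ^+ k <= B + e.
  move=> hp; apply: poly_coef_le => // u hu; have ur : md u < r by rewrite hu; lra.
  have := hp _ ur; have := hB _ ur; have := md_subr p.[u] (f (c + u)).
  rewrite mdBC; lra.
have acoef k : md (a k) * (r / 2) ^+ k <= B.
  apply/ler_addgt0Pr => e e0; have e2 : 0 < e / 2 by lra.
  have [p hp] := hf _ e2.
  have h1 := ha k p _ e2 (fun u hu => ltW (hp u hu)).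
  have h2 := pcoef _ _ k hp.
  have := md_subr (a k) p`_k; have rk : 0 < (r / 2) ^+ k by rewrite exprn_gt0.
  move: ((r / 2) ^+ k) rk h1 h2 => t t0 h1 h2 h3.
  suff : md (a k) * t <= (md (a k - p`_k) + md p`_k) * t by rewrite mulrDl; lra.
  by rewrite (ler_wpM2r (ltW t0)); lra.
exists a; split=> [k|u hu K].
  apply: le_trans (_ : B <= _); last by lra.
  apply: le_trans (acoef k); rewrite ler_wpM2l ?md_ge0// lerXn2r// ?nnegrE; lra.
set q := md u / (r / 2).
have q0 : 0 <= q by rewrite divr_ge0 ?md_ge0// ltW.
have q12 : q <= 1 / 2 by rewrite ler_pdivrMr//; lra.
have qb : q <= md u / (r / 4).
  by rewrite ler_wpM2l ?md_ge0// lef_pV2 ?posrE//; lra.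
have qK : q ^+ K <= (md u / (r / 4)) ^+ K.
  by rewrite lerXn2r// nnegrE// divr_ge0 ?md_ge0//; lra.
apply: le_trans (_ : 2 * B * q ^+ K <= _); last by rewrite ler_wpM2l//; lra.
have mdu k : md u ^+ k = (r / 2) ^+ k * q ^+ k.
  by rewrite -exprMn /q mulrCA divff ?mulr1// gt_eqF.
apply/ler_addgt0Pr => e e0; have e5 : 0 < e / 5 by lra.
have [p hp] := hf _ e5.
have ur : md u < r by lra.
have -> : f (c + u) - \sum_(k < K) a k * u ^+ k = (f (c + u) - p.[u]) +
   \sum_(j < size p) p`_(K + j) * u ^+ (K + j) + \sum_(k < K) (p`_k - a k) * u ^+ k.
  have : p.[u] = \sum_(k < K) p`_k * u ^+ k +
                 \sum_(j < size p) p`_(K + j) * u ^+ (K + j).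
    by rewrite (@horner_coef_wide _ (K + size p)) ?leq_addl// big_split_ord.
  move=> ->; under [X in _ = _ + X]eq_bigr do rewrite mulrBl.
  rewrite sumrB; ring.
apply: le_trans (mdD _ _) _.
apply: le_trans (_ : (e / 5 + (B + e / 5) * q ^+ K * 2) + e / 5 * 2 <= _); last first.
  have : q ^+ K <= 1 by rewrite exprn_ile1//; lra.
  have : 0 <= q ^+ K by rewrite exprn_ge0.
  move: (q ^+ K) => Q; nra.
apply: lerD.
  apply: le_trans (mdD _ _) _; apply: lerD; first exact/ltW/hp.
  apply: le_trans (md_sum _ _ _) _.
  apply: le_trans (_ : \sum_(j < size p) (B + e / 5) * q ^+ K * q ^+ j <= _).
    apply: ler_sum => j _; rewrite mdM mdX mdu mulrA -[leRHS]mulrA -exprD.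
    by rewrite ler_wpM2r ?exprn_ge0// pcoef.
  rewrite -mulr_sumr ler_wpM2l//; last by rewrite geometric_half_le2// q0.
  by rewrite mulr_ge0 ?exprn_ge0//; lra.
apply: le_trans (md_sum _ _ _) _.
apply: le_trans (_ : \sum_(k < K) e / 5 * q ^+ k <= _).
  apply: ler_sum => j _; rewrite mdM mdX mdu mulrA.
  by rewrite ler_wpM2r ?exprn_ge0// mdBC ha// => v /hp /ltW.
by rewrite -mulr_sumr ler_wpM2l ?geometric_half_le2 ?q0//; lra.
Qed.

Lemma pow_half_small (M e : R) : 0 < e -> exists K, M * (1 / 2) ^+ K < e.
Proof.
move=> e0; exists (Num.bound (`|M| / e)).
have : `|M| / e < (Num.bound (`|M| / e))%:R.
  by apply: archi_boundP; rewrite divr_ge0// ltW.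
move: (Num.bound _) => K hK.
have : (K%:R : R) <= 2 ^+ K by rewrite -natrX ler_nat; exact/ltnW/ltn_expl.
rewrite ltr_pdivrMr// in hK; rewrite expr_div_n expr1n mul1r => h2.
rewrite ltr_pdivrMr ?exprn_gt0//; have := ler_norm M.
nra.
Qed.

Lemma taylor_approx c r a M f : 0 < r -> taylor c r a M f -> approx c (r / 2) f.
Proof.
move=> r0 [_ h] e e0; have [K hK] := pow_half_small M e0.
exists (\poly_(k < K) a k) => u hu; rewrite horner_poly.
have ur : md u < r by lra.
apply: le_lt_trans (h _ ur K) (le_lt_trans _ hK).
have M0 : 0 <= M by have := h _ ur 0; rewrite expr0 mulr1; apply: le_trans (md_ge0 _).
rewrite ler_wpM2l// lerXn2r// ?nnegrE ?divr_ge0 ?md_ge0// ?ltW//.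
by rewrite ltr_pdivrMr//; lra.
Qed.

Lemma approx_bounded c r f : 0 < r -> approx c r f ->
  exists2 B, 0 < B & forall u, md u < r -> md (f (c + u)) <= B.
Proof.
move=> r0 hf; have [p hp] := hf 1 ltr01.
have S0 : 0 <= \sum_(k < size p) md p`_k * r ^+ k.
  by apply: sumr_ge0 => k _; rewrite mulr_ge0 ?md_ge0 ?exprn_ge0 ?ltW.
exists (1 + \sum_(k < size p) md p`_k * r ^+ k); first lra.
move=> u hu; have := hp _ hu; have := md_subr (f (c + u)) p.[u].
suff : md p.[u] <= \sum_(k < size p) md p`_k * r ^+ k by lra.
rewrite horner_coef (le_trans (md_sum _ _ _))//; apply: ler_sum => k _.
by rewrite mdM mdX ler_wpM2l ?md_ge0// lerXn2r ?nnegrE ?md_ge0// ltW.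
Qed.

Lemma analytic_taylor f c : analytic f c ->
  exists r a M, 0 < r /\ taylor c r a M f.
Proof.
move=> [r r0 hf]; have [B _ hB] := approx_bounded r0 hf.
have [a ha] := approx_taylor r0 hf hB.
by exists (r / 4), a, (2 * B); split => //; lra.
Qed.

Lemma taylor_analytic c r a M f : 0 < r -> taylor c r a M f -> analytic f c.
Proof. by move=> r0 h; exists (r / 2); [lra|exact: taylor_approx h]. Qed.

Lemma approx_sub c r c' r' f : approx c r f -> md (c' - c) + r' <= r -> approx c' r' f.
Proof.
move=> hf hr e /hf[p hp]; exists (p \Po ('X + (c' - c)%:P)) => u hu.
rewrite horner_comp hornerD hornerX hornerC.
have -> : c' + u = c + (u + (c' - c)) by ring.
by apply: hp; rewrite (le_lt_trans (mdD _ _))//; lra.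
Qed.

Lemma approx_le c r r' f : approx c r f -> r' <= r -> approx c r' f.
Proof. by move=> hf h; apply: approx_sub hf _; rewrite subrr md0 add0r. Qed.

Lemma approx_eq c r f g : (forall u, md u < r -> f (c + u) = g (c + u)) ->
  approx c r f -> approx c r g.
Proof. by move=> h hf e /hf[p hp]; exists p => u hu; rewrite -h// hp. Qed.

Lemma approx_poly c r (p : {poly C}) : approx c r (fun z => p.[z - c]).
Proof.
by move=> e e0; exists p => u _; rewrite addrAC subrr add0r subrr md0.
Qed.

Lemma approx_cst c r a : approx c r (fun=> a).
Proof. by move=> e e0; exists a%:P => u _; rewrite hornerC subrr md0. Qed.

Lemma approx_id c r : approx c r (fun z => z).
Proof. by move=> e e0; exists ('X + c%:P) => u _; rewrite hornerD hornerX hornerC (addrC u) subrr md0. Qed.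

Lemma approxD c r f g : approx c r f -> approx c r g ->
  approx c r (fun z => f z + g z).
Proof.
move=> hf hg e e0; have e2 : 0 < e / 2 by lra.
have [p hp] := hf _ e2; have [q hq] := hg _ e2; exists (p + q) => u hu.
rewrite hornerD; have -> : f (c + u) + g (c + u) - (p.[u] + q.[u]) =
  (f (c + u) - p.[u]) + (g (c + u) - q.[u]) by ring.
have := hp _ hu; have := hq _ hu; have := mdD (f (c + u) - p.[u]) (g (c + u) - q.[u]); lra.
Qed.

Lemma approxM c r f g : 0 < r -> approx c r f -> approx c r g ->
  approx c r (fun z => f z * g z).
Proof.
move=> r0 hf hg e e0.
have [B B0 hB] := approx_bounded r0 hf; have [D D0 hD] := approx_bounded r0 hg.
pose d := Num.min 1 (e / (B + D + 1)).
have E0 : 0 < e / (B + D + 1) by rewrite divr_gt0//; lra.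
have d0 : 0 < d by rewrite lt_min ltr01.
have [p hp] := hf _ d0; have [q hq] := hg _ d0; exists (p * q) => u hu.
rewrite hornerM; have -> : f (c + u) * g (c + u) - p.[u] * q.[u] =
  f (c + u) * (g (c + u) - q.[u]) + (f (c + u) - p.[u]) * g (c + u)
  - (f (c + u) - p.[u]) * (g (c + u) - q.[u]) by ring.
have := hp _ hu; have := hq _ hu; have := hB _ hu; have := hD _ hu.
set x := f (c + u) - p.[u]; set y := g (c + u) - q.[u] => h1 h2 h3 h4.
apply: le_lt_trans (mdB _ _) _; apply: le_lt_trans (lerD (mdD _ _) (lexx _)) _.
rewrite !mdM.
have d1 : d <= 1 by rewrite ge_min lexx.
have de : d * (B + D + 1) <= e by rewrite -ler_pdivlMr ?ge_min ?lexx ?orbT//; lra.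
have := md_ge0 x; have := md_ge0 y; have := md_ge0 (f (c + u)); have := md_ge0 (g (c + u)).
move: (md x) (md y) (md (f _)) (md (g _)) h1 h2 h3 h4 => X Y F G *.
have : F * Y <= B * Y by rewrite ler_wpM2r.
have : X * G <= X * D by rewrite ler_wpM2l.
have : B * Y < B * d by rewrite ltr_pM2l.
have : X * D < d * D by rewrite ltr_pM2r.
have : X * Y <= d * 1 by rewrite ler_pM//; lra.
lra.
Qed.

Lemma approx_lim c r f :
  (forall e : R, 0 < e -> exists2 g, approx c r g &
     forall u, md u < r -> md (f (c + u) - g (c + u)) <= e) ->
  approx c r f.
Proof.
move=> h e e0; have e2 : 0 < e / 2 by lra.
have [g hg fg] := h _ e2; have [p hp] := hg _ e2; exists p => u hu.
have := hp _ hu; have := fg _ hu; have := md_tri (f (c + u)) (g (c + u)) p.[u]; lra.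
Qed.

Lemma approx_sum c r (I : Type) (s : seq I) (P : pred I) (F : I -> C -> C) :
  (forall i, P i -> approx c r (F i)) ->
  approx c r (fun z => \sum_(i <- s | P i) F i z).
Proof.
move=> h; elim: s => [|i s IH].
  by apply: approx_eq (@approx_cst c r 0) => u _; rewrite big_nil.
case: (boolP (P i)) => Pi.
  by apply: approx_eq (approxD (h i Pi) IH) => u _; rewrite big_cons Pi.
by apply: approx_eq IH => u _; rewrite big_cons (negbTE Pi).
Qed.

Lemma approxX c r f n : 0 < r -> approx c r f -> approx c r (fun z => f z ^+ n).
Proof.
move=> r0 hf; elim: n => [|n IH].
  by apply: approx_eq (@approx_cst c r 1) => u _; rewrite expr0.
by apply: approx_eq (approxM r0 hf IH) => u _; rewrite exprS.
Qed.

(** The inverse is [1 / v] times the geometric series in [1 - f / v]. *)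
Lemma approxV c r f v : 0 < r -> v != 0 -> approx c r f ->
  (forall u, md u < r -> md (1 - f (c + u) / v) <= 1 / 2) ->
  approx c r (fun z => (f z)^-1).
Proof.
move=> r0 v0 hf h; apply: approx_lim => e e0.
have [K hK] := pow_half_small (2 / md v) e0.
have hx : approx c r (fun z => 1 + (- v^-1) * f z).
  by apply: approxD (@approx_cst _ _ _) (approxM r0 (@approx_cst _ _ _) hf).
exists (fun z => v^-1 * \sum_(j < K) (1 + (- v^-1) * f z) ^+ j).
  apply: approxM => //; first exact: approx_cst.
  by apply: approx_sum => j _; exact: approxX.
move=> u hu; have := h _ hu.
set x := 1 - f (c + u) / v => hx2.
have -> : 1 + (- v^-1) * f (c + u) = x by rewrite /x; ring.
have mx : 1 / 2 <= md (1 - x).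
  by have := md_subr 1 x; rewrite md1; lra.
have x1 : 1 - x != 0 by rewrite -md_gt0; lra.
have fx : f (c + u) = v * (1 - x) by rewrite /x; field.
have -> : (f (c + u))^-1 - v^-1 * \sum_(j < K) x ^+ j = v^-1 * (x ^+ K / (1 - x)).
  have -> : \sum_(j < K) x ^+ j = (1 - x ^+ K) / (1 - x).
    apply: (mulIf x1); rewrite divfK// -[1 - x]opprB -[1 - x ^+ K]opprB subrX1; ring.
  rewrite fx; field; by rewrite x1 v0.
rewrite !mdM !mdV mdX; apply: le_trans (ltW hK).
have v0' : 0 < md v by rewrite md_gt0.
rewrite [2 / _]mulrC -mulrA; apply: ler_wpM2l; first by rewrite invr_ge0 ltW.
rewrite mulrC; apply: ler_pM; rewrite ?invr_ge0 ?exprn_ge0 ?md_ge0//.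
  by rewrite -[2]invrK lef_pV2 ?posrE//; lra.
by rewrite lerXn2r// ?nnegrE ?md_ge0//; lra.
Qed.

End Approx.

(** * Analytic functions *)

Section Analytic.
Variable R : realType.
Local Notation C := (CC R).
Local Notation md := (@md R).

Lemma analytic_near (f g : C -> C) c :
  (\forall z \near c, f z = g z) -> analytic f c -> analytic g c.
Proof.
move=> /nbhsC[e e0 h] [r r0 hf]; exists (Num.min e r); first by rewrite lt_min e0.
apply: (@approx_eq _ _ _ f); last by apply: approx_le hf _; rewrite ge_min lexx orbT.
by move=> u; rewrite lt_min => /andP[ue _]; apply: h; rewrite addrAC subrr add0r.
Qed.

Lemma analytic2 (f g : C -> C) c : analytic f c -> analytic g c ->
  exists r, [/\ 0 < r, approx c r f & approx c r g].
Proof.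
move=> [r r0 hf] [s s0 hg]; exists (Num.min r s); split.
- by rewrite lt_min r0.
- by apply: approx_le hf _; rewrite ge_min lexx.
- by apply: approx_le hg _; rewrite ge_min lexx orbT.
Qed.

Lemma analytic_cst (a c : C) : analytic (fun=> a) c.
Proof. by exists 1 => //; exact: approx_cst. Qed.

Lemma analytic_id (c : C) : analytic (fun z => z) c.
Proof. by exists 1 => //; exact: approx_id. Qed.

Lemma analyticD (f g : C -> C) c : analytic f c -> analytic g c ->
  analytic (fun z => f z + g z) c.
Proof. by move=> hf /(analytic2 hf)[r [r0 ? ?]]; exists r => //; exact: approxD. Qed.

Lemma analyticM (f g : C -> C) c : analytic f c -> analytic g c ->
  analytic (fun z => f z * g z) c.
Proof. by move=> hf /(analytic2 hf)[r [r0 ? ?]]; exists r => //; exact: approxM. Qed.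

Lemma analyticN (f : C -> C) c : analytic f c -> analytic (fun z => - f z) c.
Proof.
move=> hf; apply: analytic_near (analyticM (analytic_cst (-1) c) hf).
by near=> z; rewrite mulN1r.
Unshelve. all: by end_near. Qed.

Lemma analyticB (f g : C -> C) c : analytic f c -> analytic g c ->
  analytic (fun z => f z - g z) c.
Proof. by move=> hf hg; exact: (analyticD hf (analyticN hg)). Qed.

Lemma analyticX (f : C -> C) c n : analytic f c -> analytic (fun z => f z ^+ n) c.
Proof. by move=> [r r0 hf]; exists r => //; exact: approxX. Qed.

Lemma analytic_sum (I : Type) (s : seq I) (P : pred I) (F : I -> C -> C) c :
  (forall i, P i -> analytic (F i) c) ->
  analytic (fun z => \sum_(i <- s | P i) F i z) c.
Proof.
move=> h; elim: s => [|i s IH].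
  by apply: analytic_near (analytic_cst 0 c); near=> z; rewrite big_nil.
case: (boolP (P i)) => Pi.
  by apply: analytic_near (analyticD (h i Pi) IH); near=> z; rewrite big_cons Pi.
by apply: analytic_near IH; near=> z; rewrite big_cons (negbTE Pi).
Unshelve. all: by end_near. Qed.

Lemma analytic_cont (f : C -> C) c : analytic f c -> {for c, continuous f}.
Proof.
move=> /analytic_taylor[r [a [M [r0 [ha h]]]]].
have f0 : f c = a 0.
  have := h 0 _ 1; rewrite md0 mul0r expr1 mulr0 addr0 big_ord1 expr0 mulr1.
  move=> /(_ r0) h1; apply/eqP; rewrite -subr_eq0 -md_eq0.
  by rewrite eq_le h1 md_ge0.
have M0 : 0 <= M by have := ha 0; rewrite expr0 mulr1; apply: le_trans (md_ge0 _).
apply/continuousC => e e0.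
have d0 : 0 < Num.min r (e * r / (M + 1)).
  by rewrite lt_min r0 divr_gt0// ?mulr_gt0//; lra.
apply: (nearC d0) => w; rewrite lt_min => /andP[w1 w2].
have := h _ w1 1; rewrite subrKC big_ord1 expr0 mulr1 expr1 f0 => h1.
apply: (le_lt_trans h1); rewrite mulrA ltr_pdivrMr//.
rewrite ltr_pdivlMr in w2; last lra.
have := md_ge0 (w - c); nra.
Qed.

Lemma analytic_neq0 (f : C -> C) c : analytic f c -> f c != 0 ->
  \forall z \near c, f z != 0.
Proof.
move=> /analytic_cont /continuousC h fc.
have mf : 0 < md (f c) by rewrite md_gt0.
apply: filterS (h _ mf) => z hz; rewrite -md_gt0.
have := md_subr (f c) (f z); rewrite mdBC; lra.
Qed.

Lemma analytic_inv (f : C -> C) c : analytic f c -> f c != 0 ->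
  analytic (fun z => (f z)^-1) c.
Proof.
move=> hf fc; have /continuousC h := analytic_cont hf.
have mf : 0 < md (f c) by rewrite md_gt0.
have [|e e0 he] := (nbhsC _ _).1 (h (md (f c) / 2) _); first lra.
case: hf => r r0 hf; have d0 : 0 < Num.min e r by rewrite lt_min e0.
exists (Num.min e r) => //; apply: (approxV d0 fc).
  by apply: approx_le hf _; rewrite ge_min lexx orbT.
move=> u; rewrite lt_min => /andP[ue _].
have -> : 1 - f (c + u) / f c = - ((f (c + u) - f c) / f c) by field.
rewrite mdN mdM mdV ler_pdivrMr//.
have := he (c + u); rewrite addrAC subrr add0r => /(_ ue) /=; lra.
Qed.

Lemma analytic_open (f : C -> C) c : analytic f c ->
  \forall z \near c, analytic f z.
Proof.
move=> [r r0 hf]; have r2 : 0 < r / 2 by lra.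
apply: (nearC r2) => w hw; exists (r / 2) => //; apply: approx_sub hf _; lra.
Qed.

Lemma analytic_affine (f : C -> C) (a b c : C) : a != 0 -> analytic f (a * c + b) ->
  analytic (fun z => f (a * z + b)) c.
Proof.
move=> a0 [r r0 hf]; have ma : 0 < md a by rewrite md_gt0.
exists (r / md a); first by rewrite divr_gt0.
move=> e /hf[p hp]; exists (p \Po (a *: 'X)) => u hu.
rewrite horner_comp hornerZ hornerX.
have -> : a * (c + u) + b = a * c + b + a * u by ring.
by apply: hp; rewrite mdM mulrC -ltr_pdivlMr.
Qed.

(** Cleared of its denominator, the difference quotient needs no exception at 0. *)
Lemma is_deriveCP (f : C -> C) (c l : C) :
  is_derive c (1 : C) f l <->
  forall e : R, 0 < e -> exists2 d : R, 0 < d & forall u, md u < d ->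
    md (f (c + u) - f c - l * u) <= e * md u.
Proof.
have E (h : C) : h != 0 -> md (h^-1 *: ((f \o shift c) (h *: (1 : C)) - f c) - l) =
    md (f (c + h) - f c - l * h) / md h.
  move=> h0; rewrite -mdV -mdM; congr md; rewrite /= /shift /= [h *: 1]mulr1 addrC.
  rewrite [h^-1 *: _](_ : _ = h^-1 * (f (c + h) - f c)); last by rewrite [c + h]addrC.
  by rewrite mulrBl mulfK// [RHS]addrC [h^-1 * _]mulrC.
split=> [[df dl] e e0|h].
  have /cvgC : (h^-1 *: ((f \o shift c) (h *: (1 : C)) - f c)) @[h --> 0^'] --> l.
    by rewrite -dl; exact: df.
  move=> /(_ _ e0)/dnbhsC[d d0 hd]; exists d => // u ud.
  have [->|u0] := eqVneq u 0.
    by rewrite addr0 subrr mulr0 subrr md0 mulr0.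
  have := hd _ u0; rewrite subr0 => /(_ ud) /=; rewrite E//.
  by rewrite ltr_pdivrMr ?md_gt0// => /ltW.
have cv : (h^-1 *: ((f \o shift c) (h *: (1 : C)) - f c)) @[h --> 0^'] --> l.
  apply/cvgC => e e0; have [|d d0 hd] := h (e / 2); first lra.
  apply/dnbhsC; exists d => // w w0; rewrite subr0 => /hd hw /=.
  rewrite E// ltr_pdivrMr ?md_gt0//; apply: (le_lt_trans hw).
  by rewrite ltr_pM2r ?md_gt0//; lra.
by apply: DeriveDef; [apply/cvg_ex; exists l|apply/cvg_lim].
Qed.

Lemma is_derive_affine (f : C -> C) (a b c l : C) :
  is_derive (a * c + b) (1 : C) f l ->
  is_derive c (1 : C) (fun z => f (a * z + b)) (a * l).
Proof.
move=> /is_deriveCP h; apply/is_deriveCP => e e0.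
pose B := md a + 1; have B0 : 0 < B by have := md_ge0 a; rewrite /B; lra.
have [|d d0 hd] := h (e / B); first by rewrite divr_gt0.
exists (d / B) => [|u hu]; first by rewrite divr_gt0.
have au : md a * md u <= B * md u by rewrite ler_wpM2r ?md_ge0// /B; lra.
have -> : a * (c + u) + b = a * c + b + a * u by ring.
have -> : a * l * u = l * (a * u) by ring.
apply: le_trans (hd _ _) _; rewrite mdM.
  by apply: le_lt_trans au _; rewrite mulrC -ltr_pdivlMr.
apply: le_trans (_ : e / B * (B * md u) <= _).
  by rewrite ler_wpM2l// divr_ge0// ltW.
by rewrite mulrA divfK// gt_eqF.
Qed.

Lemma taylor_derive c r a M (f : C -> C) : 0 < r -> taylor c r a M f ->
  f c = a 0 /\ is_derive c (1 : C) f (a 1).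
Proof.
move=> r0 [ha h].
have f0 : f c = a 0.
  have := h 0 _ 1; rewrite md0 mul0r expr1 mulr0 addr0 big_ord1 expr0 mulr1.
  move=> /(_ r0) h1; apply/eqP; rewrite -subr_eq0 -md_eq0.
  by rewrite eq_le h1 md_ge0.
split=> //; apply/is_deriveCP => e e0.
have M0 : 0 <= M by have := ha 0; rewrite expr0 mulr1; apply: le_trans (md_ge0 _).
have d0 : 0 < Num.min r (e * r ^+ 2 / (M + 1)).
  by rewrite lt_min r0 divr_gt0// ?mulr_gt0 ?exprn_gt0//; lra.
exists (Num.min r (e * r ^+ 2 / (M + 1))) => // u; rewrite lt_min => /andP[w1 w2].
have := h _ w1 2%N; rewrite big_ord_recl big_ord1 /= /bump /= expr0 mulr1 expr1.
rewrite f0 opprD addrA => /le_trans; apply.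
rewrite expr_div_n mulrA ler_pdivrMr ?exprn_gt0//.
rewrite ltr_pdivlMr in w2; last lra.
have := md_ge0 u; rewrite expr2; move: (md u) (r ^+ 2) w2 => x y; nra.
Qed.

Lemma analytic_is_derive (f : C -> C) c : analytic f c ->
  is_derive c (1 : C) f (derive1 f c).
Proof.
move=> /analytic_taylor[r [a [M [r0 h]]]]; have [_ hd] := taylor_derive r0 h.
by rewrite derive1E; apply: DeriveDef => //; case: hd.
Qed.

Lemma is_derive1E (f : C -> C) c l : is_derive c (1 : C) f l -> derive1 f c = l.
Proof. by move=> h; rewrite derive1E; case: h. Qed.

Lemma is_derive_near (f g : C -> C) c l : (\forall z \near c, f z = g z) ->
  is_derive c (1 : C) f l -> is_derive c (1 : C) g l.
Proof. exact: near_eq_is_derive. Qed.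

Lemma derive1_near (f g : C -> C) c : (\forall z \near c, f z = g z) ->
  derive1 f c = derive1 g c.
Proof. by move=> h; rewrite !derive1E; exact: near_eq_derive. Qed.

(** Cauchy's estimate; the factor 8 is that of [approx_taylor], whose radius is
    [r / 4] and whose bound is [2 * B]. *)
Lemma cauchy_derive_le c r B (f : C -> C) : 0 < r -> approx c r f ->
  (forall u, md u < r -> md (f (c + u)) <= B) -> md (derive1 f c) * r <= 8 * B.
Proof.
move=> r0 hf hB; have [a ha] := approx_taylor r0 hf hB.
have r4 : 0 < r / 4 by lra.
have [_ /is_derive1E ->] := taylor_derive r4 ha.
by have := ha.1 1; rewrite expr1; lra.
Qed.

Lemma is_derive_horner (p : {poly C}) (c z : C) :
  is_derive z (1 : C) (fun z => p.[z - c]) (p^`()).[z - c].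
Proof.
have H : is_derive (z - c) (1 : C) (horner p) (p^`()).[z - c].
  elim/poly_ind: p => [|p a ih].
    rewrite deriv0 horner0 (_ : horner 0 = cst 0); first exact: is_derive_cst.
    by apply/funext => y /=; rewrite horner0.
  rewrite (_ : horner (p * 'X + a%:P) = horner p * id + cst a); last first.
    by apply/funext => y; rewrite !hornerE.
  have h1 := is_deriveM ih (is_derive_id (z - c) (1 : C)).
  have h2 := is_deriveD h1 (is_derive_cst a (z - c) (1 : C)).
  apply: is_derive_eq h2 _.
  rewrite derivD derivM derivC derivX !addr0 mulr1 hornerD hornerMX /=.
  rewrite /GRing.scale /=; ring.
have := @is_derive_affine (horner p) 1 (- c) z (p^`()).[z - c].
rewrite !mul1r => /(_ H); apply: is_derive_near.
by near=> w; rewrite mul1r.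
Unshelve. all: by end_near. Qed.

(** If [p] approximates [f], Cauchy's estimate for [f - p] shows that the derivative
    of [p] approximates the derivative of [f]. *)
Lemma approx_derive c r (f : C -> C) : 0 < r -> approx c r f ->
  approx c (r / 2) (derive1 f).
Proof.
move=> r0 hf e e0; have e' : 0 < e * r / 32 by rewrite divr_gt0 ?mulr_gt0.
have [p hp] := hf _ e'; exists p^`() => u hu.
have r2 : 0 < r / 2 by lra.
pose d z := f z - p.[z - c].
have ad : approx c r d.
  have := approxD hf (@approx_poly _ c r (- p)); apply: approx_eq => v hv.
  by rewrite hornerN.
have ad' : approx (c + u) (r / 2) d.
  by apply: approx_sub ad _; rewrite addrAC subrr add0r; lra.
have B : forall v, md v < r / 2 -> md (d (c + u + v)) <= e * r / 32.
  move=> v hv; rewrite /d -addrA addrAC subrr add0r; apply/ltW/hp.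
  by rewrite (le_lt_trans (mdD _ _))//; lra.
have := cauchy_derive_le r2 ad' B.
have af : analytic f (c + u).
  by exists (r / 2) => //; apply: approx_sub hf _; rewrite addrAC subrr add0r; lra.
have -> : derive1 d (c + u) = derive1 f (c + u) - p^`().[u].
  apply: is_derive1E; have := is_derive_horner p c (c + u).
  rewrite addrAC subrr add0r => h1; have := analytic_is_derive af => h2.
  exact: is_deriveB.
move=> h; rewrite -(ltr_pM2r r2); apply: (le_lt_trans h).
have : 0 < e * r by rewrite mulr_gt0.
lra.
Qed.

Lemma analytic_derive (f : C -> C) c : analytic f c -> analytic (derive1 f) c.
Proof.
by move=> [r r0 hf]; exists (r / 2); [lra|exact: approx_derive].
Qed.

(** After division by [(z - c) ^+ K], the remainder of order [K] has a Taylor series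
    again, with the coefficients shifted by [K]. *)
Lemma analytic_remainder (f : C -> C) c : analytic f c ->
  exists a : nat -> C,
  [/\ f c = a 0, (forall k, a k = 0) -> \forall z \near c, f z = 0 &
   forall K, exists g, [/\ analytic g c, g c = a K & \forall z \near c,
     f z = \sum_(k < K) a k * (z - c) ^+ k + (z - c) ^+ K * g z]].
Proof.
move=> /analytic_taylor[r [a [M [r0 h]]]]; exists a; split.
- by have [] := taylor_derive r0 h.
- move=> a0; apply: (@nearC _ _ _ (r / 2)) => [|w hw]; first lra.
  apply/eqP; rewrite -md_eq0 eq_le md_ge0 andbT; apply/ler_addgt0Pr => e e0.
  have [K hK] := pow_half_small M e0; rewrite add0r.
  have wr : md (w - c) < r by lra.
  have := h.2 _ wr K; rewrite subrKC big1 ?subr0 => [|k _]; last by rewrite a0 mul0r.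
  move=> /le_trans; apply; apply: le_trans (ltW hK).
  have M0 : 0 <= M by have := h.1 0; rewrite expr0 mulr1; apply: le_trans (md_ge0 _).
  rewrite ler_wpM2l// lerXn2r// ?nnegrE ?divr_ge0 ?md_ge0//; last first.
    by rewrite ler_pdivrMr//; lra.
  exact/ltW.
move=> K; pose g z := if z == c then a K else
  (f z - \sum_(k < K) a k * (z - c) ^+ k) / (z - c) ^+ K.
have tg : taylor c r (fun k => a (k + K)%N) (M / r ^+ K) g.
  split=> [k|u hu J].
    rewrite ler_pdivlMr ?exprn_gt0// -mulrA -exprD; exact: h.1.
  have [->|u0] := eqVneq u 0.
    rewrite addr0 /g eqxx; case: J => [|J].
      rewrite big_ord0 subr0 expr0 mulr1 ler_pdivlMr ?exprn_gt0//; exact: h.1.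
    rewrite big_ord_recl expr0 mulr1 big1 ?addr0; last first.
      by move=> j _; rewrite lift0 exprS mul0r mulr0.
    by rewrite add0n subrr md0 mul0r exprS mul0r !mulr0.
  rewrite /g ifF; last by apply/negbTE; rewrite -subr_eq0 addrAC subrr add0r.
  have uK : u ^+ K != 0 by rewrite expf_neq0.
  have -> : c + u - c = u by rewrite addrAC subrr add0r.
  have -> : (f (c + u) - \sum_(k < K) a k * u ^+ k) / u ^+ K -
    \sum_(k < J) a (k + K)%N * u ^+ k =
    (f (c + u) - \sum_(k < K + J) a k * u ^+ k) / u ^+ K.
    rewrite big_split_ord /= opprD addrA [RHS]mulrBl; congr (_ - _).
    rewrite mulr_suml; apply: eq_bigr => k _.
    by rewrite exprD addnC -mulrA [u ^+ K * _]mulrC mulfK.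
  have mK : 0 < md u ^+ K by rewrite exprn_gt0// md_gt0.
  rewrite mdM mdV mdX ler_pdivrMr//; apply: le_trans (h.2 _ hu _) _.
  rewrite exprD !expr_div_n le_eqVlt; apply/orP; left; apply/eqP.
  by field; rewrite ?gt_eqF ?exprn_gt0// ?gt_eqF.
exists g; split; first exact: taylor_analytic tg.
  by rewrite /g eqxx.
apply: (@nearC _ _ _ r) => // w hw; rewrite /g; case: eqP => [->|/eqP wc].
  rewrite subrr; case: K {g tg} => [|K].
    rewrite big_ord0 expr0 mul1r add0r.
    by have [] := taylor_derive r0 h.
  rewrite big_ord_recl expr0 mulr1 big1 => [|j _].
    rewrite exprS mul0r mul0r !addr0; by have [] := taylor_derive r0 h.
  by rewrite lift0 exprS mul0r mulr0.
by rewrite [X in _ + X]mulrC divfK ?expf_neq0 ?subr_eq0// subrKC.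
Qed.

Lemma analytic_order (f : C -> C) c : analytic f c ->
  (\forall z \near c, f z = 0) \/
  exists k g, [/\ analytic g c, g c != 0 & \forall z \near c, f z = (z - c) ^+ k * g z].
Proof.
move=> /analytic_remainder[a [_ h0 h]].
have [a0|] := pselect (forall k, a k = 0); first by left; exact: h0.
move=> /existsNP[k0 /eqP hk0].
have ex : exists k, a k != 0 by exists k0.
right; case: (ex_minnP ex) => k hk kmin.
have [g [ga gc hg]] := h k; exists k, g; split=> //; first by rewrite gc.
apply: filterS hg => z ->; rewrite big1 ?add0r// => j _.
case: (eqVneq (a j) 0) => [->|/kmin]; first by rewrite mul0r.
by rewrite leqNgt ltn_ord.
Qed.

(** If [f] is not constant near [c] then [f z = f c + (z - c) ^+ k * g z] with
    [k > 0] and [g c <> 0]; moving from [c] in a direction [v] with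
    [v ^+ k * g c = f c] increases the modulus to first order in [|v| ^+ k]. *)
Lemma local_max_modulus (f : C -> C) c : analytic f c ->
  (\forall z \near c, md (f z) <= md (f c)) -> \forall z \near c, f z = f c.
Proof.
move=> fa fmax.
have [fc|fc] := eqVneq (f c) 0.
  apply: filterS fmax => z; rewrite fc md0 => hz; apply/eqP.
  by rewrite -md_eq0 eq_le hz md_ge0.
have [|[k [g [ga gc hg]]]] := analytic_order (analyticB fa (analytic_cst (f c) c)).
  by apply: filterS => z /eqP; rewrite subr_eq0 => /eqP.
exfalso.
have k0 : (0 < k)%N.
  case: k hg => // hg; have := nbhs_singleton hg.
  by rewrite subrr expr0 mul1r => h; rewrite -h eqxx in gc.
pose v := k.-root (f c / g c).
have vk : v ^+ k * g c = f c by rewrite rootCK// divfK.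
have v0 : v != 0.
  apply: contra fc => /eqP v0; rewrite -vk v0 expr0n; case: (k) k0 => // n _.
  by rewrite mul0r.
have mv : 0 < md v by rewrite md_gt0.
have mg : 0 < md (g c) by rewrite md_gt0.
have /continuousC/(_ (md (g c) / 2)) hc := analytic_cont ga.
have /nbhsC[e e0 he] : \forall z \near c, [/\ md (f z) <= md (f c),
    f z - f c = (z - c) ^+ k * g z & md (g z - g c) < md (g c) / 2].
  near=> z; split; first by near: z.
    by near: z.
  by near: z; apply: hc; lra.
pose s : R := Num.min 1 (e / (2 * md v)).
have s0 : 0 < s by rewrite lt_min ltr01 divr_gt0// mulr_gt0.
have s1 : s * md v < e.
  have : s <= e / (2 * md v) by rewrite ge_min lexx orbT.
  rewrite ler_pdivlMr ?mulr_gt0// => h; lra.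
have := he (c + s%:C%C * v).
have -> : c + s%:C%C * v - c = s%:C%C * v by rewrite addrAC subrr add0r.
rewrite mdM md_real gtr0_norm// => /(_ s1)[]; set z := c + _ => h1 h2 h3.
pose t := s ^+ k; have t0 : 0 < t by rewrite exprn_gt0.
have E : f z = (1 + t%:C%C) * f c + t%:C%C * (v ^+ k * (g z - g c)).
  have -> : f z = f c + (f z - f c) by rewrite subrKC.
  rewrite h2 exprMn -rmorphXn -/t mulrBr vk; ring.
have m1 : md (1 + t%:C%C) = 1 + t.
  rewrite -[1](rmorph1 (real_complex R)) -rmorphD md_real gtr0_norm//; lra.
have : md ((1 + t%:C%C) * f c) - md (t%:C%C * (v ^+ k * (g z - g c))) <= md (f z).
  by rewrite E -[X in _ - X <= _]mdN -[X in _ <= md (_ + X)]opprK md_subr.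
rewrite !mdM m1 md_real gtr0_norm//.
have : md (v ^+ k) * md (g c) = md (f c) by rewrite -mdM vk.
have mvk : 0 < md (v ^+ k) by rewrite md_gt0 expf_neq0.
have mf : 0 < md (f c) by rewrite md_gt0.
move: (md (v ^+ k)) (md (f c)) (md (g c)) (md (g z - g c)) (md (f z)) mvk mf h1 h3 => V F G D Z V0 F0 h1 h3 VG hz.
have : V * D < V * (G / 2) by rewrite ltr_pM2l.
have : 0 < t * F by rewrite mulr_gt0.
move=> tF VD; have : t * (V * D) < t * (V * (G / 2)) by rewrite ltr_pM2l.
rewrite mulrA VG in VD *; lra.
Unshelve. all: by end_near. Qed.

Definition real_basis (a b : C) := forall z : C, exists x y : R,
  z = a * x%:C%C + b * y%:C%C.

Lemma periodic_int (f : C -> C) w : (forall z, f (z + w) = f z) ->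
  forall (n : int) z, f (z + n%:~R * w) = f z.
Proof.
move=> h.
have hn (n : nat) z : f (z + n%:R * w) = f z.
  elim: n => [|n IH]; first by rewrite mul0r addr0.
  by rewrite -addn1 natrD mulrDl mul1r addrA h.
case=> n z; first exact: hn.
by rewrite NegzE -{2}(subrK (n.+1%:R * w) z) hn rmorphN mulNr.
Qed.

(** A doubly periodic function analytic everywhere attains its maximum modulus
    on a period parallelogram; by the local maximum principle the set where it
    takes that value is open. *)
Lemma liouville_periodic (f : C -> C) a b : real_basis a b ->
  (forall z, f (z + a) = f z) -> (forall z, f (z + b) = f z) ->
  (forall z, analytic f z) -> exists K, forall z, f z = K.
Proof.
move=> bas pa pb fa.
pose A := [set z | exists p : R * R,
    [/\ - 1 <= p.1 <= 1, - 1 <= p.2 <= 1 & z = a * p.1%:C%C + b * p.2%:C%C]].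
have red z : exists2 z', A z' & f z' = f z.
  have [x [y ->]] := bas z.
  pose m := Num.floor x; pose n := Num.floor y.
  exists (a * (x - m%:~R)%:C%C + b * (y - n%:~R)%:C%C).
    exists (x - m%:~R, y - n%:~R); split=> //=.
      by have := floor_le_tmp x; have := floorD1_gt x; rewrite intrD; rewrite -/m; lra.
    by have := floor_le_tmp y; have := floorD1_gt y; rewrite intrD; rewrite -/n; lra.
  rewrite -(periodic_int pa m) -(periodic_int pb n); congr f.
  rewrite !rmorphB /= !rmorph_int; ring.
have cf : continuous f by move=> z; exact: analytic_cont.
have cmf : {within A, continuous (fun z => md (f z))}.
  apply: continuous_subspaceT => z; apply: continuous_comp; first exact: cf.
  exact: continuous_md.
have A0 : A !=set0 by exists 0, (0, 0); split=> /=; [lra|lra|rewrite !mulr0 addr0].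
have cA : compact A by exact: compact_parallelogram.
have [z0 _ hmax] := compact_EVT_max A0 cA cmf.
have gmax z : md (f z) <= md (f z0).
  by have [z' Az' <-] := red z; apply: hmax; rewrite inE.
exists (f z0); apply: (@clopenC _ (fun z => f z = f z0) z0) => // z hz.
  have [|e e0 he] := (nbhsC _ _).1 (local_max_modulus (fa z) _).
    by near=> w; rewrite hz.
  by exists e => // w /he ->.
apply/eqP; rewrite -subr_eq0 -md_eq0 eq_le md_ge0 andbT; apply/ler_addgt0Pr => e e0.
have /continuousC/(_ _ e0)/nbhsC[d d0 hd] := cf z.
have [w wd <-] := hz _ d0; rewrite add0r mdBC; exact/ltW/hd.
Unshelve. all: by end_near. Qed.

Definition removable (f : C -> C) (c : C) := exists2 g, analytic g c &
  \forall z \near c^', f z = g z.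

Lemma dnear_uniq (f g : C -> C) c : {for c, continuous f} -> {for c, continuous g} ->
  (\forall z \near c^', f z = g z) -> f c = g c.
Proof.
move=> /continuousC cf /continuousC cg /dnbhsC[r r0 h].
apply/eqP; rewrite -subr_eq0 -md_eq0 eq_le md_ge0 andbT; apply/ler_addgt0Pr => e e0.
have e2 : 0 < e / 2 by lra.
have /nbhsC[s s0 hs] : \forall z \near c, md (f z - f c) < e / 2 /\ md (g z - g c) < e / 2.
  by near=> z; split; near: z; [exact: cf|exact: cg].
pose d := Num.min r s / 2.
have d0 : 0 < d by rewrite /d divr_gt0// lt_min r0.
have dr : d < r /\ d < s.
  have h1 : Num.min r s <= r by rewrite ge_min lexx.
  have h2 : Num.min r s <= s by rewrite ge_min lexx orbT.
  by rewrite /d in d0 *; split; lra.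
have E : c + d%:C%C - c = d%:C%C by rewrite addrAC subrr add0r.
have md' : md d%:C%C = d by rewrite md_real gtr0_norm.
have := h (c + d%:C%C); rewrite -subr_eq0 E md' -md_eq0 md' gt_eqF// => /(_ isT dr.1) fg.
have := hs (c + d%:C%C); rewrite E md' => /(_ dr.2)[]; rewrite fg => h1 h2.
rewrite add0r; have := md_tri (f c) (g (c + d%:C%C)) (g c).
rewrite (mdBC (f c) (g (c + d%:C%C))); lra.
Unshelve. all: by end_near. Qed.

Lemma dnear_near (P : set C) c : (\forall z \near c^', P z) ->
  \forall z \near c^', \forall w \near z, P w.
Proof.
move=> /dnbhsC[e e0 h]; apply/dnbhsC; exists e => // z zc ze.
have d0 : 0 < Num.min (e - md (z - c)) (md (z - c)).
  by rewrite lt_min md_gt0 !subr_gt0 ze subr_eq0.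
apply: (nearC d0) => w; rewrite lt_min => /andP[h1 h2]; apply: h.
  by apply/eqP => wc; rewrite wc mdBC ltxx in h2.
by have := md_tri w z c; lra.
Qed.

Lemma near_dnear (P : set C) c : (\forall z \near c, P z) -> \forall z \near c^', P z.
Proof. by move=> /nbhsC[e e0 h]; apply/dnbhsC; exists e => // w _; exact: h. Qed.

Lemma analytic_removable f c : analytic f c -> removable f c.
Proof. by move=> h; exists f => //; near=> z. Unshelve. all: by end_near. Qed.

(** The analytic extensions at the various points agree where they overlap and
    form an entire function with the same periods. *)
Theorem liouville_removable (f : C -> C) a b : real_basis a b ->
  (forall z, f (z + a) = f z) -> (forall z, f (z + b) = f z) ->
  (forall z, removable f z) ->
  exists K, forall z, analytic f z -> f z = K.
Proof.
move=> bas pa pb fr.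
pose g c := projT1 (cid2 (fr c)) c.
have gP c (h : C -> C) : analytic h c -> (\forall z \near c^', f z = h z) -> g c = h c.
  move=> ha fh; rewrite /g; case: cid2 => /= k ka fk.
  apply: dnear_uniq; [exact: analytic_cont|exact: analytic_cont|].
  by apply: filterS2 fh fk => z <- <-.
have ga c : analytic g c.
  have [h ha fh] := fr c; apply: (analytic_near _ ha).
  have /nbhsC[e e0 he] : \forall z \near c, analytic h z by exact: analytic_open.
  have /dnbhsC[d d0 hd] := dnear_near fh.
  have m0 : 0 < Num.min e d by rewrite lt_min e0.
  apply: (nearC m0) => w; rewrite lt_min => /andP[we wd].
  have [->|wc] := eqVneq w c; first by apply/esym/gP.
  apply/esym/gP; first exact: he.
  exact/near_dnear/hd.
have per w : (forall z, f (z + w) = f z) -> forall z, g (z + w) = g z.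
  move=> pw z; have [h ha fh] := fr z.
  rewrite (gP z h)// (gP (z + w) (fun u => h (1 * u + - w))); last 2 first.
  - by apply: analytic_affine; rewrite ?oner_neq0// mul1r addrK.
  - move/dnbhsC: fh => [e e0 he]; apply/dnbhsC; exists e => // u uz ue.
    rewrite -{1}(subrK w u) pw mul1r; apply: he; last by rewrite -addrA -opprD [w + z]addrC.
    by rewrite subr_eq.
  by rewrite mul1r addrK.
have [K hK] := liouville_periodic bas (per a pa) (per b pb) ga.
exists K => z fz; rewrite -(hK z); apply/esym/gP => //; by near=> w.
Unshelve. all: by end_near. Qed.

(** The points with a punctured neighbourhood where [G] vanishes form an open set.
    It is closed: near any [c], either [(z - c) * G z] vanishes identically or [G] has
    no zero close to [c] other than [c]. *)
Lemma identity_principle (G : C -> C) (z0 : C) :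
  (forall c, removable (fun z => (z - c) * G z) c) ->
  (\forall z \near z0^', G z = 0) -> forall c, \forall z \near c^', G z = 0.
Proof.
move=> hG h0; apply: (@clopenC _ (fun c => \forall z \near c^', G z = 0) z0 h0).
  move=> c hc; have /dnbhsC[e e0 he] := dnear_near hc; exists e; first exact: e0.
  move=> w we; have [->|wc] := eqVneq w c; first exact: hc.
  exact: (near_dnear (he w wc we)).
move=> c hc; have [g ga Gg] := hG c.
have [g0|[k [h [ha hc0 gh]]]] := analytic_order ga.
  have gd := near_dnear g0.
  have nc : \forall z \near c^', z != c by apply/dnbhsC; exists 1.
  near=> z; have zc : z - c != 0 by rewrite subr_eq0; near: z.
  apply: (mulfI zc); rewrite mulr0.
  have -> : (z - c) * G z = g z by near: z.
  by near: z.
exfalso.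
have : \forall z \near c^', G z != 0.
  have gd := near_dnear gh; have hn := near_dnear (analytic_neq0 ha hc0).
  have nc : \forall z \near c^', z != c by apply/dnbhsC; exists 1.
  near=> z; have zc : z - c != 0 by rewrite subr_eq0; near: z.
  suff : (z - c) * G z != 0 by rewrite mulf_eq0 negb_or => /andP[].
  have -> : (z - c) * G z = g z by near: z.
  have -> : g z = (z - c) ^+ k * h z by near: z.
  by rewrite mulf_neq0 ?expf_neq0//; near: z.
move=> nz; have nz2 := dnear_near nz.
have /dnbhsC[e e0 he] : \forall z \near c^', G z != 0 /\ \forall w \near z, G w != 0.
  by apply: filterS2 nz nz2.
have [w we hw] := hc _ e0.
have wG : \forall z \near w^', G z != 0.
  have [->|wc] := eqVneq w c; first exact: nz.
  by have [_ h1] := he _ wc we; exact: (near_dnear h1).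
have /dnbhsC[d d0 hd] : \forall z \near w^', False.
  by apply: filterS2 wG hw => z /eqP.
apply: (hd (w + (d / 2)%:C%C)).
  rewrite -subr_eq0 addrAC subrr add0r -md_eq0 md_real gtr0_norm; last lra.
  by rewrite gt_eqF//; lra.
rewrite addrAC subrr add0r md_real gtr0_norm; lra.
Unshelve. all: by end_near. Qed.

(** [(z - c) ^+ k.+1 * g] has the derivative
    [(z - c) ^+ k * (k.+1 * g + (z - c) * g')]. *)
Lemma derive_order (G g : C -> C) c k : analytic g c -> g c != 0 ->
  (\forall z \near c, G z = (z - c) ^+ k.+1 * g z) ->
  exists g', [/\ analytic g' c, g' c != 0 &
    \forall z \near c, derive1 G z = (z - c) ^+ k * g' z].
Proof.
move=> ga gc hG.
exists (fun z => k.+1%:R * g z + (z - c) * derive1 g z); split.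
- apply: analyticD; first by apply: analyticM => //; exact: analytic_cst.
  apply: analyticM; last exact: analytic_derive.
  by apply: analyticB; [exact: analytic_id|exact: analytic_cst].
- by rewrite subrr mul0r addr0 mulf_neq0// pnatr_eq0.
have hG2 : \forall z \near c, \forall w \near z, G w = (w - c) ^+ k.+1 * g w.
  by move/nbhs_interior : hG.
have gan := analytic_open ga.
near=> z; apply: is_derive1E.
have : \forall w \near z, (w - c) ^+ k.+1 * g w = G w.
  by apply: filterS (_ : \forall w \near z, G w = (w - c) ^+ k.+1 * g w) => [w ->//|]; near: z.
move=> hh; apply: (is_derive_near hh).
have dg : is_derive z (1 : C) g (derive1 g z).
  by apply: analytic_is_derive; near: z.
have dp : is_derive z (1 : C) (fun w => ('X^(k.+1) : {poly C}).[w - c]) (('X^(k.+1) : {poly C})^`()).[z - c].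
  exact: is_derive_horner.
have := is_deriveM dp dg.
rewrite derivXn hornerMn !hornerXn /= => h.
have e : (fun w => ('X^(k.+1) : {poly C}).[w - c]) * g = (fun w => (w - c) ^+ k.+1 * g w).
  by apply/funext => w; rewrite -[LHS]/(('X^(k.+1) : {poly C}).[w - c] * g w) hornerXn.
rewrite e in h; apply: is_derive_eq h _.
by rewrite /GRing.scale /= exprS -mulr_natr; ring.
Unshelve. all: by end_near. Qed.

(** Uniqueness for [G'' = K G], [G c = G' c = 0]: if [G] vanished to finite order
    [k], then [k >= 2] and [G''] would vanish to order [k - 2] only. *)
Lemma linear_ode2_uniq (G K : C -> C) c : analytic G c -> analytic K c ->
  G c = 0 -> derive1 G c = 0 ->
  (\forall z \near c, derive1 (derive1 G) z = K z * G z) ->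
  \forall z \near c, G z = 0.
Proof.
move=> Ga Ka G0 G1 hG; have [//|[k [g [ga gc hg]]]] := analytic_order Ga; exfalso.
case: k hg => [|k] hg.
  have := nbhs_singleton hg; rewrite G0 expr0 mul1r => h.
  by rewrite -h eqxx in gc.
have [g1 [g1a g1c hg1]] := derive_order ga gc hg.
case: k hg hg1 => [|k] hg hg1.
  have := nbhs_singleton hg1; rewrite G1 expr0 mul1r => h.
  by rewrite -h eqxx in g1c.
have [g2 [g2a g2c hg2]] := derive_order g1a g1c hg1.
have : g2 c = K c * (c - c) ^+ 2 * g c.
  apply: (@dnear_uniq g2 (fun z => K z * (z - c) ^+ 2 * g z)).
  - exact: analytic_cont.
  - apply: analytic_cont; apply: analyticM => //; apply: analyticM => //.
    by apply: analyticX; apply: analyticB; [exact: analytic_id|exact: analytic_cst].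
  have H : \forall z \near c, (z - c) ^+ k * g2 z = K z * ((z - c) ^+ k.+2 * g z).
    by near=> z; rewrite -(near hg2 z) ?(near hG z) ?(near hg z)//.
  have nc : \forall z \near c^', z != c by apply/dnbhsC; exists 1.
  have H' := near_dnear H.
  near=> z; have zc : (z - c) ^+ k != 0 by rewrite expf_neq0// subr_eq0; near: z.
  apply: (mulfI zc).
  have -> : (z - c) ^+ k * g2 z = K z * ((z - c) ^+ k.+2 * g z) by near: z.
  by rewrite -addn2 exprD; ring.
by rewrite subrr expr2 !mulr0 mul0r => h; rewrite h eqxx in g2c.
Unshelve. all: by end_near. Qed.

End Analytic.

(** * Unordered sums *)

Section UnorderedSums.
Local Open Scope fset_scope.
Local Open Scope ring_scope.
Variables (R : realType) (I : choiceType).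
Local Notation C := (CC R).
Local Notation md := (@md R).

Definition sumto (x : I -> C) (s : C) := forall e : R, 0 < e ->
  exists A : {fset I}, forall B : {fset I}, A `<=` B ->
    md (\sum_(i <- B) x i - s) < e.

Lemma sumtoE (x : I -> C) (s : C) : sumto x s -> summability.sum x = s.
Proof.
move=> h; have TF := @summability.totally_filter I.
apply/cvg_lim; first exact: norm_hausdorff.
apply/cvgC => e e0; have [A hA] := h _ e0.
exists A => // B /= /hA; rewrite /summability.partial_sum.
by rewrite (big_seq_fsetE _ _ predT x).
Qed.

Lemma sumto_uniq (x : I -> C) s s' : sumto x s -> sumto x s' -> s = s'.
Proof. by move=> /sumtoE <- /sumtoE. Qed.

Lemma sumto_eq (x y : I -> C) s : x =1 y -> sumto x s -> sumto y s.
Proof.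
move=> xy h e /h[A hA]; exists A => B /hA.
by rewrite (eq_bigr y) // => i _; rewrite xy.
Qed.

Lemma sumtoD (x y : I -> C) s t : sumto x s -> sumto y t ->
  sumto (fun i => x i + y i) (s + t).
Proof.
move=> hx hy e e0; have e2 : 0 < e / 2 by lra.
have [A hA] := hx _ e2; have [B hB] := hy _ e2; exists (A `|` B) => D.
rewrite fsubUset => /andP[/hA h1 /hB h2]; rewrite big_split /=.
have -> : \sum_(i <- D) x i + \sum_(i <- D) y i - (s + t) =
  (\sum_(i <- D) x i - s) + (\sum_(i <- D) y i - t) by ring.
by apply: (le_lt_trans (mdD _ _)); lra.
Qed.

Lemma sumtoZ (x : I -> C) s a : sumto x s -> sumto (fun i => a * x i) (a * s).
Proof.
move=> hx e e0; have B0 : 0 < md a + 1 by have := md_ge0 a; lra.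
have [|A hA] := hx (e / (md a + 1)); first by rewrite divr_gt0.
exists A => B /hA; rewrite -mulr_sumr -mulrBr mdM ltr_pdivlMr// => h.
apply: le_lt_trans h; rewrite mulrC ler_wpM2l ?md_ge0//; lra.
Qed.

Lemma sumtoN (x : I -> C) s : sumto x s -> sumto (fun i => - x i) (- s).
Proof.
move=> /(@sumtoZ _ _ (-1)); rewrite mulN1r; apply: sumto_eq => i; exact: mulN1r.
Qed.

Lemma sumto_reindex (x : I -> C) s (f g : I -> I) : cancel f g -> cancel g f ->
  sumto x s -> sumto (x \o f) s.
Proof.
move=> fK gK h e /h[A hA]; exists [fset g i | i in A] => B AB.
have := hA [fset f i | i in B]; rewrite big_imfset /=; last first.
  by move=> i j _ _; exact: (can_inj fK).
apply; apply/fsubsetP => i iA; apply/imfsetP; exists (g i) => //=.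
by apply: (fsubsetP AB); apply/imfsetP; exists i.
Qed.

Lemma sumto1 (i0 : I) (a : C) : sumto (fun i => if i == i0 then a else 0) a.
Proof.
move=> e e0; exists [fset i0] => B; rewrite fsub1set => h.
rewrite (big_fsetD1 i0) //= eqxx big_seq_cond big1 ?addr0 ?subrr ?md0// => i.
by rewrite !inE => /andP[/andP[/negbTE -> _] _].
Qed.

Lemma sum_fsetU (V : nmodType) (F : I -> V) (A B : {fset I}) : [disjoint A & B]%fset ->
  \sum_(i <- A `|` B) F i = \sum_(i <- A) F i + \sum_(i <- B) F i.
Proof.
move=> /fdisjointP AB; rewrite (big_fsetID _ (mem A) (A `|` B)) /=.
have -> : [fset x in A `|` B | x \in A] = A.
  by apply/fsetP => i; rewrite !inE /=; case: (i \in A); rewrite ?andbF.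
have -> : [fset x in A `|` B | x \notin A] = B.
  apply/fsetP => i; rewrite !inE /=; have := AB i; case: (i \in A) => //=.
    by move=> /(_ isT)/negbTE ->.
  by rewrite andbT.
by [].
Qed.

(** A finite set whose sum is within [e] of the supremum leaves less than [e] for
    the sets disjoint from it. *)
Lemma summable_tail (b : I -> R) (M : R) : (forall i, 0 <= b i) ->
  (forall J : {fset I}, \sum_(i <- J) b i <= M) ->
  forall e : R, 0 < e -> exists A : {fset I}, forall B : {fset I},
    [disjoint A & B]%fset -> \sum_(i <- B) b i <= e.
Proof.
move=> b0 hM e e0; pose S := [set \sum_(i <- J) b i | J in [set: {fset I}]].
have hS : has_sup S.
  split; first by exists (\sum_(i <- fset0) b i), fset0.
  by exists M => _ [J _ <-].
have [_ [A _ <-] hA] := sup_adherent e0 hS; exists A => B AB.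
have : \sum_(i <- A `|` B) b i <= sup S by apply: sup_upper_bound => //; exists (A `|` B).
rewrite sum_fsetU//; lra.
Qed.

Lemma md_sum_diff (x : I -> C) (b : I -> R) (F A B D : {fset I}) (e : R) :
  (forall i, i \notin F -> md (x i) <= b i) -> F `<=` A ->
  (forall B : {fset I}, [disjoint A & B]%fset -> \sum_(i <- B) b i <= e) ->
  A `<=` B -> B `<=` D ->
  md (\sum_(i <- D) x i - \sum_(i <- B) x i) <= e.
Proof.
move=> hx FA hA AB BD.
have -> : \sum_(i <- D) x i - \sum_(i <- B) x i = \sum_(i <- D `\` B) x i.
  have DE : D = B `|` (D `\` B).
    by apply/fsetP => i; rewrite !inE; case: (boolP (i \in B)) => //= /(fsubsetP BD).
  rewrite {1}DE sum_fsetU; first by rewrite addrAC subrr add0r.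
  by apply/fdisjointP => i iB; rewrite inE iB.
have dj : [disjoint A & D `\` B]%fset.
  by apply/fdisjointP => i /(fsubsetP AB) iB; rewrite inE iB.
apply: le_trans (hA _ dj); apply: (le_trans (md_sum _ _ _)).
rewrite big_seq_cond [leRHS]big_seq_cond; apply: ler_sum => i; rewrite andbT => iD.
apply: hx; apply/negP => /(fsubsetP FA) iA.
by move/fdisjointP : dj => /(_ _ iA); rewrite iD.
Qed.

(** The finite sets controlling the tails of the bound [b] control the
    convergence of all the families dominated by [b] off [F], uniformly. *)
Lemma dominated_sumto (x : I -> C) (b : I -> R) (M : R) (F : {fset I}) :
  (forall i, 0 <= b i) -> (forall J : {fset I}, \sum_(i <- J) b i <= M) ->
  (forall i, i \notin F -> md (x i) <= b i) ->
  exists s, sumto x s /\ forall (A : {fset I}) (e : R), F `<=` A ->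
    (forall B : {fset I}, [disjoint A & B]%fset -> \sum_(i <- B) b i <= e) ->
    forall B : {fset I}, A `<=` B -> md (\sum_(i <- B) x i - s) <= e.
Proof.
move=> b0 hM hx.
have small (e : R) : 0 < e -> exists N, forall n, (N <= n)%N -> n.+1%:R^-1 < e.
  move=> e0; exists (Num.bound e^-1) => n hn.
  rewrite -[e]invrK ltf_pV2 ?posrE ?invr_gt0//.
  apply: (lt_le_trans (archi_boundP _)); first by rewrite invr_ge0 ltW.
  by rewrite ler_nat; lia.
have tl n : exists A : {fset I}, F `<=` A /\ forall B : {fset I},
    [disjoint A & B]%fset -> \sum_(i <- B) b i <= n.+1%:R^-1.
  have [|A hA] := summable_tail b0 hM (_ : 0 < n.+1%:R^-1); first by rewrite invr_gt0.
  exists (A `|` F); split; first exact: fsubsetUr.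
  move=> B; rewrite fdisjointUX => /andP[/hA]//.
pose A n := projT1 (cid (tl n)).
have FA n : F `<=` A n by rewrite /A; case: cid => /= ? [].
have hA n : forall B : {fset I}, [disjoint A n & B]%fset -> \sum_(i <- B) b i <= n.+1%:R^-1.
  by rewrite /A; case: cid => /= ? [].
have key (A1 A2 : {fset I}) (e1 e2 : R) : F `<=` A1 -> F `<=` A2 ->
    (forall B : {fset I}, [disjoint A1 & B]%fset -> \sum_(i <- B) b i <= e1) ->
    (forall B : {fset I}, [disjoint A2 & B]%fset -> \sum_(i <- B) b i <= e2) ->
    forall B, A1 `<=` B -> md (\sum_(i <- B) x i - \sum_(i <- A2) x i) <= e1 + e2.
  move=> F1 F2 h1 h2 B AB.
  have k1 := md_sum_diff hx F1 h1 AB (fsubsetUl B A2).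
  have k2 := md_sum_diff hx F2 h2 (fsubset_refl A2) (fsubsetUr B A2).
  have := md_tri (\sum_(i <- B) x i) (\sum_(i <- B `|` A2) x i) (\sum_(i <- A2) x i).
  rewrite (mdBC (\sum_(i <- B) x i) (\sum_(i <- B `|` A2) x i)); lra.
have [s hs] : exists l, forall e : R, 0 < e -> exists N, forall n, (N <= n)%N ->
     md (\sum_(i <- A n) x i - l) < e.
  apply: complete_C => e e0; have [|N hN] := small (e / 2); first lra.
  exists N => n m /hN hn /hN hm.
  have := key _ _ _ _ (FA n) (FA m) (hA n) (hA m) _ (fsubset_refl _).
  set d1 := n.+1%:R^-1 in hn *; set d2 := m.+1%:R^-1 in hm *; lra.
have main : forall (A : {fset I}) (e : R), F `<=` A ->
    (forall B : {fset I}, [disjoint A & B]%fset -> \sum_(i <- B) b i <= e) ->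
    forall B : {fset I}, A `<=` B -> md (\sum_(i <- B) x i - s) <= e.
  move=> A0 e F0 h0 B AB; apply/ler_addgt0Pr => d d0.
  have d2 : 0 < d / 2 by lra.
  have [N1 h1] := hs _ d2; have [N2 h2] := small _ d2.
  have := h1 _ (leq_maxl N1 N2); have := h2 _ (leq_maxr N1 N2).
  set n := maxn N1 N2; set d1 := n.+1%:R^-1 => k1 k2.
  have := key _ _ _ _ F0 (FA n) h0 (hA n) _ AB; rewrite -/d1.
  have := md_tri (\sum_(i <- B) x i) (\sum_(i <- A n) x i) s; lra.
exists s; split=> // e e0; have [|A0 hA0] := summable_tail b0 hM (_ : 0 < e / 2); first lra.
exists (A0 `|` F) => B hB.
apply: (@le_lt_trans _ _ (e / 2)); last lra.
apply: main hB; first exact: fsubsetUr.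
by move=> D; rewrite fdisjointUX => /andP[/hA0].
Qed.

Lemma sumto_le (x : I -> C) s (b : I -> R) (M : R) : sumto x s ->
  (forall i, md (x i) <= b i) -> (forall J : {fset I}, \sum_(i <- J) b i <= M) ->
  md s <= M.
Proof.
move=> h hx hM; apply/ler_addgt0Pr => e /h[A /(_ A (fsubset_refl _)) hA].
have : md (\sum_(i <- A) x i) <= M.
  by apply: (le_trans (md_sum _ _ _)); apply: le_trans (hM A); exact: ler_sum.
have := md_subr s (\sum_(i <- A) x i); rewrite mdBC; lra.
Qed.

End UnorderedSums.

(** * Convergence of the lattice sums *)

Section LatticeBound.
Local Open Scope fset_scope.
Local Open Scope ring_scope.
Variable R : realType.

Lemma ler_sum_uniq_sub (T : eqType) (s t : seq T) (F : T -> R) :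
  (forall i, 0 <= F i) -> uniq s -> {subset s <= t} ->
  \sum_(i <- s) F i <= \sum_(i <- t) F i.
Proof.
move=> F0; elim: s t => [|x s IH] t.
  by move=> _ _; rewrite big_nil sumr_ge0.
move=> /= /andP[xs us] st.
have xt : x \in t by apply: st; rewrite inE eqxx.
rewrite (perm_big _ (perm_to_rem xt)) !big_cons /= lerD2l; apply: IH => // y ys.
have := st y; rewrite inE ys orbT => /(_ isT) yt.
have := perm_mem (perm_to_rem xt) y; rewrite yt inE => /esym /orP[/eqP yx|//].
by rewrite -yx ys in xs.
Qed.

(** The exponent is [- 3 / 2]: large enough for a convergent sum over one index,
    small enough for [decay m * decay n] to dominate the power [-3] of [m + n]. *)
Definition decay (n : nat) : R := (Num.sqrt n.+1%:R ^+ 3)^-1.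

Lemma decay_ge0 n : 0 <= decay n.
Proof. by rewrite invr_ge0 exprn_ge0// sqrtr_ge0. Qed.

(** The sum is compared with a telescoping one, by
    [n^(-3/2) <= 2 (n - 1)^(-1/2) - 2 n^(-1/2)]. *)
Lemma sum_decay_le n : \sum_(k < n) decay k <= 3.
Proof.
case: n => [|n]; first by rewrite big_ord0.
suff : \sum_(k < n.+1) decay k <= 3 - 2 / Num.sqrt n.+1%:R.
  move=> /le_trans; apply; rewrite gerBl divr_ge0// sqrtr_ge0.
elim: n => [|n IH]; first by rewrite big_ord1 /decay sqrtr1 expr1n invr1; lra.
rewrite big_ord_recr /=; apply: (le_trans (lerD IH (lexx _))); rewrite /decay.
set s := Num.sqrt n.+2%:R; set r := Num.sqrt n.+1%:R.
have r0 : 0 < r by rewrite sqrtr_gt0.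
have s0 : 0 < s by rewrite sqrtr_gt0.
have r2 : r ^+ 2 = n.+1%:R by rewrite sqr_sqrtr.
have s2 : s ^+ 2 = r ^+ 2 + 1 by rewrite r2 sqr_sqrtr// -[n.+2]addn1 natrD.
have rs : r < s by rewrite -(ltr_pXn2r (_ : 0 < 2)%N) ?nnegrE ?ltW// s2 ltrDl.
suff : s ^- 3 <= 2 / r - 2 / s by lra.
have -> : 2 / r - 2 / s = 2 * (s ^+ 2 - r ^+ 2) / (r * s * (s + r)).
  by field; rewrite !gt_eqF//; lra.
have -> : s ^+ 2 - r ^+ 2 = 1 by rewrite s2; ring.
rewrite mulr1 ler_pdivlMr ?mulr_gt0//; last lra.
rewrite mulrC ler_pdivrMr ?exprn_gt0//.
have -> : s ^+ 3 = s * s ^+ 2 by rewrite exprS.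
rewrite expr2; nra.
Qed.

Definition norm1 (p : int * int) : R := `|p.1|%:~R + `|p.2|%:~R.

Definition cubic_decay (p : int * int) : R := if p == 0 then 0 else (norm1 p) ^- 3.

Lemma norm1_ge1 p : p != 0 -> 1 <= norm1 p.
Proof.
case: p => m n; rewrite -[_ == _]/((m == 0) && (n == 0)) negb_and /norm1 /= => h.
rewrite -intrD -[1]/(1%:~R) ler_int; lia.
Qed.

Lemma cubic_decay_ge0 p : 0 <= cubic_decay p.
Proof.
rewrite /cubic_decay; case: eqP => // /eqP/norm1_ge1 h.
by rewrite invr_ge0 exprn_ge0//; lra.
Qed.

Lemma cubic_decay_le p : cubic_decay p <= 8 * (decay `|p.1|%N * decay `|p.2|%N).
Proof.
rewrite /cubic_decay; case: eqP => [_|/eqP p0].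
  by rewrite !mulr_ge0// decay_ge0.
have h1 := norm1_ge1 p0; rewrite /decay.
set a := Num.sqrt _; set b := Num.sqrt _.
have a0 : 0 < a by rewrite sqrtr_gt0.
have b0 : 0 < b by rewrite sqrtr_gt0.
have a2 : a ^+ 2 = `|p.1|%:~R + 1 by rewrite sqr_sqrtr// -natr1 -abszE.
have b2 : b ^+ 2 = `|p.2|%:~R + 1 by rewrite sqr_sqrtr// -natr1 -abszE.
have x0 : 0 <= (`|p.1|%:~R : R) by rewrite ler0z.
have y0 : 0 <= (`|p.2|%:~R : R) by rewrite ler0z.
have ab : a * b <= 2 * norm1 p.
  rewrite -(ler_pXn2r (_ : 0 < 2)%N) ?nnegrE//; last 2 first.
  - by rewrite mulr_ge0// ltW.
  - lra.
  rewrite exprMn a2 b2; move: h1; rewrite /norm1 !expr2.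
  move: (`|p.1|%:~R : R) (`|p.2|%:~R : R) x0 y0 => x y; nra.
rewrite -invfM -exprMn -[8]invrK -invfM lef_pV2 ?posrE; last 2 first.
- by rewrite exprn_gt0//; lra.
- by rewrite mulr_gt0 ?exprn_gt0 ?mulr_gt0//; lra.
have -> : 8^-1 * (a * b) ^+ 3 = ((a * b) / 2) ^+ 3.
  by rewrite expr_div_n mulrC; congr (_ / _); ring.
by rewrite lerXn2r// ?nnegrE; [rewrite divr_ge0// mulr_ge0// ltW|lra|lra].
Qed.

(** [sum_(p in Z^2, p <> 0) (|p_1| + |p_2|)^(-3)] converges: the terms are
    dominated by a product of two convergent one-dimensional series. *)
Lemma cubic_decay_summable (J : {fset int * int}) :
  \sum_(p <- J) cubic_decay p <= 8 * 36.
Proof.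
apply: le_trans (_ : \sum_(p <- J) 8 * (decay `|p.1|%N * decay `|p.2|%N) <= _).
  by apply: ler_sum => p _; exact: cubic_decay_le.
rewrite -mulr_sumr ler_wpM2l//.
pose N := (\max_(p <- J) maxn `|p.1|%N `|p.2|%N)%N.+1.
pose S : seq int := [seq k%:Z | k <- iota 0 N] ++ [seq - k%:Z | k <- iota 0 N].
have SN (m : int) : (`|m| < N)%N -> m \in S.
  move=> h; rewrite mem_cat; apply/orP; case: (lerP 0 m) => m0.
    by left; apply/mapP; exists `|m|%N; rewrite ?mem_iota//; lia.
  by right; apply/mapP; exists `|m|%N; rewrite ?mem_iota//; lia.
have sumS : \sum_(m <- S) decay `|m|%N <= 6.
  rewrite /S big_cat !big_map.
  have e2 : \sum_(j <- iota 0 N) decay `|- j%:Z|%N = \sum_(j <- iota 0 N) decay j.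
    by apply: eq_bigr => j _; rewrite abszN.
  have := sum_decay_le N; rewrite -(big_mkord xpredT decay) /index_iota subn0.
  rewrite e2; set X := \sum_(_ <- _) _ => hX.
  rewrite -[leLHS]/(X + X); lra.
apply: le_trans (_ : \sum_(p <- [seq (m, n) | m <- S, n <- S]) decay `|p.1|%N * decay `|p.2|%N <= _).
  apply: ler_sum_uniq_sub; [|exact: fset_uniq|].
    by move=> p; rewrite mulr_ge0 ?decay_ge0.
  move=> [m n] pJ; apply/allpairsP; exists (m, n); split=> //=.
    apply: SN; rewrite ltnS; apply: leq_trans (leq_maxl _ `|n|%N) _.
    by rewrite (big_rem _ pJ) leq_maxl.
  apply: SN; rewrite ltnS; apply: leq_trans (leq_maxr `|m|%N _) _.
  by rewrite (big_rem _ pJ) leq_maxl.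
rewrite big_allpairs /=.
under eq_bigr do rewrite -mulr_sumr.
rewrite -mulr_suml.
have : 0 <= \sum_(m <- S) decay `|m|%N by apply: sumr_ge0 => m _; exact: decay_ge0.
move: (\sum_(m <- S) _) sumS => X; nra.
Qed.

End LatticeBound.

(** * The Weierstrass zeta function *)

Lemma sum_pred_all (V : nmodType) (I : eqType) (s : seq I) (P : pred I) (F : I -> V) :
  (forall i, i \in s -> P i) -> \sum_(i <- s | P i) F i = \sum_(i <- s) F i.
Proof.
move=> h; rewrite big_seq_cond [RHS]big_seq; apply: eq_bigl => i.
by have := h i; case: (i \in s) => //= ->.
Qed.

Section DeriveRules.
Variable R : realType.
Local Notation C := (CC R).
Implicit Types (f g : C -> C) (c : C).

Lemma deriveC_cst (a c : C) : is_derive c (1 : C) (fun=> a) 0.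
Proof. exact: is_derive_cst. Qed.

Lemma deriveC_id (c : C) : is_derive c (1 : C) (fun z => z) 1.
Proof. exact: is_derive_id. Qed.

Lemma deriveC_add f g c l m : is_derive c (1 : C) f l -> is_derive c (1 : C) g m ->
  is_derive c (1 : C) (fun z => f z + g z) (l + m).
Proof. exact: is_deriveD. Qed.

Lemma deriveC_opp f c l : is_derive c (1 : C) f l -> is_derive c (1 : C) (fun z => - f z) (- l).
Proof. exact: is_deriveN. Qed.

Lemma deriveC_sub f g c l m : is_derive c (1 : C) f l -> is_derive c (1 : C) g m ->
  is_derive c (1 : C) (fun z => f z - g z) (l - m).
Proof. exact: is_deriveB. Qed.

Lemma deriveC_mul f g c l m : is_derive c (1 : C) f l -> is_derive c (1 : C) g m ->
  is_derive c (1 : C) (fun z => f z * g z) (f c * m + g c * l).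
Proof. exact: is_deriveM. Qed.

Lemma deriveC_inv f c l : is_derive c (1 : C) f l -> f c != 0 ->
  is_derive c (1 : C) (fun z => (f z)^-1) (- (l / f c ^+ 2)).
Proof.
move=> [d1 d2] fc; have e := deriveV fc d1.
apply: DeriveDef; first exact: derivableV.
by apply: (eq_trans e); rewrite d2 /GRing.scale /=; ring.
Qed.

Lemma deriveC_sum (I : Type) (s : seq I) (F : I -> C -> C) (l : I -> C) c :
  (forall i, is_derive c (1 : C) (F i) (l i)) ->
  is_derive c (1 : C) (fun z => \sum_(i <- s) F i z) (\sum_(i <- s) l i).
Proof.
move=> h; elim: s => [|p s IH].
  rewrite big_nil; apply: is_derive_near (deriveC_cst 0 c).
  by near=> z; rewrite big_nil.
rewrite big_cons; apply: is_derive_near (deriveC_add (h p) IH).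
by near=> z; rewrite big_cons.
Unshelve. all: by end_near. Qed.

Lemma deriveC_eq f c l m : is_derive c (1 : C) f l -> l = m -> is_derive c (1 : C) f m.
Proof. by move=> h <-. Qed.

End DeriveRules.

Section Zeta.
Local Open Scope fset_scope.
Local Open Scope ring_scope.
Variables (R : realType) (tau : CC R).
Hypothesis tau_gt0 : 0 < complex.Im tau.
Local Notation C := (CC R).
Local Notation md := (@md R).
Local Notation w := (lattice_point tau).
Local Notation zeta := (zeta tau).
Local Notation wp := (wp tau).
Local Notation lattice := (lattice tau).

(** A bound for the inverse of the real linear map [(x, y) |-> x + y * tau]. *)
Definition skew : R := 1 + (md tau + 1) / complex.Im tau.

Lemma skew_gt0 : 0 < skew.
Proof.
by rewrite /skew ltr_wpDr// divr_ge0 ?ltW//; have := md_ge0 tau; lra.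
Qed.

Lemma skew_ge0 : 0 <= skew. Proof. exact/ltW/skew_gt0. Qed.

Lemma real_coords_le (x y : R) : `|x| + `|y| <= skew * md (x%:C%C + y%:C%C * tau).
Proof.
set z : C := x%:C%C + y%:C%C * tau.
have hy : `|y| * complex.Im tau <= md z.
  have -> : `|y| * complex.Im tau = `|complex.Im z|.
    rewrite -{1}(gtr0_norm tau_gt0) -normrM; congr `|_|.
    by rewrite /z; case: (tau) => a b /=; ring.
  exact: md_Im.
have hx : `|x| <= md z + `|y| * md tau.
  rewrite -(md_real x) -(md_real y) -mdM.
  have -> : x%:C%C = z - y%:C%C * tau by rewrite /z addrK.
  exact: mdB.
rewrite /skew mulrDl mul1r mulrAC.
have h2 : `|y| <= md z / complex.Im tau by rewrite ler_pdivlMr.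
have h3 : `|y| * (md tau + 1) <= md z / complex.Im tau * (md tau + 1).
  by rewrite ler_wpM2r//; have := md_ge0 tau; lra.
rewrite (mulrC (md tau + 1)); lra.
Qed.

Lemma lattice_coords_le (x y : R) :
  `|x| + `|y| <= skew * md (1 * x%:C%C + tau * y%:C%C).
Proof. by rewrite mul1r [tau * _]mulrC; exact: real_coords_le. Qed.

Lemma real_coords_inj (x y x' y' : R) :
  x%:C%C + y%:C%C * tau = x'%:C%C + y'%:C%C * tau -> x = x' /\ y = y'.
Proof.
move=> h; have := real_coords_le (x - x') (y - y').
have -> : (x - x')%:C%C + (y - y')%:C%C * tau = 0.
  by rewrite !rmorphB/= mulrBl addrACA -opprD h subrr.
rewrite md0 mulr0 => h0; have := normr_ge0 (x - x'); have := normr_ge0 (y - y') => h1 h2.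
have : `|x - x'| = 0 by lra.
have : `|y - y'| = 0 by lra.
by move=> /eqP; rewrite normr_eq0 subr_eq0 => /eqP -> /eqP; rewrite normr_eq0 subr_eq0 => /eqP ->.
Qed.

Lemma real_coords (z : C) : exists x y : R, z = x%:C%C + y%:C%C * tau.
Proof.
exists (complex.Re z - complex.Im z / complex.Im tau * complex.Re tau).
exists (complex.Im z / complex.Im tau).
move: tau_gt0; case: (z) => a b; case: (tau) => s t /= t0.
by apply/eqP; rewrite eq_complex /=; apply/andP; split; apply/eqP; field; rewrite gt_eqF.
Qed.

Lemma latticeE z : z \in lattice <-> exists m n : int, z = m%:~R + n%:~R * tau.
Proof.
split=> [/asboolP[p ->]|[m [n ->]]]; first by exists p.1, p.2.
by apply/asboolP; exists (m, n).
Qed.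

Lemma intC (m : int) : (m%:~R : C) = (m%:~R : R)%:C%C.
Proof. by rewrite rmorph_int. Qed.

Lemma lattice_pointE p : w p = (p.1%:~R : R)%:C%C + (p.2%:~R : R)%:C%C * tau.
Proof. by rewrite /lattice_point !intC. Qed.

Lemma norm1_le p : norm1 R p <= skew * md (w p).
Proof. by rewrite lattice_pointE /norm1 !intr_norm; exact: real_coords_le. Qed.

Lemma lattice_point_eq0 p : (w p == 0) = (p == 0).
Proof.
apply/eqP/eqP => [h|->]; last by rewrite /lattice_point mul0r addr0.
apply/eqP; apply: contraT => /norm1_ge1 -/(_ R); have := norm1_le p; rewrite h md0 mulr0.
by move=> h1 h2; have := le_trans h2 h1; rewrite ler10.
Qed.

Lemma lattice_pointB p q : w (p - q) = w p - w q.
Proof. by rewrite /lattice_point /= !rmorphB /=; ring. Qed.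

Lemma lattice_pointN p : w (- p) = - w p.
Proof. by rewrite /lattice_point /= !rmorphN /=; ring. Qed.

Lemma lattice_disc_finite (r : R) : exists F : {fset int * int},
  forall p, p \notin F -> r <= md (w p).
Proof.
pose N := Num.bound (skew * `|r|).
have [S SN] : exists S : seq int, forall m : int, (`|m| < N)%N -> m \in S.
  exists ([seq k%:Z | k <- iota 0 N] ++ [seq - k%:Z | k <- iota 0 N]) => m h.
   rewrite mem_cat; apply/orP; case: (lerP 0 m) => m0.
    by left; apply/mapP; exists `|m|%N; rewrite ?mem_iota//; lia.
  by right; apply/mapP; exists `|m|%N; rewrite ?mem_iota//; lia.
exists [fset p in [seq (m, n) | m <- S, n <- S]] => -[m n].
apply: contraR; rewrite -ltNge => h.
have hN : skew * md (w (m, n)) < N%:R.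
  apply: (@lt_trans _ _ (skew * `|r|)).
    by rewrite ltr_pM2l ?skew_gt0// (lt_le_trans h)// ler_norm.
  by apply: archi_boundP; rewrite mulr_ge0 ?skew_ge0.
have h1 := le_lt_trans (norm1_le (m, n)) hN; rewrite /norm1 /= -!abszE in h1.
have nn (k : nat) : (k%:Z%:~R : R) = k%:R by [].
rewrite !nn -natrD ltr_nat in h1.
by rewrite inE; apply/allpairsP; exists (m, n); split=> //=; apply: SN; lia.
Qed.

Definition zterm (z : C) (p : int * int) : C :=
  if p == 0 then 0 else (z - w p)^-1 + (w p)^-1 + z / w p ^+ 2.

(** The three summands of a term combine into [z ^+ 2 / (w ^+ 2 * (z - w))], of cubic
    decay. *)
Lemma zterm_le (z : C) p : 2 * md z <= md (w p) ->
  md (zterm z p) <= 2 * md z ^+ 2 * skew ^+ 3 * cubic_decay R p.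
Proof.
move=> h; rewrite /zterm /cubic_decay; case: eqP => [_|/eqP p0].
  by rewrite md0 mulr0.
have w0 : w p != 0 by rewrite lattice_point_eq0.
have mw : 0 < md (w p) by rewrite md_gt0.
have zw : md (w p) / 2 <= md (z - w p).
  by have := md_subr (w p) z; rewrite mdBC; lra.
have zw0 : z - w p != 0 by rewrite -md_gt0; lra.
have -> : (z - w p)^-1 + (w p)^-1 + z / w p ^+ 2 = z ^+ 2 / (w p ^+ 2 * (z - w p)).
  by field; rewrite w0 zw0.
rewrite mdM mdV mdM !mdX.
have n1 := norm1_ge1 R p0; have nw := norm1_le p.
have n0 : 0 < norm1 R p by lra.
have n3 : norm1 R p ^+ 3 <= skew ^+ 3 * md (w p) ^+ 3.
  by rewrite -exprMn lerXn2r// ?nnegrE ?mulr_ge0 ?skew_ge0 ?md_ge0//; lra.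
rewrite -2!mulrA [2 * _]mulrCA; apply: ler_wpM2l; first by rewrite exprn_ge0// md_ge0.
rewrite mulrA ler_pdivlMr ?exprn_gt0// mulrC ler_pdivrMr; last first.
  by rewrite mulr_gt0 ?exprn_gt0//; lra.
have : 2 * skew ^+ 3 * (md (w p) ^+ 2 * (md (w p) / 2)) <= 2 * skew ^+ 3 * (md (w p) ^+ 2 * md (z - w p)).
  rewrite ler_wpM2l//; first by rewrite mulr_ge0// exprn_ge0 ?skew_ge0//.
  by rewrite ler_wpM2l// exprn_ge0// ltW.
apply: le_trans; apply: (le_trans n3); rewrite le_eqVlt; apply/orP; left; apply/eqP.
by rewrite (exprS _ 2); field.
Qed.

Lemma zterm_coef_ge0 (r : R) : 0 <= 2 * r ^+ 2 * skew ^+ 3.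
Proof.
apply: mulr_ge0; first by rewrite mulr_ge0// sqr_ge0.
exact/exprn_ge0/skew_ge0.
Qed.

Lemma zterm_bound_ge0 (r : R) p : 0 <= 2 * r ^+ 2 * skew ^+ 3 * cubic_decay R p.
Proof.
by apply: mulr_ge0; [exact: zterm_coef_ge0|exact: cubic_decay_ge0].
Qed.

Lemma zterm_bound_sum (r : R) (J : {fset int * int}) :
  \sum_(p <- J) 2 * r ^+ 2 * skew ^+ 3 * cubic_decay R p <= 2 * r ^+ 2 * skew ^+ 3 * (8 * 36).
Proof.
rewrite -mulr_sumr; apply: ler_wpM2l; last exact: cubic_decay_summable.
exact: zterm_coef_ge0.
Qed.

Lemma zterm_le_disc (r : R) (F : {fset int * int}) (z : C) p :
  (forall p, p \notin F -> 2 * r <= md (w p)) -> md z < r -> p \notin F ->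
  md (zterm z p) <= 2 * r ^+ 2 * skew ^+ 3 * cubic_decay R p.
Proof.
move=> hF zr pF; have z0 := md_ge0 z.
apply: (le_trans (zterm_le _)); first by have := hF _ pF; lra.
apply: ler_wpM2r; first exact: cubic_decay_ge0.
apply: ler_wpM2r; first by rewrite exprn_ge0 ?skew_ge0//.
by rewrite ler_wpM2l// lerXn2r// ?nnegrE//; lra.
Qed.

Lemma sumto_zterm (z : C) : sumto (zterm z) (zeta z - z^-1).
Proof.
have z1 : md z < md z + 1 by lra.
have [F hF] := lattice_disc_finite (2 * (md z + 1)).
have [s [hs _]] := dominated_sumto (zterm_bound_ge0 (md z + 1))
  (zterm_bound_sum (md z + 1)) (fun p => zterm_le_disc hF z1).
by rewrite /zeta addrAC subrr add0r /lattice_sum (sumtoE hs).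
Qed.

(** Where the second alternative fails, [2 * md z] is at most the modulus of every
    nonzero lattice point; the constant 1000 exceeds [2 * (8 * 36)]. *)
Lemma zeta_near0 (z : C) : md (zeta z - z^-1) <= 1000 * skew ^+ 3 * md z ^+ 2 \/
  1 <= 2 * skew * md z.
Proof.
have [h|h] := lerP 1 (2 * skew * md z); [by right|left].
have hp p : md (zterm z p) <= 2 * md z ^+ 2 * skew ^+ 3 * cubic_decay R p.
  have [->|p0] := eqVneq p 0; first by rewrite /zterm /cubic_decay eqxx md0 mulr0.
  apply: zterm_le; have := norm1_le p; have := norm1_ge1 R p0 => h1 h2.
  rewrite -(ler_pM2l skew_gt0); lra.
have := sumto_le (sumto_zterm z) hp (zterm_bound_sum _).
move/le_trans; apply.
have : 0 <= skew ^+ 3 * md z ^+ 2 by rewrite mulr_ge0 ?exprn_ge0 ?md_ge0 ?skew_ge0//.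
move: (skew ^+ 3) (md z ^+ 2) => a b; lra.
Qed.

Lemma approx_zterm (r : R) p : 0 < r -> 2 * r <= md (w p) -> approx 0 r (zterm^~ p).
Proof.
move=> r0 hp; have w0 : w p != 0 by rewrite -md_gt0; lra.
have p0 : p != 0 by rewrite -lattice_point_eq0.
have V : approx 0 r (fun z => (z - w p)^-1).
  apply: (@approxV _ _ _ _ (- w p)) => //; first by rewrite oppr_eq0.
    by apply: approxD; [exact: approx_id|exact: approx_cst].
  move=> u ur; have -> : 1 - (0 + u - w p) / - w p = u / w p.
    by field.
  rewrite mdM mdV ler_pdivrMr ?md_gt0//; lra.
apply: approx_eq (approxD (approxD V (@approx_cst _ _ _ (w p)^-1))
  (approxM r0 (@approx_id _ _ _) (@approx_cst _ _ _ (w p ^+ 2)^-1))).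
by move=> u _; rewrite /zterm (negbTE p0).
Qed.

(** On any disc, [zeta] is a finite sum of explicit polar terms plus a function
    analytic on the disc, and the partial sums converge uniformly. *)
Lemma zeta_split (r : R) : 0 < r -> exists F : {fset int * int}, exists f : C -> C,
  [/\ forall p, p \notin F -> 2 * r <= md (w p), approx 0 r f,
     forall z, zeta z = z^-1 + \sum_(p <- F) zterm z p + f z &
     forall e : R, 0 < e -> exists A : {fset int * int}, F `<=` A /\
       forall B : {fset int * int}, A `<=` B -> forall z, md z < r ->
       md (f z - \sum_(p <- B `\` F) zterm z p) <= e].
Proof.
move=> r0; have [F hF] := lattice_disc_finite (2 * r).
pose f z := zeta z - z^-1 - \sum_(p <- F) zterm z p.
have hf (e : R) : 0 < e -> exists A : {fset int * int}, F `<=` A /\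
       forall B : {fset int * int}, A `<=` B -> forall z, md z < r ->
       md (f z - \sum_(p <- B `\` F) zterm z p) <= e.
  move=> e0; have [A hA] := summable_tail (zterm_bound_ge0 r) (zterm_bound_sum r) e0.
  exists (A `|` F); split; first exact: fsubsetUr.
  move=> B AB z zr.
  have [s [hs hh]] := dominated_sumto (zterm_bound_ge0 r) (zterm_bound_sum r)
     (fun p => zterm_le_disc hF zr).
  have FB : F `<=` B by apply: fsubset_trans AB; exact: fsubsetUr.
  have := hh (A `|` F) e (fsubsetUr _ _) _ B AB.
  rewrite (sumto_uniq hs (sumto_zterm z)) /f => {}hh.
  have BE : B = F `|` (B `\` F).
    by apply/fsetP => i; rewrite !inE; case: (boolP (i \in F)) => //= /(fsubsetP FB).
  have dj : [disjoint F & B `\` F]%fset by apply/fdisjointP => i iB; rewrite inE iB.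
  rewrite -addrA -opprD -sum_fsetU// -BE mdBC; apply: hh.
  by move=> D; rewrite fdisjointUX => /andP[/hA].
exists F, f; split=> //; last by move=> z; rewrite /f; ring.
apply: approx_lim => e /hf[A [FA hA]].
exists (fun z => \sum_(p <- A `\` F) zterm z p).
  apply: approx_eq (_ : approx 0 r (fun z => \sum_(p <- A `\` F | p \notin F) zterm z p)).
    by move=> u _; apply: sum_pred_all => p; rewrite inE => /andP[].
  by apply: approx_sum => p pF; apply: approx_zterm => //; exact: hF.
by move=> u ur; apply: hA => //; rewrite add0r.
Qed.

Lemma zeta_odd z : zeta (- z) = - zeta z.
Proof.
have h := sumtoN (sumto_reindex (@opprK _) (@opprK _) (sumto_zterm (- z))).
have : sumto (zterm z) (- (zeta (- z) - (- z)^-1)).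
  apply: sumto_eq h => p /=; rewrite /zterm oppr_eq0; case: eqP => [_|_]; first by rewrite oppr0.
  by rewrite lattice_pointN sqrrN -opprD !invrN !opprD !opprK mulNr opprK.
move=> h2; have := sumto_uniq h2 (sumto_zterm z).
rewrite invrN => h3; have : zeta (- z) = - (- (zeta (- z) - - z^-1)) - z^-1 by ring.
by rewrite h3 => ->; ring.
Qed.

(** With the polar term at 0 counted as the term of index 0, translation by a
    lattice point is a reindexing of the sum. *)
Definition full_term (z : C) (p : int * int) : C :=
  (z - w p)^-1 + (if p == 0 then 0 else (w p)^-1 + z / w p ^+ 2).

Lemma sumto_full_term (z : C) : sumto (full_term z) (zeta z).
Proof.
have := sumtoD (sumto_zterm z) (sumto1 0 z^-1); rewrite subrK.
apply: sumto_eq => p; rewrite /zterm /full_term; case: eqP => [->|_].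
  by rewrite /lattice_point mul0r !addr0 subr0 add0r.
by rewrite addr0 addrA.
Qed.

(** Differences [zeta (z + w q) - zeta z] for two values of [z], summed term by
    term, differ by a multiple of the difference of the arguments; oddness kills
    the multiple. *)
Lemma zeta_quasi_periodic (q : int * int) :
  exists c, forall z, zeta (z + w q) - zeta z = c.
Proof.
pose s p : C := if p == 0 then 0 else (w p ^+ 2)^-1.
pose E z := zeta (z + w q) - zeta z.
have hE z z' : sumto (fun p => (z - z') * (s p - s (p - q))) (E z - E z').
  have hv y y' : sumto (fun p => full_term y p - full_term y' p) (zeta y - zeta y').
    exact: sumtoD (sumto_full_term y) (sumtoN (sumto_full_term y')).
  have h2 := sumto_reindex (subrK q) (addrK q) (hv z z').
  have h3 := sumtoD (hv (z + w q) (z' + w q)) (sumtoN h2).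
  have -> : E z - E z' = zeta (z + w q) - zeta (z' + w q) - (zeta z - zeta z').
    by rewrite /E; ring.
  apply: sumto_eq h3 => p /=; rewrite /full_term /s lattice_pointB.
  have e1 y : y + w q - w p = y - (w p - w q) by ring.
  rewrite !e1; case: (p == 0); case: (p - q == 0); ring.
have [K hK] : exists K, forall z z', E z - E z' = (z - z') * K.
  exists (E 1 - E 0) => z z'.
  have := hE 1 0; rewrite subr0 => h1.
  apply: sumto_uniq (hE z z') _; apply: sumto_eq (sumtoZ (z - z') h1) => p.
  by rewrite mul1r.
have Eodd z : E (- z - w q) = E z.
  by rewrite /E subrK -opprD !zeta_odd; ring.
have K0 : K = 0.
  have h z : (2 * z + w q) * K = 0.
    have := hK z (- z - w q); rewrite Eodd subrr => h; rewrite h; ring.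
  have h1 : 2 * K = (2 * 1 + w q) * K - (2 * 0 + w q) * K by ring.
  by move: h1; rewrite !h subrr => /eqP; rewrite mulf_eq0 pnatr_eq0 /= => /eqP.
exists (E 0) => z; have := hK z 0; rewrite K0 mulr0 => /eqP.
by rewrite subr_eq0 => /eqP.
Qed.

(** The sum may be differentiated term by term: by Cauchy's estimate the derivative
    of a uniformly small remainder is small. *)
Lemma wp_zeta (c : C) : c \notin lattice ->
  analytic zeta c /\ is_derive c (1 : C) zeta (- wp c).
Proof.
move=> cL.
have cw p : c - w p != 0.
  by rewrite subr_eq0; apply: contra cL => /eqP ->; apply/latticeE; exists p.1, p.2.
have c0 : c != 0 by have := cw 0; rewrite /lattice_point mul0r addr0 subr0.
have r0 : 0 < md c + 1 by have := md_ge0 c; lra.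
have [F [f [hF af zf hf]]] := zeta_split r0.
have anV p : analytic (fun z => (z - w p)^-1) c.
  apply: analytic_inv => //.
  by apply: analyticB; [exact: analytic_id|exact: analytic_cst].
have anI : analytic (fun z => z^-1) c by apply: analytic_inv => //; exact: analytic_id.
have anz p : analytic (zterm^~ p) c.
  rewrite /zterm; case: (p == 0); first exact: analytic_cst.
  apply: analyticD; last by apply: analyticM; [exact: analytic_id|exact: analytic_cst].
  by apply: analyticD => //; exact: analytic_cst.
have anf : analytic f c.
  by exists 1 => //; apply: approx_sub af _; rewrite subr0.
have zan : analytic zeta c.
  apply: (@analytic_near _ (fun z => z^-1 + \sum_(p <- F) zterm z p + f z)).
    by near=> z; rewrite zf.
  by do 2?apply: analyticD => //; apply: analytic_sum => p _.
split=> //.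
suff -> : - wp c = derive1 zeta c by exact: analytic_is_derive.
pose t p : C := if p == 0 then 0 else (c - w p) ^- 2 - w p ^- 2.
have dV a : c - a != 0 -> is_derive c (1 : C) (fun z => (z - a)^-1) (- (c - a) ^- 2).
  move=> ca; apply: deriveC_eq (deriveC_inv (deriveC_sub (deriveC_id c) (deriveC_cst a c)) ca) _.
  by rewrite subr0 mul1r.
have dz p : is_derive c (1 : C) (zterm^~ p) (- t p).
  rewrite /zterm /t; case: (p == 0); first by rewrite oppr0; exact: deriveC_cst.
  apply: deriveC_eq (deriveC_add (deriveC_add (dV _ (cw p)) (deriveC_cst (w p)^-1 c))
    (deriveC_mul (deriveC_id c) (deriveC_cst (w p ^+ 2)^-1 c))) _.
  by ring.
have dS (B : {fset int * int}) : is_derive c (1 : C)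
    (fun z => z^-1 + \sum_(p <- B) zterm z p) (- c ^- 2 + \sum_(p <- B) - t p).
  apply: deriveC_add; last exact: deriveC_sum.
  have := dV 0; rewrite subr0 => /(_ c0); apply: is_derive_near.
  by near=> z; rewrite subr0.
have st : sumto t (- derive1 zeta c - c ^- 2).
  (* Cauchy's estimate on a disc of radius 1 costs a factor 8. *)
  move=> e e0; have [|A [FA hA]] := hf (e / 16); first lra.
  exists A => B AB.
  have FB : F `<=` B by exact: fsubset_trans AB.
  have BE : B = F `|` (B `\` F).
    by apply/fsetP => i; rewrite !inE; case: (boolP (i \in F)) => //= /(fsubsetP FB).
  have dj : [disjoint F & B `\` F]%fset by apply/fdisjointP => i iB; rewrite inE iB.
  pose d z := f z - \sum_(p <- B `\` F) zterm z p.
  have ad : approx 0 (md c + 1) d.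
    have h : approx 0 (md c + 1) (fun z => \sum_(p <- B `\` F | p \notin F) zterm z p).
      by apply: approx_sum => p pF; apply: approx_zterm => //; exact: hF.
    apply: approx_eq (approxD af (approxM r0 (@approx_cst _ _ _ (-1)) h)) => u _.
    rewrite mulN1r /d; congr (_ - _).
    by apply: sum_pred_all => p; rewrite inE => /andP[].
  have adc : approx c 1 d by apply: approx_sub ad _; rewrite subr0.
  have dle u : md u < 1 -> md (d (c + u)) <= e / 16.
    by move=> u1; apply: hA => //; have := mdD c u; lra.
  have := cauchy_derive_le ltr01 adc dle.
  have dd : is_derive c (1 : C) d (derive1 zeta c - (- c ^- 2 + \sum_(p <- B) - t p)).
    apply: is_derive_near (deriveC_sub (analytic_is_derive zan) (dS B)).
    near=> z; rewrite /d -[LHS]/(zeta z - (z^-1 + \sum_(p <- B) zterm z p)) zf {1}BE sum_fsetU//; ring.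
  rewrite (is_derive1E dd) mulr1 sumrN.
  have -> : derive1 zeta c - (- c ^- 2 - \sum_(p <- B) t p) =
    \sum_(p <- B) t p - (- derive1 zeta c - c ^- 2) by ring.
  by move=> /le_lt_trans; apply; lra.
rewrite /wp /lattice_sum (sumtoE st); ring.
Unshelve. all: by end_near. Qed.

(** By [zeta_near0] the difference [zeta z - 1 / z] is quadratically small, so that
    its Taylor expansion has neither a constant nor a linear term. *)
Lemma zeta_laurent : exists g : C -> C, [/\ analytic g 0, g 0 = 0 &
  \forall z \near 0, zeta z = z^-1 + z * g z].
Proof.
have [F [f [hF af zf hf]]] := zeta_split ltr01.
have anz p : analytic (zterm^~ p) 0.
  rewrite /zterm; case: eqP => [_|/eqP p0]; first exact: analytic_cst.
  apply: analyticD; last by apply: analyticM; [exact: analytic_id|exact: analytic_cst].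
  apply: analyticD; last exact: analytic_cst.
  apply: analytic_inv; last by rewrite sub0r oppr_eq0 lattice_point_eq0.
  by apply: analyticB; [exact: analytic_id|exact: analytic_cst].
pose e z := \sum_(p <- F) zterm z p + f z.
have ae : analytic e 0.
  by apply: analyticD; [apply: analytic_sum => p _|exists 1].
have ez z : zeta z - z^-1 = e z by rewrite zf /e; ring.
have [a [ea _ hrem]] := analytic_remainder ae.
have [g1 [g1a g1c hg1]] := hrem 1; have [g2 [g2a g2c hg2]] := hrem 2%N.
pose k := skew; have k0 : 0 < k := skew_gt0.
have hle z : md z < 1 / (2 * k) -> md (e z) <= 1000 * k ^+ 3 * md z ^+ 2.
  rewrite ltr_pdivlMr ?mulr_gt0// => hz; rewrite -ez.
  by have [//|] := zeta_near0 z; rewrite -/k => h; have := lt_le_trans hz h; lra.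
have kk : 0 < 1 / (2 * k) by rewrite divr_gt0// mulr_gt0.
have e0 : a 0 = 0.
  have := hle 0; rewrite md0 => /(_ kk); rewrite expr0n mulr0 -ea => h.
  by apply/eqP; rewrite -md_eq0 eq_le h md_ge0.
exists g1; split=> //; last first.
  apply: filterS hg1 => z; rewrite big_ord1 e0 mul0r add0r subr0 expr1 -ez => <-.
  by rewrite subrKC.
rewrite g1c.
apply/eqP; rewrite -md_eq0 eq_le md_ge0 andbT; apply/ler_addgt0Pr => d d0; rewrite add0r.
have /continuousC/(_ 1 ltr01) cg2 := analytic_cont g2a.
have /nbhsC[r r0 hr] : \forall z \near (0 : C), e z = a 1 * z + z ^+ 2 * g2 z /\ md (g2 z - g2 0) < 1.
  near=> z; split; last by near: z.
  rewrite (near hg2 z)//; rewrite big_ord_recl big_ord1 /= /bump /= e0 mul0r add0r subr0 expr1//.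
pose B := 1000 * k ^+ 3 + md (g2 0) + 1.
have B0 : 0 < B.
  have : 0 < k ^+ 3 by rewrite exprn_gt0.
  by have := md_ge0 (g2 0); rewrite /B; lra.
pose t := Num.min (Num.min (r / 2) (1 / (2 * k) / 2)) (d / B).
have t0 : 0 < t by rewrite !lt_min !divr_gt0// mulr_gt0.
have tm : t <= r / 2 /\ t <= 1 / (2 * k) / 2 /\ t <= d / B.
  by rewrite /t !ge_min !lexx !orbT.
have mt : md t%:C%C = t by rewrite md_real gtr0_norm.
have [|E1 E2] := hr t%:C%C; first by rewrite subr0 mt; lra.
have := hle t%:C%C; rewrite mt E1 => /(_ _) h1.
have {}h1 : md (a 1 * t%:C%C + t%:C%C ^+ 2 * g2 t%:C%C) <= 1000 * k ^+ 3 * t ^+ 2.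
  by apply: h1; lra.
have := md_subr (a 1 * t%:C%C) (- (t%:C%C ^+ 2 * g2 t%:C%C)).
rewrite opprK mdN !mdM ?mdX !mt => h2.
have h3 : md (g2 t%:C%C) <= md (g2 0) + 1.
  by have := md_subr (g2 t%:C%C) (g2 0); lra.
have : md (a 1) * t <= B * t * t.
  rewrite /B; move: h1 h2; rewrite !expr2; move: (md (_ + _)) (md (g2 _)) h3 => X G h3 h1 h2.
  have : t * t * G <= t * t * (md (g2 0) + 1) by rewrite ler_wpM2l// mulr_ge0// ltW.
  lra.
rewrite ler_pM2r// => /le_trans; apply.
by rewrite mulrC -ler_pdivlMr//; case: tm => _ [].
Unshelve. all: by end_near. Qed.

End Zeta.

(** * Elliptic functions of the type of the Jacobi function ns *)

(** Second order matching finds the operands, so that one call treats any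
    polynomial expression in functions known to be analytic. *)
Ltac analytic_auto := repeat lazymatch goal with
  | |- analytic (fun z => z) _ => exact (analytic_id _)
  | |- analytic (fun z => @?f z - @?g z) _ => refine (@analyticB _ f g _ _ _); cbv beta
  | |- analytic (fun z => - @?f z) _ => refine (@analyticN _ f _ _); cbv beta
  | |- analytic (fun z => @?f z + @?g z) _ => refine (@analyticD _ f g _ _ _); cbv beta
  | |- analytic (fun z => @?f z * @?g z) _ => refine (@analyticM _ f g _ _ _); cbv beta
  | |- analytic (fun z => @?f z ^+ ?n) _ => refine (@analyticX _ f _ n _); cbv beta
  | |- analytic _ _ => first [assumption | exact (analytic_cst _ _)]
  end.

Lemma int_parity (n : int) : exists k : int, n = 2 * k \/ n = 2 * k + 1.
Proof.
case: n => n; [exists (n./2)%:Z|exists (- (n.+2./2)%:Z)].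
  by have := odd_double_half n; case: (odd n); lia.
by rewrite NegzE; have := odd_double_half n; rewrite /=; case: (odd n) => /=; lia.
Qed.

Section SpanInt.
Variable R : realType.
Local Notation C := (CC R).
Local Notation md := (@md R).

Definition span_int (a b z : C) := exists m n : int, z = m%:~R * a + n%:~R * b.

(** [h] is, up to a factor, the Jacobi function [ns]: odd, with period [al] and
    half-period [be] (translation by [be] changes its sign), with a simple pole
    of residue 1 at 0 and poles only on the lattice spanned by [al] and [be].
    [P] is periodic for that lattice and has the polar part [1 / z ^ 2] at 0. *)
Record ns_function (al be : C) (k : R) (h P : C -> C) := NsFunction {
  ns_coords : real_basis al be;
  ns_coords_le : forall x y : R,
    `|x| + `|y| <= k * md (al * x%:C%C + be * y%:C%C);
  ns_analytic : forall z, ~ span_int al be z -> analytic h z;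
  ns_odd : forall z, h (- z) = - h z;
  ns_al : forall z, h (z + al) = h z;
  ns_be : forall z, h (z + be) = - h z;
  ns_pole : exists2 g, analytic g 0 & \forall z \near 0^', h z = z^-1 + g z;
  ns_P_analytic : forall z, ~ span_int al be z -> analytic P z;
  ns_P_al : forall z, ~ span_int al be z -> P (z + al) = P z;
  ns_P_be : forall z, ~ span_int al be z -> P (z + be) = P z;
  ns_P_pole : exists2 g, analytic g 0 /\ g 0 = 0 &
    \forall z \near 0^', P z = z ^- 2 + g z }.

Variables (al be : C) (k : R).
Local Notation L := (span_int al be).

Lemma span0 : L 0. Proof. by exists 0, 0; rewrite !mul0r addr0. Qed.

Lemma spanB z w : L z -> L w -> L (z - w).
Proof.
move=> [m [n ->]] [m' [n' ->]]; exists (m - m'), (n - n').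
by rewrite !rmorphB /=; ring.
Qed.

Lemma spanN z : L z -> L (- z).
Proof. by move=> Lz; rewrite -[- z]sub0r; exact: spanB span0 Lz. Qed.

Lemma spanD z w : L z -> L w -> L (z + w).
Proof. by move=> Lz /spanN; rewrite -{2}[w]opprK; exact: spanB. Qed.

Lemma span_l : L al. Proof. by exists 1, 0; rewrite mul0r addr0 mul1r. Qed.
Lemma span_r : L be. Proof. by exists 0, 1; rewrite mul0r add0r mul1r. Qed.

Lemma span_addr z w : L w -> (L (z + w) <-> L z).
Proof.
by move=> Lw; split=> [h'|Lz]; [rewrite -(addrK w z); exact: spanB|exact: spanD].
Qed.

Hypothesis coords_le : forall x y : R,
  `|x| + `|y| <= k * md (al * x%:C%C + be * y%:C%C).

Lemma span_gap : exists2 d : R, 0 < d & forall z, L z -> md z < d -> z = 0.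
Proof.
have int_small (m : int) : `|m%:~R : R| < 1 -> m = 0.
  by rewrite -intr_norm -[1]/(1%:~R) ltr_int; lia.
have s0 : 0 < `|k| + 1 by have := normr_ge0 k; lra.
exists (`|k| + 1)^-1 => [|z [m [n zE]] zd]; first by rewrite invr_gt0.
have := coords_le m%:~R n%:~R.
have -> : al * (m%:~R : R)%:C%C + be * (n%:~R : R)%:C%C = z.
  by rewrite zE !rmorph_int; ring.
move=> hh; have h1 : k * md z < 1.
  have : k * md z <= (`|k| + 1) * md z.
    by rewrite ler_wpM2r ?md_ge0//; have := ler_norm k; lra.
  move=> /le_lt_trans; apply.
  by rewrite mulrC -ltr_pdivlMr// mul1r.
have m1 := normr_ge0 (m%:~R : R); have n1 := normr_ge0 (n%:~R : R).
have -> : z = 0 => //.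
have hm : m = 0 by apply: int_small; lra.
have hn : n = 0 by apply: int_small; lra.
by rewrite zE hm hn !mul0r addr0.
Qed.

Lemma near_notin_span c : \forall z \near c^', ~ L z.
Proof.
have [d d0 hd] := span_gap.
have [Lc|nLc] := pselect (L c).
  apply/dnbhsC; exists d => // z zc zd Lz; move/eqP: zc; apply.
  by apply/eqP; rewrite -subr_eq0; apply/eqP/hd => //; exact: spanB.
have [[z Lz zc]|nex] := pselect (exists2 z, L z & md (z - c) < d / 2).
  have zc0 : z != c by apply/eqP => zc'; apply: nLc; rewrite -zc'.
  have e0 : 0 < Num.min (d / 2) (md (z - c)).
    by rewrite lt_min md_gt0 subr_eq0 zc0 andbT; lra.
  apply/dnbhsC; exists (Num.min (d / 2) (md (z - c))) => // w wc.
  rewrite lt_min => /andP[h1 h2] Lw.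
  have wz : w = z.
    apply/eqP; rewrite -subr_eq0; apply/eqP/hd; first exact: spanB.
    by have := md_tri w c z; rewrite (mdBC c z); lra.
  by rewrite wz ltxx in h2.
apply/dnbhsC; exists (d / 2) => [|w _ wc Lw]; first lra.
by apply: nex; exists w.
Qed.

Lemma notin_span_open c : ~ L c -> \forall z \near c, ~ L z.
Proof.
move=> nLc; have /dnbhsC[e e0 he] := near_notin_span c.
by apply: (nearC e0) => w hw; have [->//|wc] := eqVneq w c; exact: he.
Qed.

End SpanInt.

Section NsFunction.
Variable R : realType.
Local Notation C := (CC R).
Local Notation md := (@md R).
Variables (al be : C) (skew0 : R) (h P : C -> C).
Hypothesis ns : ns_function al be skew0 h P.
Local Notation L := (span_int al be).
Local Notation L2 := (span_int al (2 * be)).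
Local Notation coords := (ns_coords ns).
Local Notation coords_le := (ns_coords_le ns).
Local Notation h_analytic := (ns_analytic ns).
Local Notation h_odd := (ns_odd ns).
Local Notation h_al := (ns_al ns).
Local Notation h_be := (ns_be ns).
Local Notation h_pole := (ns_pole ns).
Local Notation P_analytic := (ns_P_analytic ns).
Local Notation P_al := (ns_P_al ns).
Local Notation P_be := (ns_P_be ns).
Local Notation P_pole := (ns_P_pole ns).
Local Notation span0 := (span0 al be).
Local Notation span_l := (span_l al be).
Local Notation span_r := (span_r al be).
Local Notation near_notin_span := (near_notin_span (ns_coords_le ns)).
Local Notation notin_span_open := (notin_span_open (ns_coords_le ns)).
Local Notation span_gap := (span_gap (ns_coords_le ns)).

(** [Phi] is controlled off [L] only; extended by 0 on [L] it satisfies the same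
    relations everywhere, and these can be iterated. *)
Lemma sign_translate (Phi : C -> C) (e : C) :
  (forall z, ~ L z -> Phi (z + al) = Phi z) ->
  (forall z, ~ L z -> Phi (z + be) = e * Phi z) -> e ^+ 2 = 1 ->
  forall c, L c -> (exists s, s ^+ 2 = 1 /\ forall z, ~ L z -> Phi (z + c) = s * Phi z).
Proof.
move=> pa pb e2 c [m [n ->]].
pose Psi z := if `[< L z >] then 0 else Phi z.
have PsiE z : ~ L z -> Psi z = Phi z by move=> nL; rewrite /Psi; case: asboolP.
have Psi0 z : L z -> Psi z = 0 by move=> Lz; rewrite /Psi; case: asboolP.
have qa z : Psi (z + al) = Psi z.
  have [Lz|nLz] := pselect (L z); first by rewrite !Psi0//; apply: spanD => //; exact: span_l.
  by rewrite !PsiE ?pa//; move/(span_addr _ span_l).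
have qb z : Psi (z + be) = e * Psi z.
  have [Lz|nLz] := pselect (L z).
    by rewrite !Psi0 ?mulr0//; apply: spanD => //; exact: span_r.
  by rewrite !PsiE ?pb//; move/(span_addr _ span_r).
have qb2 z : Psi (z + 2 * be) = Psi z.
  have -> : z + 2 * be = z + be + be by ring.
  by rewrite !qb mulrA -expr2 e2 mul1r.
have back s : (forall z, Psi (z + (m%:~R * al + n%:~R * be)) = s * Psi z) ->
    forall z, ~ L z -> Phi (z + (m%:~R * al + n%:~R * be)) = s * Phi z.
  move=> hs z nLz; have Lw : L (m%:~R * al + n%:~R * be) by exists m, n.
  by rewrite -[in RHS](PsiE _ nLz) -hs PsiE//; move/(span_addr _ Lw).
have [k [nk|nk]] := int_parity n.
  exists 1; split; first by rewrite expr1n.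
  apply: back => z; rewrite mul1r.
  have -> : z + (m%:~R * al + n%:~R * be) = z + k%:~R * (2 * be) + m%:~R * al.
    by rewrite nk rmorphM /=; ring.
  by rewrite (periodic_int qa) (periodic_int qb2).
exists e; split=> //; apply: back => z.
have -> : z + (m%:~R * al + n%:~R * be) = z + be + k%:~R * (2 * be) + m%:~R * al.
  by rewrite nk rmorphD rmorphM /=; ring.
by rewrite (periodic_int qa) (periodic_int qb2) qb.
Qed.

Lemma removable_near (f g : C -> C) c : (\forall z \near c^', f z = g z) ->
  removable f c -> removable g c.
Proof.
move=> fg [k ka fk]; exists k => //.
by apply: filterS2 fg fk => z <- <-.
Qed.

Lemma removable_affine (f : C -> C) c : removable f 0 ->
  removable (fun z => f (z - c)) c.
Proof.
move=> [k ka /dnbhsC[e e0 he]]; exists (fun z => k (1 * z + - c)).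
  by apply: analytic_affine; rewrite ?oner_neq0// mul1r subrr.
apply/dnbhsC; exists e => // z zc ze; rewrite mul1r; apply: he.
  by rewrite subr_eq0.
by rewrite subr0.
Qed.

Lemma removableB (f g : C -> C) c : removable f c -> removable g c ->
  removable (fun z => f z - g z) c.
Proof.
move=> [k ka fk] [l la gl]; exists (fun z => k z - l z); first exact: analyticB.
by apply: filterS2 fk gl => z -> ->.
Qed.

Lemma removableZ (f : C -> C) a c : removable f c -> removable (fun z => a * f z) c.
Proof.
move=> [k ka fk]; exists (fun z => a * k z).
  by apply: analyticM => //; exact: analytic_cst.
by apply: filterS fk => z ->.
Qed.

(** Liouville for functions on the torus with all their singularities in [L]:
    by translation, only the origin has to be examined. *)
Lemma constant_off_L (Phi : C -> C) (e : C) :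
  (forall z, ~ L z -> Phi (z + al) = Phi z) ->
  (forall z, ~ L z -> Phi (z + be) = e * Phi z) -> e ^+ 2 = 1 ->
  (forall z, ~ L z -> analytic Phi z) -> removable Phi 0 ->
  exists K, forall z, ~ L z -> Phi z = K.
Proof.
move=> pa pb e2 an r0.
pose Psi z := if `[< L z >] then 0 else Phi z.
have PsiE z : ~ L z -> Psi z = Phi z by move=> nL; rewrite /Psi; case: asboolP.
have Psi0 z : L z -> Psi z = 0 by move=> Lz; rewrite /Psi; case: asboolP.
have Psian z : ~ L z -> analytic Psi z.
  move=> nLz; apply: analytic_near (an _ nLz).
  by apply: filterS (notin_span_open nLz) => w /PsiE.
have per c : L c -> (forall z, ~ L z -> Phi (z + c) = Phi z) ->
    forall z, Psi (z + c) = Psi z.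
  move=> Lc hc z; have [Lz|nLz] := pselect (L z).
    by rewrite !Psi0//; exact: spanD.
  by rewrite !PsiE ?hc//; move/(span_addr _ Lc).
have Lbb : L (2 * be) by exists 0, 2; rewrite mul0r add0r.
have pb2 z : ~ L z -> Phi (z + 2 * be) = Phi z.
  move=> nLz; have -> : z + 2 * be = z + be + be by ring.
  have nLb : ~ L (z + be) by move/(span_addr _ span_r).
  by rewrite !pb// mulrA -expr2 e2 mul1r.
have bas2 : real_basis al (2 * be).
  move=> z; have [x [y ->]] := coords z; exists x, (y / 2).
  by rewrite rmorphM fmorphV rmorph_nat /=; field.
have rem c : removable Psi c.
  have [Lc|nLc] := pselect (L c); last exact: analytic_removable (Psian _ nLc).
  have [s [_ hs]] := sign_translate pa pb e2 Lc.
  apply: removable_near (removableZ s (removable_affine c r0)).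
  apply: filterS (near_notin_span c) => z nLz; rewrite PsiE// -hs ?subrK//.
  by move=> h'; apply: nLz; rewrite -(subrK c z); exact: spanD.
have [K hK] := liouville_removable bas2 (per _ span_l pa) (per _ Lbb pb2) rem.
by exists K => z nLz; rewrite -PsiE// hK//; exact: Psian.
Qed.

(** The constant given by [constant_off_L] changes sign under [be]. *)
Lemma zero_off_L (Phi : C -> C) :
  (forall z, ~ L z -> Phi (z + al) = Phi z) ->
  (forall z, ~ L z -> Phi (z + be) = - Phi z) ->
  (forall z, ~ L z -> analytic Phi z) -> removable Phi 0 ->
  forall z, ~ L z -> Phi z = 0.
Proof.
move=> pa pb an r0.
have [| |K hK] := @constant_off_L Phi (-1) pa _ _ an r0.
- by move=> z /pb ->; rewrite mulN1r.
- by rewrite sqrrN expr1n.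
move=> z nLz; have nLb : ~ L (z + be) by move/(span_addr _ span_r).
have := pb z nLz; rewrite !hK// => /eqP; rewrite -addr_eq0 -mulr2n mulrn_eq0 /=.
by move=> /eqP.
Qed.

Lemma analytic_uniq (f g : C -> C) c : analytic f c -> analytic g c ->
  (\forall z \near c^', f z = g z) -> f c = g c.
Proof. by move=> fa ga; apply: dnear_uniq; exact: analytic_cont. Qed.

Lemma near_neq0 : \forall z \near (0 : C)^', z != 0.
Proof. by apply/dnbhsC; exists 1. Qed.

(** The Laurent expansion at the pole; oddness removes the constant and the
    quadratic terms. *)
Lemma h_laurent : exists a G, analytic G 0 /\
  \forall z \near 0^', h z = z^-1 + a * z + z ^+ 3 * G z.
Proof.
have [g ga hg] := h_pole.
have [a [_ _ /(_ 3%N)[G [Ga _ hG]]]] := analytic_remainder ga.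
have gan : analytic (fun z => g (-1 * z + 0)) 0.
  by apply: analytic_affine; rewrite ?oppr_eq0 ?oner_neq0// mulr0 addr0.
have Gan : analytic (fun z => G (-1 * z + 0)) 0.
  by apply: analytic_affine; rewrite ?oppr_eq0 ?oner_neq0// mulr0 addr0.
have hG' : \forall z \near 0^', h z = z^-1 + (a 0 + a 1 * z + a 2%N * z ^+ 2 + z ^+ 3 * G z).
  apply: filterS2 hg (near_dnear hG) => z -> ->.
  by rewrite !big_ord_recl big_ord0 /= /bump /= subr0 expr0 expr1; ring.
have opp (Q : set C) : (\forall z \near 0^', Q z) -> \forall z \near (0 : C)^', Q (- z).
  move=> /dnbhsC[e e0 he]; apply/dnbhsC; exists e => // z z0 ze; apply: he.
    by rewrite oppr_eq0.
  by rewrite subr0 mdN; rewrite subr0 in ze.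
have hN := opp _ hG'.
have sym : \forall z \near 0^',
    a 0 + a 2%N * z ^+ 2 + z ^+ 3 * ((G z - G (-1 * z + 0)) / 2) = 0.
  near=> z.
  have z0 : z != 0 by near: z; exact: near_neq0.
  have e1 : h z = z^-1 + (a 0 + a 1 * z + a 2%N * z ^+ 2 + z ^+ 3 * G z) by near: z.
  have e2 : h (- z) = (- z)^-1 + (a 0 + a 1 * (- z) + a 2%N * (- z) ^+ 2 + (- z) ^+ 3 * G (- z)).
    by near: z.
  rewrite mulN1r addr0; rewrite h_odd e1 in e2.
  apply: (mulfI (_ : (2 : C) != 0)); first by rewrite pnatr_eq0.
  have -> : 2 * (a 0 + a 2%N * z ^+ 2 + z ^+ 3 * ((G z - G (- z)) / 2)) =
    (z^-1 + (a 0 + a 1 * z + a 2%N * z ^+ 2 + z ^+ 3 * G z)) +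
    ((- z)^-1 + (a 0 + a 1 * (- z) + a 2%N * (- z) ^+ 2 + (- z) ^+ 3 * G (- z))).
    by rewrite invrN; field.
  by rewrite -e2 subrr mulr0.
have Pc (c : C) := analytic_cst c (0 : C); have Pi := analytic_id (0 : C).
have GG : analytic (fun z => (G z - G (-1 * z + 0)) / 2) 0.
  by apply: analyticM => //; apply: analyticB.
have a00 : a 0 = 0.
  have F1 : analytic (fun z => a 0 + a 2%N * z ^+ 2 + z ^+ 3 * ((G z - G (-1 * z + 0)) / 2)) 0.
    by analytic_auto.
  by have := analytic_uniq F1 (Pc 0) sym; rewrite /= !expr0n /= mulr0 mul0r !addr0.
have a20 : a 2%N = 0.
  have F1 : analytic (fun z => a 2%N + z * ((G z - G (-1 * z + 0)) / 2)) 0.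
    by analytic_auto.
  have := analytic_uniq F1 (Pc 0); rewrite /= mul0r addr0; apply.
  near=> z; have z0 : z != 0 by near: z; exact: near_neq0.
  apply: (mulfI (_ : z ^+ 2 != 0)); first by rewrite expf_neq0.
  have e3 : a 0 + a 2%N * z ^+ 2 + z ^+ 3 * ((G z - G (-1 * z + 0)) / 2) = 0 by near: z.
  by rewrite mulr0 -[RHS]e3 a00; ring.
exists (a 1), G; split=> //; apply: filterS hG' => z ->.
by rewrite a00 a20; ring.
Unshelve. all: by end_near. Qed.

Local Notation h1 := (derive1 h).
Local Notation h2 := (derive1 h1).

Lemma h1_analytic z : ~ L z -> analytic h1 z.
Proof. by move=> /h_analytic; exact: analytic_derive. Qed.

Lemma h2_analytic z : ~ L z -> analytic h2 z.
Proof. by move=> /h1_analytic; exact: analytic_derive. Qed.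

Lemma derive1_translate (f : C -> C) (c s z : C) : analytic f z ->
  (\forall w \near z, f (w + c) = s * f w) -> derive1 f (z + c) = s * derive1 f z.
Proof.
move=> fa hf; apply: is_derive1E.
have e1 : is_derive z (1 : C) (fun w => s * f w) (s * derive1 f z).
  apply: deriveC_eq (deriveC_mul (deriveC_cst s z) (analytic_is_derive fa)) _.
  by rewrite mulr0 addr0.
have e2 : is_derive (1 * (z + c) + - c) (1 : C) (fun w => s * f w) (s * derive1 f z).
  by rewrite mul1r addrK.
have := is_derive_affine e2; rewrite mul1r; apply: is_derive_near.
move/nbhsC: hf => [e e0 he]; apply: (nearC e0) => w hw.
rewrite mul1r -he ?subrK//.
by have -> : w - c - z = w - (z + c) by ring.
Qed.

Lemma h1_translate c s : L c -> (forall z, h (z + c) = s * h z) ->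
  forall z, ~ L z -> h1 (z + c) = s * h1 z.
Proof.
move=> Lc hc z nLz; apply: derive1_translate; first exact: h_analytic.
by near=> w.
Unshelve. all: by end_near. Qed.

Lemma h2_translate c s : L c -> (forall z, h (z + c) = s * h z) ->
  forall z, ~ L z -> h2 (z + c) = s * h2 z.
Proof.
move=> Lc hc z nLz; apply: derive1_translate; first exact: h1_analytic.
by apply: filterS (notin_span_open nLz) => w; exact: h1_translate.
Qed.

Lemma h_al1 z : h (z + al) = 1 * h z. Proof. by rewrite h_al mul1r. Qed.
Lemma h_be1 z : h (z + be) = -1 * h z. Proof. by rewrite h_be mulN1r. Qed.

(** Elliptic functions are determined by their polar parts: three combinations
    of [P], [h] and its derivatives are constant because their expansions at the
    pole have no polar part; the coefficient of [z] in [h] is [- A / 2]. *)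
Theorem h_ode : exists A D, forall z, ~ L z ->
  [/\ P z = h z ^+ 2 + A, h1 z ^+ 2 = h z ^+ 4 + 3 * A * h z ^+ 2 + D &
      h2 z = 2 * h z ^+ 3 + 3 * A * h z].
Proof.
have [a [G [Ga hG]]] := h_laurent; pose A := - 2 * a.
(* [h] is written [(1 + z ^+ 2 * m z) / z] near 0, so that the cancellation of the
   polar parts below is a matter of computation with rational functions. *)
pose m z := a + z ^+ 2 * G z.
have G1a := analytic_derive Ga; have G2a := analytic_derive G1a.
have [G1 G1E] : exists G1, derive1 G = G1 by exists (derive1 G).
rewrite G1E in G1a G2a.
have [G2 G2E] : exists G2, derive1 G1 = G2 by exists (derive1 G1).
rewrite G2E in G2a.
have hm : \forall z \near 0^', h z = (1 + z ^+ 2 * m z) / z.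
  apply: filterS2 near_neq0 hG => z z0 ->; rewrite /m; field.
  by [].
have Gnear : \forall z \near 0^', analytic G z /\ analytic G1 z.
  apply: near_dnear; have h3 := analytic_open Ga; have h4 := analytic_open G1a.
  by apply: filterS2 h3 h4.
have hz1 : \forall z \near 0^', h1 z = - z ^- 2 + a + 3 * z ^+ 2 * G z + z ^+ 3 * G1 z.
  have n1 := dnear_near hG.
  near=> z; have z0 : z != 0 by near: z; exact: near_neq0.
  have [Gz _] : analytic G z /\ analytic G1 z by near: z.
  have nz : \forall w \near z, h w = w^-1 + a * w + w ^+ 3 * G w by near: z.
  have dG := analytic_is_derive Gz; rewrite G1E in dG.
  have di := deriveC_id z; have dii := deriveC_mul di di.
  have hd := deriveC_add (deriveC_add (deriveC_inv di z0) (deriveC_mul (deriveC_cst a z) di)) (deriveC_mul (deriveC_mul dii di) dG).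
  have nz' : \forall w \near z, h w = w^-1 + a * w + w * w * w * G w.
    by apply: filterS nz => w ->; ring.
  rewrite (derive1_near nz') (is_derive1E hd).
  by move: (G z) (G1 z) => u v; field.
have hz2 : \forall z \near 0^', h2 z = 2 * z ^- 3 + 6 * z * G z + 6 * z ^+ 2 * G1 z + z ^+ 3 * G2 z.
  have n1 := dnear_near hz1.
  near=> z; have z0 : z != 0 by near: z; exact: near_neq0.
  have [Gz G1z] : analytic G z /\ analytic G1 z by near: z.
  have nz : \forall w \near z, h1 w = - w ^- 2 + a + 3 * w ^+ 2 * G w + w ^+ 3 * G1 w by near: z.
  have dG := analytic_is_derive Gz; rewrite G1E in dG.
  have dG1 := analytic_is_derive G1z; rewrite G2E in dG1.
  have di := deriveC_id z; have dii := deriveC_mul di di.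
  have zz0 : z * z != 0 by rewrite mulf_neq0.
  have hd := deriveC_add (deriveC_add (deriveC_add (deriveC_opp (deriveC_inv dii zz0)) (deriveC_cst a z))
    (deriveC_mul (deriveC_mul (deriveC_cst 3 z) dii) dG)) (deriveC_mul (deriveC_mul dii di) dG1).
  have nz' : \forall w \near z, h1 w = - (w * w)^-1 + a + 3 * (w * w) * G w + w * w * w * G1 w.
    by apply: filterS nz => w ->; rewrite expr2; ring.
  rewrite (derive1_near nz') (is_derive1E hd).
  by move: (G z) (G1 z) (G2 z) => u v u2; field.
have Pc (c : C) := analytic_cst c (0 : C); have Pi := analytic_id (0 : C).
have ma : analytic m 0.
  by apply: analyticD => //; apply: analyticM => //; exact: analyticX.
have PA : forall z, ~ L z -> P z = h z ^+ 2 + A.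
  have [pg [pga pg0] hpg] := P_pole.
  pose Phi z := P z - h z ^+ 2.
  have hPhi : \forall z \near 0^', Phi z = pg z - 2 * m z - z ^+ 2 * m z ^+ 2.
    near=> z; have z0 : z != 0 by near: z; exact: near_neq0.
    have e1 : h z = (1 + z ^+ 2 * m z) / z by near: z.
    have e2 : P z = z ^- 2 + pg z by near: z.
    by rewrite /Phi e1 e2; field.
  have Phian z : ~ L z -> analytic Phi z.
    by move=> nLz; apply: analyticB; [exact: P_analytic|apply: analyticX; exact: h_analytic].
  have ran : analytic (fun z => pg z - 2 * m z - z ^+ 2 * m z ^+ 2) 0.
    by analytic_auto.
  have [| | | | |K hK] := @constant_off_L Phi 1.
  - by move=> z nLz; rewrite /Phi (P_al nLz) h_al.
  - by move=> z nLz; rewrite /Phi (P_be nLz) h_be sqrrN mul1r.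
  - by rewrite expr1n.
  - exact: Phian.
  - by exists (fun z => pg z - 2 * m z - z ^+ 2 * m z ^+ 2).
  have KA : K = A.
    have := analytic_uniq ran (Pc K); rewrite /= pg0 /m expr0n /= !mul0r subr0 => <-.
      by rewrite /A; ring.
    by apply: filterS2 (near_notin_span 0) hPhi => z /hK ->.
  by move=> z nLz; rewrite -KA -(hK _ nLz) /Phi; ring.
have [D hD] : exists D, forall z, ~ L z -> h1 z ^+ 2 - h z ^+ 4 - 3 * A * h z ^+ 2 = D.
  apply: (@constant_off_L _ 1).
  - by move=> z nLz; rewrite (h1_translate span_l h_al1)// h_al mul1r.
  - by move=> z nLz; rewrite (h1_translate span_r h_be1)// h_be !mulN1r; ring.
  - by rewrite expr1n.
  - move=> z nLz; have ha := h_analytic nLz; have ha1 := h1_analytic nLz.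
    apply: analyticB; first by apply: analyticB; exact: analyticX.
    by apply: analyticM; [exact: analytic_cst|exact: analyticX].
  exists (fun z => - 2 * (3 * G z + z * G1 z) + (a + 3 * z ^+ 2 * G z + z ^+ 3 * G1 z) ^+ 2
    - (4 * G z + 6 * m z ^+ 2 + 4 * z ^+ 2 * m z ^+ 3 + z ^+ 4 * m z ^+ 4)
    - 3 * A * (2 * m z + z ^+ 2 * m z ^+ 2)).
    by analytic_auto.
  near=> z; have z0 : z != 0 by near: z; exact: near_neq0.
  have e1 : h z = (1 + z ^+ 2 * m z) / z by near: z.
  have e2 : h1 z = - z ^- 2 + a + 3 * z ^+ 2 * G z + z ^+ 3 * G1 z by near: z.
  by rewrite e1 e2 /m /A; field.
have h2E : forall z, ~ L z -> h2 z - 2 * h z ^+ 3 - 3 * A * h z = 0.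
  apply: zero_off_L.
  - by move=> z nLz; rewrite (h2_translate span_l h_al1)// h_al mul1r.
  - by move=> z nLz; rewrite (h2_translate span_r h_be1)// h_be !mulN1r; ring.
  - move=> z nLz; have ha := h_analytic nLz; have ha2 := h2_analytic nLz.
    have qc (c : C) := analytic_cst c z.
    by analytic_auto.
  exists (fun z => 6 * z * G z + 6 * z ^+ 2 * G1 z + z ^+ 3 * G2 z
    - (6 * z * G z + 6 * z * m z ^+ 2 + 2 * z ^+ 3 * m z ^+ 3) - 3 * A * (z * m z)).
    by analytic_auto.
  near=> z; have z0 : z != 0 by near: z; exact: near_neq0.
  have e1 : h z = (1 + z ^+ 2 * m z) / z by near: z.
  have e2 : h2 z = 2 * z ^- 3 + 6 * z * G z + 6 * z ^+ 2 * G1 z + z ^+ 3 * G2 z by near: z.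
  by rewrite e1 e2 /m /A; field.
exists A, D => z nLz; split; first exact: PA.
  by rewrite -(hD _ nLz); ring.
by apply/eqP; rewrite -subr_eq0 opprD addrA h2E.
Unshelve. all: by end_near. Qed.

Lemma L2_L z : L2 z -> L z.
Proof. by move=> [m [n ->]]; exists m, (n * 2); rewrite rmorphM /= mulrA. Qed.

Lemma h_L2 c z : L2 c -> h (z + c) = h z.
Proof.
move=> [m [n ->]]; have hb2 w : h (w + 2 * be) = h w.
  by rewrite mulr_natl mulr2n addrA !h_be opprK.
by rewrite [m%:~R * _ + _]addrC addrA (periodic_int h_al) (periodic_int hb2).
Qed.

Lemma h1_L2 c z : L2 c -> ~ L z -> h1 (z + c) = h1 z.
Proof.
move=> Lc nLz; rewrite -[RHS]mul1r; apply: h1_translate => //; first exact: L2_L.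
by move=> w; rewrite h_L2// mul1r.
Qed.

(** Translation by a point of [L] acts on [h] through the parity of its
    coordinate along [be]. *)
Lemma L_parity c : L c -> L2 c \/ forall z, h (z + c) = - h z.
Proof.
move=> [m [n ->]]; have [k [nk|nk]] := int_parity n.
  by left; exists m, k; rewrite nk rmorphM /=; ring.
right=> z; have Lc : L2 (m%:~R * al + k%:~R * (2 * be)) by exists m, k.
have -> : z + (m%:~R * al + n%:~R * be) = z + be + (m%:~R * al + k%:~R * (2 * be)).
  by rewrite nk rmorphD rmorphM /=; ring.
by rewrite h_L2// h_be.
Qed.

Lemma h_translate c : L c -> exists s, s ^+ 2 = 1 /\ forall z, h (z + c) = s * h z.
Proof.
case/L_parity=> [Lc|hc]; [exists 1|exists (-1)]; split=> [|z].
- by rewrite expr1n.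
- by rewrite mul1r h_L2.
- by rewrite sqrrN expr1n.
- by rewrite hc mulN1r.
Qed.

Lemma zh_near0 : exists2 k, analytic k 0 /\ k 0 = 1 & \forall z \near 0^', z * h z = k z.
Proof.
have [g ga hg] := h_pole; exists (fun z => 1 + z * g z).
  by split; [analytic_auto|rewrite mul0r addr0].
apply: filterS2 near_neq0 hg => z z0 ->; field; exact: z0.
Qed.

Lemma near0_shift (Q : set C) c : (\forall z \near 0^', Q z) -> \forall z \near c^', Q (z - c).
Proof.
move=> /dnbhsC[e e0 he]; apply/dnbhsC; exists e => // z zc ze; apply: he.
  by rewrite subr_eq0.
by rewrite subr0.
Qed.

(** The poles of [h] are simple, which is what [identity_principle] asks. *)
Lemma simple_pole a c : removable (fun z => (z - c) * h (z + a)) c.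
Proof.
have aa : analytic (fun z => z - c) c by analytic_auto.
have [La|nLa] := pselect (L (c + a)); last first.
  apply: analytic_removable; apply: analyticM => //.
  have := @analytic_affine _ h 1 a c (oner_neq0 _); rewrite mul1r => /(_ (h_analytic nLa)).
  by apply: analytic_near; near=> z; rewrite mul1r.
have [s [_ hs]] := h_translate La.
have [k [ka _] hk] := zh_near0.
exists (fun z => s * k (1 * z + - c)).
  apply: analyticM; first exact: analytic_cst.
  by apply: analytic_affine; rewrite ?oner_neq0// mul1r subrr.
apply: filterS (near0_shift c hk) => z hz.
have -> : z + a = z - c + (c + a) by ring.
by rewrite hs mul1r -hz; ring.
Unshelve. all: by end_near. Qed.

Lemma h_blowup c (M : R) : L c -> \forall z \near c^', M < md (h z).
Proof.
move=> Lc; have [s [s2 hs]] := h_translate Lc.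
have [k [ka k0] hk] := zh_near0.
have s1 : md s = 1.
  have : md s ^+ 2 = 1 by rewrite -mdX s2 md1.
  by move=> /eqP; rewrite pexpr_eq1 ?md_ge0// => /eqP.
have /continuousC/(_ (1 / 2)) ck := analytic_cont ka.
have B0 : 0 < `|M| + 1 by have := normr_ge0 M; lra.
have H : \forall z \near 0^', M < md (h z).
  have kn : \forall z \near 0^', md (k z - k 0) < 1 / 2.
    by apply: near_dnear; apply: ck; lra.
  have sm : \forall z \near (0 : C)^', md z < 1 / (2 * (`|M| + 1)).
    apply/dnbhsC; exists (1 / (2 * (`|M| + 1))); first by rewrite divr_gt0// mulr_gt0.
    by move=> z _; rewrite subr0.
  near=> z.
  have z0 : z != 0 by near: z; exact: near_neq0.
  have zs : md z < 1 / (2 * (`|M| + 1)) by near: z.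
  have kz : md (k z - k 0) < 1 / 2 by near: z.
  have e : z * h z = k z by near: z.
  have h12 : 1 / 2 < md z * md (h z).
    by rewrite -mdM e; have := md_subr (k 0) (k z); rewrite mdBC k0 md1 in kz *; lra.
  rewrite ltr_pdivlMr ?mulr_gt0// in zs.
  rewrite ltNge; apply/negP => hM.
  have : md z * md (h z) <= md z * (`|M| + 1).
    by rewrite ler_wpM2l ?md_ge0//; have := ler_norm M; lra.
  lra.
apply: filterS (near0_shift c H) => z hz.
by rewrite -(subrK c z) hs mdM s1 mul1r.
Unshelve. all: by end_near. Qed.

(** If [h] omitted the value [c], then [1 / (h ^+ 2 - c ^+ 2)] would be constant
    by Liouville's theorem; its value would be 0, since it vanishes at the pole. *)
Lemma h_surjective c : exists2 z, ~ L z & h z = c.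
Proof.
apply: contrapT => nc.
have nz z : ~ L z -> h z ^+ 2 - c ^+ 2 != 0.
  move=> nLz; rewrite subr_sqr mulf_eq0 negb_or subr_eq0 addr_eq0.
  apply/andP; split; apply/eqP => hz; apply: nc; first by exists z.
  by exists (- z); [move/spanN; rewrite opprK|rewrite h_odd hz opprK].
pose Phi z := (h z ^+ 2 - c ^+ 2)^-1.
have Phia z : ~ L z -> analytic Phi z.
  move=> nLz; apply: analytic_inv; last exact: nz.
  by have := h_analytic nLz => ha; analytic_auto.
have [k [ka k0] hk] := zh_near0.
have da : analytic (fun z => (k z ^+ 2 - z ^+ 2 * c ^+ 2)^-1) 0.
  apply: (@analytic_inv _ (fun z => k z ^+ 2 - z ^+ 2 * c ^+ 2)); first by analytic_auto.
  by rewrite k0 expr1n expr0n mul0r subr0 oner_neq0.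
have ra : analytic (fun z => z ^+ 2 * (k z ^+ 2 - z ^+ 2 * c ^+ 2)^-1) 0.
  by apply: analyticM => //; apply: analyticX; exact: analytic_id.
have PhiE : \forall z \near 0^', Phi z = z ^+ 2 * (k z ^+ 2 - z ^+ 2 * c ^+ 2)^-1.
  apply: filterS3 near_neq0 hk (near_notin_span 0) => z z0 hz nLz.
  rewrite /Phi -hz; have := nz _ nLz; move: (h z) => H H0.
  have -> : (z * H) ^+ 2 - z ^+ 2 * c ^+ 2 = z ^+ 2 * (H ^+ 2 - c ^+ 2) by ring.
  by rewrite invfM mulrA divff ?mul1r// expf_neq0.
have [| | | | |K hK] := @constant_off_L Phi 1.
- by move=> z _; rewrite /Phi h_al.
- by move=> z _; rewrite /Phi h_be sqrrN mul1r.
- by rewrite expr1n.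
- exact: Phia.
- by exists (fun z => z ^+ 2 * (k z ^+ 2 - z ^+ 2 * c ^+ 2)^-1).
have K0 : K = 0.
  have := analytic_uniq ra (analytic_cst K 0); rewrite /= expr0n mul0r => -> //.
  by apply: filterS2 (near_notin_span 0) PhiE => z /hK ->.
have /dnbhsC[e e0 he] := near_notin_span 0.
have nLe : ~ L (e / 2)%:C%C.
  have e2 : md (e / 2)%:C%C = e / 2 by rewrite md_real gtr0_norm//; lra.
  apply: he; last by rewrite subr0 e2; lra.
  by rewrite -md_eq0 e2 gt_eqF//; lra.
have /eqP := hK _ nLe; rewrite K0 /Phi invr_eq0 => /eqP h0.
by have := nz _ nLe; rewrite h0 eqxx.
Qed.

Lemma h_shift_analytic a : ~ L a -> analytic (fun z => h (z + a)) 0.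
Proof.
move=> nLa; have := @analytic_affine _ h 1 a 0 (oner_neq0 _).
rewrite mulr0 add0r => /(_ (h_analytic nLa)); apply: analytic_near.
by near=> z; rewrite mul1r.
Unshelve. all: by end_near. Qed.

Lemma derive1_shift (f : C -> C) (a z : C) : analytic f (z + a) ->
  derive1 (fun w => f (w + a)) z = derive1 f (z + a).
Proof.
move=> fa; apply: is_derive1E.
have e2 : is_derive (1 * z + a) (1 : C) f (derive1 f (z + a)).
  by rewrite mul1r; exact: analytic_is_derive.
have := is_derive_affine e2; rewrite mul1r; apply: is_derive_near.
by near=> w; rewrite mul1r.
Unshelve. all: by end_near. Qed.

Lemma h_shift_derive2 a : ~ L a ->
  \forall z \near 0, derive1 (fun w => h (w + a)) z = h1 (z + a) /\
    derive1 (derive1 (fun w => h (w + a))) z = h2 (z + a).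
Proof.
move=> nLa.
have E : \forall z \near 0, ~ L (z + a).
  have /nbhsC[e e0 he] := notin_span_open nLa; apply: (nearC e0) => z hz; apply: he.
  by rewrite addrK -[z]subr0.
have E1 : \forall z \near 0, derive1 (fun w => h (w + a)) z = h1 (z + a).
  by apply: filterS E => z nLz; apply: derive1_shift; exact: h_analytic.
have E2 : \forall z \near 0, \forall w \near z, derive1 (fun w => h (w + a)) w = h1 (w + a).
  by move/nbhs_interior : E1.
near=> z; split; first by near: z.
have nz : \forall w \near z, derive1 (fun w => h (w + a)) w = h1 (w + a) by near: z.
apply: (eq_trans (derive1_near nz)).
by apply: derive1_shift; apply: h1_analytic; near: z.
Unshelve. all: by end_near. Qed.

(** Two translates of [h] with the same 1-jet at 0 solve the same second order
    equation, hence coincide near 0, hence everywhere; comparing poles, the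
    translations differ by a period. *)
Theorem h_injective a b : ~ L a -> ~ L b -> h a = h b -> h1 a = h1 b -> L2 (b - a).
Proof.
move=> nLa nLb hab h1ab.
have [A [D ode]] := h_ode.
pose G z := h (z + a) - h (z + b).
have aa := h_shift_analytic nLa; have ab := h_shift_analytic nLb.
have Ga : analytic G 0 by exact: analyticB.
have rem c : removable (fun z => (z - c) * G z) c.
  apply: removable_near (removableB (simple_pole a c) (simple_pole b c)).
  by near=> z; rewrite /G mulrBr.
have da := h_shift_derive2 nLa; have db := h_shift_derive2 nLb.
have an : \forall z \near 0, analytic (fun w => h (w + a)) z /\ analytic (fun w => h (w + b)) z.
  by apply: filterS2 (analytic_open aa) (analytic_open ab).
have nL : \forall z \near 0, ~ L (z + a) /\ ~ L (z + b).
  have /nbhsC[e e0 he] := notin_span_open nLa; have /nbhsC[d d0 hd] := notin_span_open nLb.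
  have m0 : 0 < Num.min e d by rewrite lt_min e0.
  apply: (nearC m0) => z; rewrite subr0 lt_min => /andP[ze zd].
  by split; [apply: he|apply: hd]; rewrite addrK.
have dG : \forall z \near 0, derive1 G z = derive1 (fun w => h (w + a)) z - derive1 (fun w => h (w + b)) z.
  apply: filterS an => z [az bz]; apply: is_derive1E.
  by apply: deriveC_sub; exact: analytic_is_derive.
have dG2 : \forall z \near 0, derive1 (derive1 G) z = h2 (z + a) - h2 (z + b).
  have dG' : \forall z \near 0, \forall w \near z,
     derive1 G w = derive1 (fun w => h (w + a)) w - derive1 (fun w => h (w + b)) w.
    by move/nbhs_interior : dG.
  apply: filterS2 (filterI dG' an) (filterI da db) => z [nz [az bz]] [[_ ea] [_ eb]].
  have h3 := analytic_is_derive (analytic_derive az).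
  have h4 := analytic_is_derive (analytic_derive bz).
  apply: (eq_trans (derive1_near nz)).
  apply: (eq_trans (is_derive1E (deriveC_sub h3 h4))).
  exact: (f_equal2 (fun x y => x - y) ea eb).
pose K z := 2 * (h (z + a) ^+ 2 + h (z + a) * h (z + b) + h (z + b) ^+ 2) + 3 * A.
have Ka : analytic K 0 by rewrite /K; analytic_auto.
have Gz : \forall z \near 0, G z = 0.
  apply: (linear_ode2_uniq Ga Ka).
  - by rewrite /G !add0r hab subrr.
  - rewrite (nbhs_singleton dG) (nbhs_singleton da).1 (nbhs_singleton db).1.
    by rewrite !add0r h1ab subrr.
  apply: filterS2 dG2 nL => z -> [nza nzb].
  have [_ _ ->] := ode _ nza; have [_ _ ->] := ode _ nzb.
  by rewrite /K /G; ring.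
have Gma := identity_principle rem (near_dnear Gz) (- a).
have eqh : \forall u \near 0^', h u = h (u + (b - a)).
  move/dnbhsC: Gma => [e e0 he]; apply/dnbhsC; exists e => // u u0; rewrite subr0 => ue.
  have ua : u - a != - a by rewrite -subr_eq0 opprK subrK.
  have ue' : md (u - a - - a) < e by rewrite opprK subrK.
  have /eqP := he _ ua ue'; rewrite /G subrK subr_eq0 => /eqP ->.
  by rewrite -addrA [- a + b]addrC.
have [k [ka k0] hk] := zh_near0.
have [Lba|nLba] := pselect (L (b - a)).
  have [//|hN] := L_parity Lba; exfalso.
  have kz : \forall u \near 0^', k u = 0.
    apply: filterS2 hk eqh => u <-; rewrite hN => /eqP.
    by rewrite -addr_eq0 -mulr2n mulrn_eq0 /= => /eqP ->; rewrite mulr0.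
  have /eqP := analytic_uniq ka (analytic_cst 0 0) kz.
  by rewrite k0 oner_eq0.
exfalso; have sa := h_shift_analytic nLba.
have ra : analytic (fun u => u * h (u + (b - a))) 0.
  by apply: analyticM => //; exact: analytic_id.
have kz : \forall u \near 0^', k u = u * h (u + (b - a)).
  by apply: filterS2 hk eqh => u <- <-.
by have /eqP := analytic_uniq ka ra kz; rewrite k0 mul0r oner_eq0.
Unshelve. all: by end_near. Qed.

(** Otherwise [h] would coincide with a constant solution of its equation. *)
Theorem h_regular a : ~ L a -> h1 a = 0 -> h2 a != 0.
Proof.
move=> nLa h1a; apply/eqP => h2a.
have [A [D ode]] := h_ode.
pose G z := h (z + a) - h a.
have aa := h_shift_analytic nLa.
have Ga : analytic G 0 by apply: analyticB => //; exact: analytic_cst.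
have rem c : removable (fun z => (z - c) * G z) c.
  have rc : removable (fun z => (z - c) * h a) c.
    by apply: analytic_removable; analytic_auto.
  apply: removable_near (removableB (simple_pole a c) rc).
  by near=> z; rewrite /G mulrBr.
have da := h_shift_derive2 nLa.
have an := analytic_open aa.
have nL : \forall z \near 0, ~ L (z + a).
  have /nbhsC[e e0 he] := notin_span_open nLa.
  by apply: (nearC e0) => z; rewrite subr0 => ze; apply: he; rewrite addrK.
have dG : \forall z \near 0, derive1 G z = derive1 (fun w => h (w + a)) z.
  apply: filterS an => z az; apply: is_derive1E.
  by apply: deriveC_eq (deriveC_sub (analytic_is_derive az) (deriveC_cst (h a) z)) _; rewrite subr0.
have dG2 : \forall z \near 0, derive1 (derive1 G) z = h2 (z + a).
  have dG' : \forall z \near 0, \forall w \near z, derive1 G w = derive1 (fun w => h (w + a)) w.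
    by move/nbhs_interior : dG.
  apply: filterS2 dG' da => z nz [_ e2].
  exact: (eq_trans (derive1_near nz)).
pose K z := 2 * (h (z + a) ^+ 2 + h (z + a) * h a + h a ^+ 2) + 3 * A.
have Ka : analytic K 0 by rewrite /K; analytic_auto.
have [_ _ odea] := ode _ nLa; rewrite h2a in odea.
have Gz : \forall z \near 0, G z = 0.
  apply: (linear_ode2_uniq Ga Ka).
  - by rewrite /G !add0r subrr.
  - by rewrite (nbhs_singleton dG) (nbhs_singleton da).1 add0r.
  apply: filterS2 dG2 nL => z -> nza; have [_ _ ->] := ode _ nza.
  by rewrite -[LHS]subr0 odea /K /G; ring.
have Gma := identity_principle rem (near_dnear Gz) (- a).
have [k [ka k0] hk] := zh_near0.
have ra : analytic (fun u => u * h a) 0 by analytic_auto.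
move/dnbhsC: Gma => [e e0 he].
have eqh : \forall u \near 0^', h u = h a.
  apply/dnbhsC; exists e => // u u0; rewrite subr0 => ue.
  apply/eqP; rewrite -subr_eq0; apply/eqP.
  have := he (u - a); rewrite /G subrK; apply; last by rewrite opprK subrK.
  by rewrite -subr_eq0 opprK subrK.
have kz : \forall u \near 0^', k u = u * h a.
  by apply: filterS2 hk eqh => u <- <-.
by have /eqP := analytic_uniq ka ra kz; rewrite k0 mul0r oner_eq0.
Unshelve. all: by end_near. Qed.

End NsFunction.

(** * The function attached to a half-period *)

Lemma horner_inj (K : numDomainType) (p q : {poly K}) : (forall x, p.[x] = q.[x]) -> p = q.
Proof.
move=> h; apply/eqP; rewrite -subr_eq0; apply: contraT => pq0.
have := max_poly_roots pq0 (_ : all (root (p - q)) [seq n%:R | n <- iota 0 (size (p - q))]) _.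
rewrite size_map size_iota ltnn; apply.
  by apply/allP => x _; rewrite rootE hornerD hornerN h subrr.
rewrite map_inj_uniq ?iota_uniq// => m n /eqP; rewrite eqr_nat => /eqP //.
Qed.

Section HalfLattice.
Local Open Scope quotient_scope.
Local Open Scope ring_scope.
Variables (R : realType) (tau : CC R).
Hypothesis tau_gt0 : 0 < complex.Im tau.
Local Notation C := (CC R).
Local Notation md := (@md R).
Local Notation zeta := (zeta tau).
Local Notation wp := (wp tau).
Local Notation Lam := (lattice tau).
Local Notation omega := (omega tau).
Local Notation eta := (eta tau).

Lemma two_neq0 : (2 : C) != 0. Proof. by rewrite pnatr_eq0. Qed.

Lemma omega1 : omega 1 = 1. Proof. by []. Qed.
Lemma omega2 : omega 2 = tau. Proof. by []. Qed.
Lemma omega3 : omega 3 = 1 + tau. Proof. by []. Qed.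

Lemma omega_lattice_point k : exists q, omega k = lattice_point tau q.
Proof.
case: k => [|[|[|[|k]]]]; rewrite /Defs.omega /=.
- by exists (0, 0); rewrite /lattice_point /= mul0r addr0.
- by exists (1, 0); rewrite /lattice_point /= mul0r addr0.
- by exists (0, 1); rewrite /lattice_point /= mul1r add0r.
- by exists (1, 1); rewrite /lattice_point /= mul1r.
- by exists (0, 0); rewrite /lattice_point /= nth_nil mul0r addr0.
Qed.

Lemma half_notin_lattice : (1 / 2 : C) \notin Lam.
Proof.
apply/negP => /(latticeE _ _)[m [n h]].
have [|h1 _] := @real_coords_inj _ tau tau_gt0 (1 / 2) 0 m%:~R n%:~R.
  rewrite rmorph0 mul0r addr0 !rmorph_int -h rmorphM rmorph1 fmorphV rmorph_nat //.
have : (2 * m)%:~R = (1 : R) by rewrite rmorphM /= -h1; field.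
by rewrite -[1]/(1%:~R) => /eqP; rewrite eqr_int; lia.
Qed.

Lemma zeta_shift k z : zeta (z + omega k) = zeta z + eta k.
Proof.
have [q qE] := omega_lattice_point k; have [c hc] := zeta_quasi_periodic tau_gt0 q.
have -> : eta k = c.
  rewrite /Defs.eta; case: xgetP => [c' _ /(_ _ half_notin_lattice)|/(_ c)].
    by rewrite qE hc => ->.
  by case=> y _; rewrite qE hc.
by rewrite -(hc z) qE subrKC.
Qed.

Lemma eta0 : eta 0 = 0.
Proof.
have := zeta_shift 0 0; rewrite /Defs.omega /= addr0 => /eqP.
by rewrite -subr_eq0 opprD addrA subrr add0r oppr_eq0 => /eqP.
Qed.

Lemma eta3 : eta 3 = eta 1 + eta 2.
Proof.
have := zeta_shift 3 0; have := zeta_shift 2 (0 + omega 1); have := zeta_shift 1 0.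
rewrite /Defs.omega /= addrA => -> -> h; apply: (addrI (zeta 0)).
by rewrite -h addrA.
Qed.

Definition Z (k : nat) (z : C) := zeta (z - omega k / 2).

(** A half-period permutes the four points [omega k / 2] modulo the lattice; the
    quasi-periods account for the lattice points involved. *)
Lemma Z_one z : [/\ Z 0 (z + 1 / 2) = Z 1 z + eta 1, Z 1 (z + 1 / 2) = Z 0 z,
  Z 2 (z + 1 / 2) = Z 3 z + eta 1 & Z 3 (z + 1 / 2) = Z 2 z].
Proof.
rewrite /Z; split; rewrite -?zeta_shift; congr zeta; rewrite /Defs.omega /=; by field.
Qed.

Lemma Z_tau z : [/\ Z 0 (z + tau / 2) = Z 2 z + eta 2, Z 2 (z + tau / 2) = Z 0 z,
  Z 1 (z + tau / 2) = Z 3 z + eta 2 & Z 3 (z + tau / 2) = Z 1 z].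
Proof.
rewrite /Z; split; rewrite -?zeta_shift; congr zeta; rewrite /Defs.omega /=; by field.
Qed.

Lemma Z_neg z : [/\ Z 0 (- z) = - Z 0 z, Z 1 (- z) = - (Z 1 z + eta 1),
  Z 2 (- z) = - (Z 2 z + eta 2) & Z 3 (- z) = - (Z 3 z + eta 3)].
Proof.
rewrite /Z; split; rewrite -?zeta_shift -zeta_odd//; congr zeta; rewrite /Defs.omega /=; by field.
Qed.

Variable l : nat.
Hypothesis hl : (1 <= l <= 3)%N.

Lemma l_cases (Q : nat -> Prop) : Q 1%N -> Q 2%N -> Q 3%N -> Q l.
Proof. by case: l hl => [|[|[|[|]]]]. Qed.

Definition ns_period := omega l / 2.

(** A half-period independent of [omega l / 2]; when [l = 3] both [1 / 2] and
    [tau / 2] qualify. *)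
Definition ns_half_period : C := if l == 1%N then tau / 2 else 1 / 2.
Local Notation al := ns_period.
Local Notation be := ns_half_period.

(** [F_sol tau l T] is [2 * T] minus this function ([F_solE]); the additive constant
    makes it odd. *)
Definition twisted_zeta (z : C) := \sum_(k < 4) eps R l k * zeta (z - omega k / 2) - eta (3 - l).

(** The Weierstrass function of the half-lattice. *)
Definition half_wp (z : C) := 4 * wp (2 * z).
Local Notation L := (span_int al be).
Local Notation L2 := (span_int al (2 * be)).

Lemma twisted_zetaE z : twisted_zeta z = eps R l 0 * Z 0 z + eps R l 1 * Z 1 z + eps R l 2 * Z 2 z
  + eps R l 3 * Z 3 z - eta (3 - l).
Proof. by rewrite /twisted_zeta !big_ord_recl big_ord0 /= /bump /= addr0 !addrA. Qed.

Lemma twisted_zeta_odd z : twisted_zeta (- z) = - twisted_zeta z.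
Proof.
rewrite !twisted_zetaE; have [-> -> -> ->] := Z_neg z.
rewrite /eps; elim/l_cases: l => /=; rewrite ?eta0 ?eta3;
  by move: (Z 0 z) (Z 1 z) (Z 2 z) (Z 3 z) (eta 1) (eta 2) => *; ring.
Qed.

Lemma twisted_zeta_al z : twisted_zeta (z + al) = twisted_zeta z.
Proof.
rewrite !twisted_zetaE /al /eps; elim/l_cases: l => /=.
- rewrite omega1; have [-> -> -> ->] := Z_one z;
    move: (Z 0 z) (Z 1 z) (Z 2 z) (Z 3 z) (eta 1) (eta 2) (eta 3) => *; ring.
- rewrite omega2; have [-> -> -> ->] := Z_tau z;
    move: (Z 0 z) (Z 1 z) (Z 2 z) (Z 3 z) (eta 1) (eta 2) (eta 3) => *; ring.
have -> : z + omega 3 / 2 = z + 1 / 2 + tau / 2 by rewrite omega3; field.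
have [-> -> -> ->] := Z_tau (z + 1 / 2); have [-> -> -> ->] := Z_one z;
    move: (Z 0 z) (Z 1 z) (Z 2 z) (Z 3 z) (eta 1) (eta 2) (eta 3) => *; ring.
Qed.

Lemma twisted_zeta_be z : twisted_zeta (z + be) = - twisted_zeta z.
Proof.
rewrite !twisted_zetaE /be /eps; elim/l_cases: l => /=.
- have [-> -> -> ->] := Z_tau z;
    move: (Z 0 z) (Z 1 z) (Z 2 z) (Z 3 z) (eta 1) (eta 2) (eta 3) => *; ring.
- have [-> -> -> ->] := Z_one z;
    move: (Z 0 z) (Z 1 z) (Z 2 z) (Z 3 z) (eta 1) (eta 2) (eta 3) => *; ring.
have [-> -> -> ->] := Z_one z; rewrite eta0;
    move: (Z 0 z) (Z 1 z) (Z 2 z) (Z 3 z) (eta 1) (eta 2) (eta 3) => *; ring.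
Qed.

Lemma L_double z : L z <-> 2 * z \in Lam.
Proof.
split=> [[m [n ->]]|/(latticeE _ _)[m [n zE]]].
  apply/latticeE; rewrite /al /be; elim/l_cases: l => /=; rewrite /Defs.omega /=.
  - by exists m, n; field.
  - by exists n, m; field.
  by exists (m + n), m; rewrite rmorphD /=; field.
have {zE} -> : z = (m%:~R + n%:~R * tau) / 2 by rewrite -zE; field.
rewrite /al /be; elim/l_cases: l => /=; rewrite /Defs.omega /=.
- by exists m, n; field.
- by exists n, m; field.
by exists n, (m - n); rewrite rmorphB /=; field.
Qed.

(** Since [L2] is generated by the lattice and by [omega l / 2], it is the group by
    which the representatives of a pair [{a, a - omega l / 2}] differ. *)
Lemma L2_lattice z : L2 z <-> (z \in Lam) \/ (z - al \in Lam).
Proof.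
have al2 : 2 * al \in Lam.
  by have [q e] := omega_lattice_point l; apply/latticeE; exists q.1, q.2;
     rewrite /al mulrC divfK ?two_neq0.
have int_mul (m : int) w : w \in Lam -> m%:~R * w \in Lam.
  move=> /(latticeE _ _)[a [b ->]]; apply/latticeE; exists (m * a), (m * b).
  by rewrite !rmorphM /=; ring.
have be2 : 2 * be \in Lam.
  apply/latticeE; rewrite /be; case: (l == 1%N); [exists 0, 1|exists 1, 0]; by field.
split=> [[m [n ->]]|].
  have [k [->|->]] := int_parity m; [left|right].
    have -> : (2 * k)%:~R * al + n%:~R * (2 * be) = k%:~R * (2 * al) + n%:~R * (2 * be).
      by rewrite rmorphM /=; ring.
    by rewrite rpredD ?int_mul.
  have -> : (2 * k + 1)%:~R * al + n%:~R * (2 * be) - al = k%:~R * (2 * al) + n%:~R * (2 * be).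
    by rewrite rmorphD rmorphM /=; ring.
  by rewrite rpredD ?int_mul.
have sub w : w \in Lam -> exists m n : int, w = (2 * m)%:~R * al + n%:~R * (2 * be).
  move=> /(latticeE _ _)[m [n ->]]; rewrite /al /be; elim/l_cases: l => /=; rewrite /Defs.omega /=.
  - by exists m, n; rewrite rmorphM /=; field.
  - by exists n, m; rewrite rmorphM /=; field.
  by exists n, (m - n); rewrite rmorphM rmorphB /=; field.
case=> /sub[m [n zE]]; first by exists (2 * m), n.
exists (2 * m + 1), n; rewrite rmorphD /= mulrDl mul1r addrAC -zE; ring.
Qed.

Lemma al_be_coords : real_basis al be.
Proof.
move=> z; have [x [y ->]] := real_coords tau_gt0 z.
have E (a : R) : (2 * a)%:C%C = 2 * a%:C%C :> C by rewrite rmorphM rmorph_nat.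
rewrite /al /be; elim/l_cases: l => /=; rewrite /Defs.omega /=.
- by exists (2 * x), (2 * y); rewrite !E; field.
- by exists (2 * y), (2 * x); rewrite !E; field.
by exists (2 * y), (2 * (x - y)); rewrite !E rmorphB /=; field.
Qed.

Lemma al_be_coords_le (x y : R) :
  `|x| + `|y| <= 4 * skew tau * md (al * x%:C%C + be * y%:C%C).
Proof.
have k0 := skew_gt0 tau_gt0.
have half (a b : R) : md (1 / 2 * a%:C%C + tau / 2 * b%:C%C) = md (a%:C%C + b%:C%C * tau) / 2.
  have -> : 1 / 2 * a%:C%C + tau / 2 * b%:C%C = (a%:C%C + b%:C%C * tau) / 2 by field.
  by rewrite mdM mdV md_nat.
have main (a b : R) : `|a| + `|b| <= 2 * skew tau * md (1 / 2 * a%:C%C + tau / 2 * b%:C%C).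
  rewrite half; have := real_coords_le tau_gt0 a b.
  by have -> : 2 * skew tau * (md (a%:C%C + b%:C%C * tau) / 2) =
    skew tau * md (a%:C%C + b%:C%C * tau) by field.
have weak (a b : R) : 2 * skew tau * md (1 / 2 * a%:C%C + tau / 2 * b%:C%C) <=
    4 * skew tau * md (1 / 2 * a%:C%C + tau / 2 * b%:C%C).
  by rewrite ler_wpM2r ?md_ge0//; lra.
rewrite /al /be; elim/l_cases: l => /=; rewrite /Defs.omega /=.
- exact: le_trans (main _ _) (weak _ _).
- by rewrite addrC [X in md X]addrC; exact: le_trans (main _ _) (weak _ _).
have -> : (1 + tau) / 2 * x%:C%C + 1 / 2 * y%:C%C =
  1 / 2 * (x + y)%:C%C + tau / 2 * x%:C%C by rewrite rmorphD /=; field.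
have := main (x + y) x; have := ler_normB (x + y) x; rewrite addrAC subrr add0r.
have := normr_ge0 (x + y); have := normr_ge0 x; lra.
Qed.

Lemma half_shift_notin k z : (k < 4)%N -> ~ L z -> z - omega k / 2 \notin Lam.
Proof.
move=> k4 nLz; apply/negP => h; apply: nLz; apply/L_double.
have [q e] := omega_lattice_point k.
have -> : 2 * z = (z - omega k / 2) + (z - omega k / 2) + omega k by field.
apply: rpredD; first by apply: rpredD.
by apply/latticeE; exists q.1, q.2; exact: e.
Qed.

Lemma analytic_translate (f : C -> C) (a z : C) : analytic f (z - a) ->
  analytic (fun w => f (w - a)) z.
Proof.
move=> fa; have := @analytic_affine _ f 1 (- a) z (oner_neq0 _).
rewrite mul1r => /(_ fa); apply: analytic_near; near=> w; by rewrite mul1r.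
Unshelve. all: by end_near. Qed.

Lemma is_derive_translate (f : C -> C) (a z v : C) : is_derive (z - a) (1 : C) f v ->
  is_derive z (1 : C) (fun w => f (w - a)) v.
Proof.
move=> fa; have e2 : is_derive (1 * z + - a) (1 : C) f v by rewrite mul1r.
have := is_derive_affine e2; rewrite mul1r; apply: is_derive_near; near=> w.
by rewrite mul1r.
Unshelve. all: by end_near. Qed.

Lemma twisted_zeta_analytic z : ~ L z -> analytic twisted_zeta z.
Proof.
move=> nLz; apply: analyticB; last exact: analytic_cst.
apply: analytic_sum => k _; apply: analyticM; first exact: analytic_cst.
apply: analytic_translate.
by have [] := wp_zeta tau_gt0 (half_shift_notin (ltn_ord k) nLz).
Qed.

Lemma half_omega_notin k : (0 < k < 4)%N -> (0 : C) - omega k / 2 \notin Lam.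
Proof.
move=> hk; rewrite sub0r rpredN; apply/negP => /(latticeE _ _)[m [n e]].
have {e} : omega k = (2 * m)%:~R + (2 * n)%:~R * tau.
  by rewrite !rmorphM /= -[LHS](divfK two_neq0) e; ring.
have nn (a b : int) : a%:~R + b%:~R * tau = (2 * m)%:~R + (2 * n)%:~R * tau -> a = 2 * m /\ b = 2 * n.
  rewrite !(intC R) => /(real_coords_inj tau_gt0)[/eqP + /eqP].
  by rewrite !eqr_int => /eqP -> /eqP ->.
case: k hk => [|[|[|[|k]]]]// _; rewrite /Defs.omega /=.
- by have := nn 1 0; rewrite mul0r addr0 => h /h[]; lia.
- by have := nn 0 1; rewrite add0r mul1r => h /h[]; lia.
by have := nn 1 1; rewrite mul1r => h /h[]; lia.
Qed.

Lemma Z_analytic0 k : (0 < k < 4)%N -> analytic (Z k) 0.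
Proof.
move=> hk; apply: analytic_translate.
by have [] := wp_zeta tau_gt0 (half_omega_notin hk).
Qed.

Lemma twisted_zeta_pole : exists2 g, analytic g 0 & \forall z \near 0^', twisted_zeta z = z^-1 + g z.
Proof.
have [g [ga _ hg]] := zeta_laurent tau_gt0.
exists (fun z => z * g z + eps R l 1 * Z 1 z + eps R l 2 * Z 2 z + eps R l 3 * Z 3 z - eta (3 - l)).
  have z1 := @Z_analytic0 1 isT; have z2 := @Z_analytic0 2 isT; have z3 := @Z_analytic0 3 isT.
  by analytic_auto.
apply: filterS (near_dnear hg) => z hz; rewrite twisted_zetaE /eps /= mul1r.
have -> : Z 0 z = z^-1 + z * g z by rewrite -hz /Z /Defs.omega /= mul0r subr0.
by rewrite !addrA.
Qed.

Lemma wp_periodic k z : z \notin Lam -> wp (z + omega k) = wp z.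
Proof.
move=> zL; have [q e] := omega_lattice_point k.
have qL : omega k \in Lam by apply/latticeE; exists q.1, q.2.
have zL' : z + omega k \notin Lam by rewrite rpredDr.
have [_ d1] := wp_zeta tau_gt0 zL; have [_ d2] := wp_zeta tau_gt0 zL'.
have d3 : is_derive z (1 : C) (fun w => zeta (w - - omega k)) (- wp (z + omega k)).
  by apply: is_derive_translate; rewrite opprK.
have d4 : is_derive z (1 : C) (fun w => zeta w + eta k) (- wp z).
  by apply: deriveC_eq (deriveC_add d1 (deriveC_cst (eta k) z)) _; rewrite addr0.
have d5 : is_derive z (1 : C) (fun w => zeta w + eta k) (- wp (z + omega k)).
  by apply: is_derive_near d3; near=> w; rewrite opprK zeta_shift.
by apply: oppr_inj; rewrite -(is_derive1E d4) -(is_derive1E d5).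
Unshelve. all: by end_near. Qed.

Lemma half_wp_analytic z : ~ L z -> analytic half_wp z.
Proof.
move=> nLz; apply: analyticM; first exact: analytic_cst.
have zL : 2 * z \notin Lam by apply/negP => /L_double.
have [za _] := wp_zeta tau_gt0 zL.
have wa : analytic wp (2 * z).
  apply: analytic_near (analyticN (analytic_derive za)).
  apply: filterS (_ : \forall w \near 2 * z, w \notin Lam) => [w wL|].
    by have [_ /is_derive1E ->] := wp_zeta tau_gt0 wL; rewrite opprK.
  have [e e0 he] : exists2 e : R, 0 < e & forall w, md (w - z) < e -> ~ L w.
    exact: (nbhsC _ _).1 (notin_span_open al_be_coords_le nLz).
  apply: (nearC e0) => w hw; have := he (w / 2); rewrite L_double.
  have -> : 2 * (w / 2) = w by field.
  move=> h; apply/negP; apply: h.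
  have -> : w / 2 - z = (w - 2 * z) / 2 by field.
  by rewrite mdM mdV md_nat; have := md_ge0 (w - 2 * z); lra.
have := @analytic_affine _ wp 2 0 z two_neq0; rewrite addr0 => /(_ wa).
by apply: analytic_near; near=> w; rewrite addr0.
Unshelve. all: by end_near. Qed.

Lemma half_wp_al z : ~ L z -> half_wp (z + al) = half_wp z.
Proof.
move=> nLz; rewrite /half_wp; have -> : 2 * (z + al) = 2 * z + omega l by rewrite /al; field.
by rewrite wp_periodic//; apply/negP => /L_double.
Qed.

Lemma half_wp_be z : ~ L z -> half_wp (z + be) = half_wp z.
Proof.
move=> nLz; have zL : 2 * z \notin Lam by apply/negP => /L_double.
rewrite /half_wp /be; case: (l == 1%N).
  have -> : 2 * (z + tau / 2) = 2 * z + omega 2 by rewrite omega2; field.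
  by rewrite wp_periodic.
have -> : 2 * (z + 1 / 2) = 2 * z + omega 1 by rewrite omega1; field.
by rewrite wp_periodic.
Qed.

Lemma near0_scale (Q : set C) (a : C) : a != 0 ->
  (\forall z \near 0^', Q z) -> \forall z \near (0 : C)^', Q (a * z).
Proof.
move=> a0 /dnbhsC[e e0 he]; have ma : 0 < md a by rewrite md_gt0.
apply/dnbhsC; exists (e / md a) => [|z z0]; first by rewrite divr_gt0.
rewrite subr0 => ze; apply: he; first by rewrite mulf_neq0.
by rewrite subr0 mdM mulrC -ltr_pdivlMr.
Qed.

Lemma wp_laurent : exists2 k : C -> C, analytic k 0 /\ k 0 = 0 &
  \forall z \near 0^', wp z = z ^- 2 + k z.
Proof.
have [g [ga g0 hg]] := zeta_laurent tau_gt0.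
have [g1 g1E] : exists g1, derive1 g = g1 by exists (derive1 g).
have g1a := analytic_derive ga; rewrite g1E in g1a.
exists (fun z => - (g z + z * g1 z)); first by split; [analytic_auto|rewrite g0 mul0r addr0 oppr0].
have H := near_notin_span (lattice_coords_le tau_gt0) 0.
have n1 := dnear_near (near_dnear hg); have an := near_dnear (analytic_open ga).
apply: filterS2 (filterI (near_neq0 R) H) (filterI n1 an) => z [z0 nLz] [nz az].
have zL : z \notin Lam.
  by apply/negP => /(latticeE _ _)[m [n e]]; apply: nLz; exists m, n; rewrite mulr1.
have [_ d1] := wp_zeta tau_gt0 zL.
have dg := analytic_is_derive az; rewrite g1E in dg.
have di := deriveC_id z; have d2 := deriveC_add (deriveC_inv di z0) (deriveC_mul di dg).
have := is_derive1E d1; rewrite (derive1_near nz) (is_derive1E d2) => e.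
by apply: oppr_inj; rewrite -e; move: (g z) (g1 z) => u v; field.
Qed.

Lemma half_wp_pole : exists2 g, analytic g 0 /\ g 0 = 0 &
  \forall z \near 0^', half_wp z = z ^- 2 + g z.
Proof.
have [k [ka k0] hk] := wp_laurent.
exists (fun z => 4 * k (2 * z + 0)).
  split; last by rewrite mulr0 addr0 k0 mulr0.
  apply: analyticM; first exact: analytic_cst.
  by apply: analytic_affine; rewrite ?two_neq0// mulr0 addr0.
apply: filterS2 (near_neq0 R) (near0_scale two_neq0 hk) => z z0 hz.
by rewrite /half_wp hz addr0; move: (k _) => K; field.
Qed.

Lemma twisted_zeta_ns : ns_function al be (4 * skew tau) twisted_zeta half_wp.
Proof.
split; [exact: al_be_coords|exact: al_be_coords_le|exact: twisted_zeta_analytic|exact: twisted_zeta_odd|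
  exact: twisted_zeta_al|exact: twisted_zeta_be|exact: twisted_zeta_pole|exact: half_wp_analytic|exact: half_wp_al|exact: half_wp_be|
  exact: half_wp_pole].
Qed.

(** The difference of the two sides has the periods [1 / 2] and [tau / 2] and no pole;
    oddness determines its constant value. *)
Lemma zeta_duplication z : ~ L z ->
  Z 0 z + Z 1 z + Z 2 z + Z 3 z = 2 * zeta (2 * z) - eta 3.
Proof.
pose Phi z := Z 0 z + Z 1 z + Z 2 z + Z 3 z - 2 * zeta (2 * z).
have dbl k y : zeta (2 * y + omega k) = zeta (2 * y) + eta k by exact: zeta_shift.
have s1 y : Phi (y + 1 / 2) = Phi y.
  rewrite /Phi; have [-> -> -> ->] := Z_one y.
  have -> : 2 * (y + 1 / 2) = 2 * y + omega 1 by rewrite omega1; field.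
  by rewrite dbl; move: (Z 0 y) (Z 1 y) (Z 2 y) (Z 3 y) (zeta _) (eta 1) => *; ring.
have s2 y : Phi (y + tau / 2) = Phi y.
  rewrite /Phi; have [-> -> -> ->] := Z_tau y.
  have -> : 2 * (y + tau / 2) = 2 * y + omega 2 by rewrite omega2; field.
  by rewrite dbl; move: (Z 0 y) (Z 1 y) (Z 2 y) (Z 3 y) (zeta _) (eta 2) => *; ring.
have sal y : Phi (y + al) = Phi y.
  rewrite /al; elim/l_cases: l => /=; rewrite ?omega1 ?omega2 ?omega3//.
  have -> : y + (1 + tau) / 2 = y + 1 / 2 + tau / 2 by field.
  by rewrite s2 s1.
have sbe y : Phi (y + be) = 1 * Phi y by rewrite mul1r /be; case: (l == 1%N).
have an y : ~ L y -> analytic Phi y.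
  move=> nLy.
  have za k : (k < 4)%N -> analytic (Z k) y.
    move=> k4; apply: analytic_translate.
    by have [] := wp_zeta tau_gt0 (half_shift_notin k4 nLy).
  have z0 := za 0 isT; have z1 := za 1 isT; have z2 := za 2 isT; have z3 := za 3 isT.
  have yL : 2 * y \notin Lam by apply/negP => /L_double.
  have [zz _] := wp_zeta tau_gt0 yL.
  have zd : analytic (fun w => zeta (2 * w)) y.
    have := @analytic_affine _ zeta 2 0 y two_neq0; rewrite addr0 => /(_ zz).
    by apply: analytic_near; near=> w; rewrite addr0.
  exact: analyticB (analyticD (analyticD (analyticD z0 z1) z2) z3)
    (analyticM (analytic_cst 2 y) zd).
have rem : removable Phi 0.
  have [g [ga _ hg]] := zeta_laurent tau_gt0.
  have z1 := @Z_analytic0 1 isT; have z2 := @Z_analytic0 2 isT; have z3 := @Z_analytic0 3 isT.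
  have g2 : analytic (fun w => g (2 * w + 0)) 0.
    by apply: analytic_affine; rewrite ?two_neq0// mulr0 addr0.
  exists (fun w => w * g w + Z 1 w + Z 2 w + Z 3 w - 4 * w * g (2 * w + 0)).
    by analytic_auto.
  have hd := near_dnear hg; have hd2 := near0_scale two_neq0 hd.
  apply: filterS3 (near_neq0 R) hd hd2 => w w0 e1 e2.
  have -> : Phi w = zeta w + Z 1 w + Z 2 w + Z 3 w - 2 * zeta (2 * w).
    by rewrite /Phi {1}/Z /Defs.omega /= mul0r subr0.
  rewrite e1 e2 addr0; move: (Z 1 w) (Z 2 w) (Z 3 w) (g w) (g (2 * w)) => *; field.
  by [].
have [K hK] := constant_off_L twisted_zeta_ns (fun y _ => sal y) (fun y _ => sbe y) (expr1n _ _) an rem.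
have KE y : ~ L y -> K = - eta 3.
  move=> nLy; have nLy' : ~ L (- y) by move/spanN; rewrite opprK.
  have e3 : Phi (- y) = - Phi y - 2 * eta 3.
    rewrite /Phi; have [-> -> -> ->] := Z_neg y; rewrite mulrN (zeta_odd tau_gt0) !eta3.
    by move: (Z 0 y) (Z 1 y) (Z 2 y) (Z 3 y) (zeta _) (eta 1) (eta 2) => *; ring.
  rewrite (hK _ nLy) (hK _ nLy') in e3; apply: (mulfI two_neq0).
  have -> : 2 * K = K + K by ring.
  by rewrite {1}e3; ring.
by move=> nLz; have := hK _ nLz; rewrite (KE _ nLz) /Phi => <-; ring.
Unshelve. all: by end_near. Qed.

Lemma twisted_zeta_half z : ~ L z ->
  zeta z + zeta (z - omega l / 2) - zeta (2 * z) + eta l / 2 = twisted_zeta z / 2.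
Proof.
move=> /zeta_duplication; rewrite eta3 twisted_zetaE => e.
have e' : zeta (2 * z) = (Z 0 z + Z 1 z + Z 2 z + Z 3 z + (eta 1 + eta 2)) / 2 by rewrite e; field.
have z0 : zeta z = Z 0 z by rewrite /Z /Defs.omega /= mul0r subr0.
rewrite e' z0 -/(Z l z) /eps; elim/l_cases: l => /=; rewrite ?eta0 ?eta3;
  by move: (Z 0 z) (Z 1 z) (Z 2 z) (Z 3 z) (eta 1) (eta 2) => *; field.
Qed.

(** The derivative of the duplication formula. *)
Lemma sum_wp z : ~ L z -> \sum_(k < 4) wp (z - omega k / 2) = half_wp z.
Proof.
move=> nLz; have yL : 2 * z \notin Lam by apply/negP => /L_double.
have d1 : is_derive z (1 : C) (fun w => \sum_(k < 4) zeta (w - omega k / 2))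
    (\sum_(k < 4) - wp (z - omega k / 2)).
  apply: (@deriveC_sum R _ _ (fun (k : 'I_4) w => zeta (w - omega k / 2))) => k.
  apply: is_derive_translate.
  by have [] := wp_zeta tau_gt0 (half_shift_notin (ltn_ord k) nLz).
have d2 : is_derive z (1 : C) (fun w => 2 * zeta (2 * w) - eta 3) (- half_wp z).
  have [_ dz] := wp_zeta tau_gt0 yL.
  have dz' : is_derive (2 * z + 0) (1 : C) zeta (- wp (2 * z)) by rewrite addr0.
  have d3 : is_derive z (1 : C) (fun w => zeta (2 * w)) (2 * - wp (2 * z)).
    by apply: is_derive_near (is_derive_affine dz'); near=> w; rewrite addr0.
  apply: deriveC_eq (deriveC_sub (deriveC_mul (deriveC_cst 2 z) d3) (deriveC_cst (eta 3) z)) _.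
  by rewrite /half_wp; move: (wp _) (zeta _) => u v; ring.
have nz : \forall w \near z, \sum_(k < 4) zeta (w - omega k / 2) = 2 * zeta (2 * w) - eta 3.
  apply: filterS (notin_span_open al_be_coords_le nLz) => w nLw.
  by rewrite -zeta_duplication// !big_ord_recl big_ord0 /= /bump /= addr0 !addrA.
have := is_derive1E d1; rewrite (derive1_near nz) (is_derive1E d2) sumrN.
by move=> /oppr_inj.
Unshelve. all: by end_near. Qed.

Lemma F_solE T z : F_sol tau l T z = 2 * T - twisted_zeta z.
Proof. by rewrite /F_sol /twisted_zeta; ring. Qed.

Lemma q_potE T z : ~ L z -> q_pot tau l T z = 3 / 4 * half_wp z + T * twisted_zeta z + T ^+ 2.
Proof. by move=> nLz; rewrite /q_pot sum_wp// /twisted_zeta; ring. Qed.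

Lemma toTE (x y : C) : @toT R tau x = @toT R tau y <-> x - y \in Lam.
Proof.
split=> h; first by rewrite Quotient.idealrBE; apply/eqP; exact: h.
by rewrite Quotient.idealrBE in h; move/eqP: h.
Qed.

Lemma two_torsionE z : @two_torsion R tau (@toT R tau z) <-> L z.
Proof.
split=> [[k _ /toTE h]|/L_double /(latticeE _ _)[m [n e]]].
  apply/L_double; have [q e] := omega_lattice_point k.
  have -> : 2 * z = - (omega k / 2 - z) - (omega k / 2 - z) + omega k by field.
  apply: rpredD; first by apply: rpredB => //; rewrite rpredN.
  by apply/latticeE; exists q.1, q.2.
have zE : z = (m%:~R + n%:~R * tau) / 2 by rewrite -e; field.
have [i [mi|mi]] := int_parity m; have [j [nj|nj]] := int_parity n;
  [exists (0 : 'I_4)%R|exists (@Ordinal 4 2 isT)|exists (@Ordinal 4 1 isT)|exists (@Ordinal 4 3 isT)] => //;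
  apply/toTE; apply/latticeE; exists (- i), (- j);
  rewrite zE mi nj /Defs.omega /= ?rmorphD ?rmorphM ?rmorphN /=; by field.
Qed.

(** With [F = 2 * T - h] and [q = 3 / 4 * (h ^+ 2 + A) + T * h + T ^+ 2], the equations of
    [h] cancel every power of [h] in the spectral expression. *)
Theorem spectral_polyE : exists A D : C,
  [/\ spectral_poly tau l = 16 *: 'X^4 + (12 * A) *: 'X^2 + D%:P,
      forall z, ~ L z -> derive1 twisted_zeta z ^+ 2 = twisted_zeta z ^+ 4 + 3 * A * twisted_zeta z ^+ 2 + D &
      forall z, ~ L z -> derive1 (derive1 twisted_zeta) z = 2 * twisted_zeta z ^+ 3 + 3 * A * twisted_zeta z].
Proof.
have [A [D ode]] := h_ode twisted_zeta_ns; exists A, D.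
split; [|by move=> z /ode[]|by move=> z /ode[]].
pose Q : {poly C} := 16 *: 'X^4 + (12 * A) *: 'X^2 + D%:P.
have QE T : Q.[T] = 16 * T ^+ 4 + 12 * A * T ^+ 2 + D.
  by rewrite /Q !hornerD !hornerZ !hornerXn hornerC.
have main T z : ~ @two_torsion R tau (@toT R tau z) -> Q.[T] = spectral_expr tau l T z.
  move=> nt; have nLz : ~ L z by move/two_torsionE.
  have FE : F_sol tau l T = (fun z => 2 * T - twisted_zeta z) by apply/funext => w; rewrite F_solE.
  have dF w : ~ L w -> derive1 (F_sol tau l T) w = - derive1 twisted_zeta w.
    move=> nLw; rewrite FE; apply: is_derive1E.
    by apply: deriveC_eq (deriveC_sub (deriveC_cst _ w) (analytic_is_derive (twisted_zeta_analytic nLw))) _; rewrite sub0r.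
  have nz : \forall w \near z, derive1 (F_sol tau l T) w = - derive1 twisted_zeta w.
    by apply: filterS (notin_span_open al_be_coords_le nLz) => w; exact: dF.
  have dF2 : derive1n 2 (F_sol tau l T) z = - derive1 (derive1 twisted_zeta) z.
    rewrite /derive1n /=; apply: (eq_trans (derive1_near nz)); apply: is_derive1E.
    by apply: deriveC_opp; apply: analytic_is_derive; apply: analytic_derive; exact: twisted_zeta_analytic.
  rewrite QE /spectral_expr dF2 (dF _ nLz) F_solE q_potE//.
  have [-> e1 ->] := ode _ nLz; rewrite sqrrN e1.
  by move: (twisted_zeta z) => H; field.
have [z1 nLz1 _] := h_surjective twisted_zeta_ns 0.
rewrite /spectral_poly; case: xgetP => [Q' _ hQ'|/(_ Q) []]; last exact: main.
apply: horner_inj => T; rewrite (hQ' _ z1); last by move/two_torsionE.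
by rewrite -main//; move/two_torsionE.
Qed.

End HalfLattice.

(** * Complex curves and their charts *)

Section Charts.
Variable R : realType.
Local Notation C := (CC R).
Local Notation md := (@md R).

Lemma derivable_is_derive1 (f : C -> C) c :
  derivable f c 1 -> is_derive c (1 : C) f (derive1 f c).
Proof. by move=> h; rewrite derive1E; exact: derivableP. Qed.

Lemma derivable_cont (g : C -> C) t : derivable g t 1 -> {for t, continuous g}.
Proof.
move=> /derivable_is_derive1; move: (derive1 g t) => l /is_deriveCP h.
apply/continuousC => e e0; have [d d0 hd] := h 1 ltr01.
have B0 : 0 < md l + 1 by have := md_ge0 l; lra.
have m0 : 0 < Num.min d (e / (md l + 1)) by rewrite lt_min d0 divr_gt0.
apply: (nearC m0) => w; rewrite lt_min ltr_pdivlMr// => /andP[w1 w2].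
have := hd _ w1; rewrite subrKC mul1r.
have := mdD (g w - g t - l * (w - t)) (l * (w - t)); rewrite subrK mdM.
have := md_ge0 (w - t); move: (md (w - t)) w2 => x; nra.
Qed.

(** Differentiability of an implicitly defined function: [k (phi t) - k s] is
    [phi t - s] times a factor tending to [k' s], which is not zero. *)
Lemma implicit_derivable (k phi g : C -> C) (t : C) :
  derivable k (phi t) 1 -> derive1 k (phi t) != 0 -> {for t, continuous phi} ->
  derivable g t 1 -> (\forall u \near t, k (phi u) = g u) -> derivable phi t 1.
Proof.
move=> /derivable_is_derive1; move: (derive1 k (phi t)) => l hk l0 cphi.
move=> /derivable_is_derive1; move: (derive1 g t) => m hg kg.
set s := phi t in hk; move/is_deriveCP: hk => hk; move/is_deriveCP: hg => hg.
have ml : 0 < md l by rewrite md_gt0.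
suff : is_derive t (1 : C) phi (m / l) by case.
apply/is_deriveCP => e e0.
pose B := md m / md l + 1.
have mm := md_ge0 m.
have q0 : 0 <= md m / md l by apply: divr_ge0 => //; exact: ltW.
have B0 : 0 < B by rewrite /B; lra.
pose e1 := Num.min (md l / 2) (e * md l / (4 * (B + B))).
have e10 : 0 < e1 by rewrite lt_min !divr_gt0 ?mulr_gt0//; lra.
have e1a : e1 <= md l / 2 by rewrite ge_min lexx.
have e1b : e1 * (4 * (B + B)) <= e * md l.
  by rewrite -ler_pdivlMr ?ge_min ?lexx ?orbT//; lra.
pose e2 := Num.min (md l) (e * md l / 2).
have e20 : 0 < e2 by rewrite lt_min ml !divr_gt0 ?mulr_gt0//.
have e2a : e2 <= md l by rewrite ge_min lexx.
have e2b : e2 <= e * md l / 2 by rewrite ge_min lexx orbT.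
have [d1 d10 hd1] := hk _ e10; have [d2 d20 hd2] := hg _ e20.
have /continuousC/(_ _ d10)/nbhsC[d3 d30 hd3] := cphi.
have /nbhsC[d4 d40 hd4] := kg.
exists (Num.min d2 (Num.min d3 d4)) => [|u]; first by rewrite !lt_min d20 d30.
rewrite !lt_min => /and3P[u2 u3 u4].
have tu : t + u - t = u by rewrite addrAC subrr add0r.
have c3 : md (phi (t + u) - s) < d1 by apply: hd3; rewrite tu.
have c4 : k (phi (t + u)) = g (t + u) by apply: hd4; rewrite tu.
have c5 : k s = g t by apply: hd4; rewrite subrr md0.
have := hd1 _ c3; rewrite subrKC c4 c5 => a1.
have a2 := hd2 _ u2.
set x := phi (t + u) - s in a1 *; set y := g (t + u) - g t in a1 a2.
have lx : md (l * x) = md l * md x by rewrite mdM.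
have bx : md l * md x <= 2 * (md y).
  have := md_subr (l * x) y; rewrite (mdBC (l * x) y) lx.
  have : e1 * md x <= md l / 2 * md x by rewrite ler_wpM2r ?md_ge0.
  lra.
have b_y : md y <= (md m + md l) * md u.
  have := md_subr y (m * u); rewrite mdM.
  have : e2 * md u <= md l * md u by rewrite ler_wpM2r ?md_ge0.
  lra.
have xB : md x <= 2 * B * md u.
  rewrite /B -(ler_pM2l ml); apply: (le_trans bx).
  have -> : md l * (2 * (md m / md l + 1) * md u) = 2 * ((md m + md l) * md u).
    by field; rewrite gt_eqF.
  lra.
have -> : x - m / l * u = ((l * x - y) + (y - m * u)) / l by field.
rewrite mdM mdV ler_pdivrMr//; apply: (le_trans (mdD _ _)); rewrite (mdBC (l * x) y).
have u0 := md_ge0 u.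
have : e1 * md x <= e1 * (2 * B * md u) by rewrite ler_wpM2l//; lra.
have : e2 * md u <= e * md l / 2 * md u by rewrite ler_wpM2r.
have : e1 * (4 * (B + B)) * md u <= e * md l * md u by rewrite ler_wpM2r.
have : 0 <= e * md l * md u by rewrite !mulr_ge0// ltW.
lra.
Qed.

Lemma open_within_cont (X : topologicalType) (A : set X) (f : X -> C) (x : X) :
  open A -> {within A, continuous f} -> A x -> {for x, continuous f}.
Proof.
move=> oA; rewrite continuous_open_subspace//.
by move=> cf Ax; apply: cf; rewrite inE.
Qed.

Lemma chart_cont (X : topologicalType) (c : chart R X) x : is_chart c -> dom c x ->
  {for x, continuous (coord c)}.
Proof. by case=> oc cc _ _; exact: open_within_cont. Qed.

(** Charts are injective and open, so that a function on the curve becomes a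
    function of the coordinate and stays continuous. *)
Lemma chart_expr (X : topologicalType) (c : chart R X) (phi : X -> C) x :
  is_chart c -> dom c x -> {for x, continuous phi} ->
  exists g : C -> C, {for coord c x, continuous g} /\
    forall x', dom c x' -> g (coord c x') = phi x'.
Proof.
move=> [oc cc ic opc] dx cphi.
have [g gE] : exists g : C -> C, forall x', dom c x' -> g (coord c x') = phi x'.
  exists (fun t => phi (xget x [set x' | dom c x' /\ coord c x' = t])) => x' dx'.
  case: xgetP => [y _ [dy e]|/(_ x')[]]; last by split.
  by rewrite (ic y x' (mem_set dy) (mem_set dx') e).
exists g; split; last exact: gE.
move=> N; rewrite (gE _ dx) => /cphi Nx.
have : nbhs x (dom c `&` phi @^-1` N).
  by apply: filterI => //; exact: open_nbhs_nbhs.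
rewrite nbhsE => -[U [oU Ux] UN].
have oV := opc U oU (fun y Uy => (UN y Uy).1).
have : nbhs (coord c x) (coord c @` U) by apply: open_nbhs_nbhs; split=> //; exists x.
by apply: filterS => _ [y Uy <-] /=; have [dy Ny] := UN _ Uy; rewrite gE.
Qed.

Lemma chart_near (X : topologicalType) (c : chart R X) (P : set X) x :
  is_chart c -> dom c x -> (\forall x' \near x, P x') ->
  \forall t \near coord c x, exists x', [/\ dom c x', P x' & coord c x' = t].
Proof.
move=> [oc _ _ opc] dx nP.
have : nbhs x (dom c `&` P) by apply: filterI => //; exact: open_nbhs_nbhs.
rewrite nbhsE => -[U [oU Ux] UN].
have oV := opc U oU (fun y Uy => (UN y Uy).1).
have : nbhs (coord c x) (coord c @` U) by apply: open_nbhs_nbhs; split=> //; exists x.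
by apply: filterS => _ [y Uy <-]; exists y; have [dy Ny] := UN _ Uy; split.
Qed.

(** In charts [f] is the function defined implicitly by [k (phi t) = g t]. *)
Lemma holomorphic_implicit (X Y : topologicalType) (c : chart R X) (d : chart R Y)
    (f : X -> Y) (k g : C -> C) x :
  is_chart c -> dom c x -> is_chart d -> dom d (f x) -> {for x, continuous f} ->
  derivable k (coord d (f x)) 1 -> derive1 k (coord d (f x)) != 0 ->
  derivable g (coord c x) 1 ->
  (\forall x' \near x, k (coord d (f x')) = g (coord c x')) ->
  holomorphic_in_charts f c d x.
Proof.
move=> cc dx cd dfx cf dk k0 dg kg.
have cphi : {for x, continuous (fun x' => coord d (f x'))}.
  by apply: continuous_comp; [exact: cf|exact: chart_cont].
have [phi [cphi' phiE]] := chart_expr cc dx cphi.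
exists phi; split; last first.
  have oc : open (dom c) by case: cc.
  have : nbhs x (dom c) by exact: open_nbhs_nbhs.
  by apply: filterS => x' /phiE.
have e0 := phiE x dx; rewrite -e0 in dk k0.
apply: (implicit_derivable dk k0 cphi' dg).
by apply: filterS (chart_near cc dx kg) => t [x' [dx' kx' <-]]; rewrite phiE.
Qed.

(** The map [ev] to the affine plane may identify points; the condition is the one
    that makes its differential injective in every chart. *)
Definition immersed (X : curve R) (ev : X -> C * C) :=
  (forall c, atlas X c -> is_chart c) /\
  forall c, atlas X c -> exists g1 g2 : C -> C, forall p, dom c p ->
    [/\ ev p = (g1 (coord c p), g2 (coord c p)), derivable g1 (coord c p) 1,
        derivable g2 (coord c p) 1 &
        (derive1 g1 (coord c p), derive1 g2 (coord c p)) != 0].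

(** One of the two coordinates of the plane has a nonzero derivative in the chart
    of the target, and defines [f] implicitly. *)
Lemma immersed_holomorphic (X Y : curve R) (evX : X -> C * C) (evY : Y -> C * C)
    (f : X -> Y) c d x : immersed evX -> immersed evY -> atlas X c -> atlas Y d ->
  dom c x -> dom d (f x) -> {for x, continuous f} -> (forall x, evY (f x) = evX x) ->
  holomorphic_in_charts f c d x.
Proof.
move=> [icX iX] [icY iY] Xc Yd dx dfx cf ef.
have [g1 [g2 hg]] := iX _ Xc; have [k1 [k2 hk]] := iY _ Yd.
have ic := icX _ Xc; have id := icY _ Yd.
have [eg dg1 dg2 _] := hg _ dx; have [ek dk1 dk2 nk] := hk _ dfx.
have nearE : \forall x' \near x, k1 (coord d (f x')) = g1 (coord c x') /\
    k2 (coord d (f x')) = g2 (coord c x').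
  have n1 : nbhs x (dom c) by apply: open_nbhs_nbhs; split=> //; case: ic.
  have n2 : nbhs x (f @^-1` dom d).
    by apply: cf; apply: open_nbhs_nbhs; split=> //; case: id.
  apply: filterS2 n1 n2 => x' /hg[e1 _ _ _] /hk[e2 _ _ _].
  by have := ef x'; rewrite e1 e2 => -[-> ->].
have [k10|k10] := eqVneq (derive1 k1 (coord d (f x))) 0; last first.
  by apply: (holomorphic_implicit (k := k1) (g := g1)) => //; apply: filterS nearE => x' [].
apply: (holomorphic_implicit (k := k2) (g := g2)) => //.
  by apply: contra nk => /eqP k20; rewrite k10 k20.
by apply: filterS nearE => x' [].
Qed.

(** Over a compact neighbourhood [K] of [y], the points outside [O] form a compact
    set; its image is closed and misses [y]. *)
Lemma proper_tube (X : topologicalType) (f : X -> C) (y : C) (O : set X) :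
  continuous f -> proper_map f -> open O -> f @^-1` [set y] `<=` O ->
  \forall y' \near y, f @^-1` [set y'] `<=` O.
Proof.
move=> cf pf oO fO.
pose K := [set z : C | md (z - y) <= 1].
have clK (a : C) (B : R) : closed [set z : C | md (z - a) <= B].
  rewrite (_ : mkset _ = ~` [set z | B < md (z - a)]); last first.
    by apply/seteqP; split=> z /=; rewrite leNgt => /negP.
  apply: open_closedC; apply: openC => z /= hz; exists (md (z - a) - B); first lra.
  by move=> w; have := md_tri z w a; rewrite (mdBC z w); lra.
have cK : compact K.
  apply: subclosed_compact (@compact_disc R (md y + 1)) _; first exact: clK.
  by move=> z; rewrite /K /= => hz; have := mdD (z - y) y; rewrite subrK; lra.
have cKO : compact (f @^-1` K `&` ~` O).
  by apply: compact_closedI; [exact: pf|exact: open_closedC].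
have cI : closed (f @` (f @^-1` K `&` ~` O)).
  apply: compact_closed; first exact: norm_hausdorff.
  by apply: continuous_compact => //; exact: continuous_subspaceT.
have n1 : nbhs y (~` (f @` (f @^-1` K `&` ~` O))).
  apply: open_nbhs_nbhs; split; first exact: closed_openC.
  by move=> [x [_ nOx] fx]; apply: nOx; apply: fO.
have n2 : nbhs y K by apply: (nearC ltr01) => w /ltW.
apply: filterS2 n1 n2 => y' h1 h2 x /= fx; apply: contrapT => nOx.
by apply: h1; exists x => //; split=> //=; rewrite fx.
Qed.

Lemma finite_gap (s : seq C) (t : C) :
  exists2 e : R, 0 < e & forall y, y \in s -> y != t -> e <= md (y - t).
Proof.
elim: s => [|x s [e e0 he]]; first by exists 1.
have [->|xt] := eqVneq x t.
  exists e => // y; rewrite inE => /orP[/eqP ->|/he//]; by rewrite eqxx.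
exists (Num.min e (md (x - t))); first by rewrite lt_min e0 md_gt0 subr_eq0.
move=> y; rewrite inE => /orP[/eqP -> _|/he h /h]; first by rewrite ge_min lexx orbT.
by move=> h'; rewrite ge_min h'.
Qed.

Lemma limit_point_roots (p : {poly C}) : p != 0 ->
  limit_point [set x | root p x] = set0.
Proof.
move=> p0; apply/seteqP; split=> // t ht.
have [rs Dp] := closed_field_poly_normal p.
have rE x : root p x -> x \in rs.
  by rewrite Dp rootZ ?lead_coef_eq0// root_prod_XsubC.
have [e e0 he] := finite_gap rs t.
have nt : nbhs t [set z : C | md (z - t) < e] by apply/nbhsC; exists e.
have [y [yt /rE yr /=]] := ht _ nt.
by have := he _ yr yt; lra.
Qed.

End Charts.

Section Separation.
Variable R : realType.
Local Notation C := (CC R).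
Local Notation md := (@md R).

Lemma hausdorff_separating (Y : topologicalType) :
  (forall s s' : Y, s <> s' -> exists2 F : Y -> C, continuous F & F s <> F s') ->
  hausdorff_space Y.
Proof.
move=> sep x y cl; apply: contrapT => /sep[F cF Fxy].
have d0 : 0 < md (F x - F y) / 2.
  by rewrite divr_gt0// md_gt0 subr_eq0; apply/eqP.
have /continuousC/(_ _ d0) nx := cF x; have /continuousC/(_ _ d0) ny := cF y.
have [z [/= zx zy]] := cl _ _ nx ny.
by have := md_tri (F x) (F z) (F y); rewrite (mdBC (F x) (F z)); lra.
Qed.

Lemma affine_line_curve : is_complex_curve (affine_line R).
Proof.
split.
- exact: norm_hausdorff.
- by move=> x; exists (Chart setT id).
- move=> _ ->; split.
  + exact: openT.
  + by apply: (@continuous_subspaceT (CC R) (CC R) setT id) => z; exact: cvg_id.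
  + by move=> x y.
  + by move=> U oU _; rewrite image_id.
- move=> _ _ x -> -> _ _; exists id; split; first exact: derivable_id.
  by near=> z.
Unshelve. all: by end_near. Qed.

End Separation.

(** * The branched double covering *)

(** [Y] is the quotient of the complement of [L] by the group [L2]. The quotient
    map is presented as a relation, [rel s a] meaning that [s] is the class of
    [a]; the last two fields say that it is open and continuous. *)
Record quotient_param (R : realType) (L L2 : CC R -> Prop) (Y : topologicalType)
    (rel : Y -> CC R -> Prop) : Prop := QuotientParam {
  qp_notin : forall s a, rel s a -> ~ L a;
  qp_coset : forall s a b, rel s a -> (rel s b <-> L2 (b - a));
  qp_total : forall s, exists a, rel s a;
  qp_onto : forall a, ~ L a -> exists s, rel s a;
  qp_inj : forall s s' a, rel s a -> rel s' a -> s = s';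
  qp_open : forall U : set (CC R), open U -> open [set s | exists2 a, U a & rel s a];
  qp_continuous : forall V : set Y, open V -> forall s a, V s -> rel s a ->
    \forall a' \near a, forall s', rel s' a' -> V s' }.

Section Cover.
Variable R : realType.
Local Notation C := (CC R).
Local Notation md := (@md R).
Variables (al be : C) (k0 : R) (h P : C -> C).
Hypothesis ns : ns_function al be k0 h P.
Local Notation L := (span_int al be).
Local Notation L2 := (span_int al (2 * be)).
Local Notation h1 := (derive1 h).
Variable p : {poly C}.
Hypothesis p0 : p != 0.
Hypothesis hp : forall z, ~ L z -> h1 z ^+ 2 = p.[h z / 2].
Variables (Y : topologicalType) (rel : Y -> C -> Prop).
Hypothesis YQ : quotient_param L L2 rel.
Local Notation rel_notin := (qp_notin YQ).
Local Notation rel_coset := (qp_coset YQ).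
Local Notation rel_total := (qp_total YQ).
Local Notation rel_onto := (qp_onto YQ).
Local Notation rel_inj := (qp_inj YQ).
Local Notation rel_open := (qp_open YQ).
Local Notation rel_continuous := (qp_continuous YQ).
Variable T : Y -> C.
Hypothesis TE : forall s a, rel s a -> T s = h a / 2.

Definition cover_curve : curve R := @Curve R Y
  [set c : chart R Y | [/\ open (dom c), {within dom c, continuous (coord c)} &
     forall s, dom c s -> rel s (coord c s)]].

Definition rep s := projT1 (cid (rel_total s)).

Lemma relP s : rel s (rep s). Proof. by rewrite /rep; case: cid. Qed.

Definition W s : C := h1 (rep s).

Lemma WE s a : rel s a -> W s = h1 a.
Proof.
move=> sa; have /(rel_coset _ sa) La := relP s.
by rewrite /W -(subrK a (rep s)) addrC (h1_L2 ns La (rel_notin sa)).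
Qed.

(** A function of the representative is continuous on [Y] since the quotient map is
    open. *)
Lemma lift_continuous (f : C -> C) (F : Y -> C) : (forall s a, rel s a -> F s = f a) ->
  (forall a, ~ L a -> {for a, continuous f}) -> continuous F.
Proof.
move=> Ff cf s; have sa := relP s; apply/continuousC => e e0.
have /continuousC/(_ _ e0)/nbhsC[d d0 hd] := cf _ (rel_notin sa).
have := rel_open (@openC_ball R (rep s) d) => oV.
have : nbhs s [set s' | exists2 a, md (a - rep s) < d & rel s' a].
  apply: open_nbhs_nbhs; split; first exact: oV.
  by exists (rep s) => //=; rewrite subrr md0.
by apply: filterS => s' [a ad s'a]; rewrite (Ff _ _ s'a) (Ff _ _ sa); exact: hd.
Qed.

Lemma T_continuous : continuous T.
Proof.
apply: (lift_continuous TE) => a nLa; apply: analytic_cont.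
by apply: analyticM; [exact: ns_analytic ns _ nLa|exact: analytic_cst].
Qed.

Lemma W_continuous : continuous W.
Proof.
apply: (lift_continuous WE) => a nLa; apply: analytic_cont; exact: h1_analytic ns _ nLa.
Qed.

Lemma W_sqr s : W s ^+ 2 = p.[T s].
Proof. by rewrite (TE (relP s)) -hp//; exact: rel_notin (relP s). Qed.

Lemma WT_inj s s' : W s = W s' -> T s = T s' -> s = s'.
Proof.
have sa := relP s; have sb := relP s'; rewrite (TE sa) (TE sb) => w t.
have t2 : h (rep s) = h (rep s').
  by apply: (mulIf (_ : (2 : C)^-1 != 0)) => //; rewrite invr_eq0 pnatr_eq0.
have Lba := h_injective ns (rel_notin sa) (rel_notin sb) t2 w.
have sb' : rel s (rep s') by apply/(rel_coset _ sa).
exact: rel_inj sb' sb.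
Qed.

Lemma h1_even z : ~ L z -> h1 (- z) = h1 z.
Proof.
move=> nLz; have nLz' : ~ L (- z) by move/spanN; rewrite opprK.
have d := analytic_is_derive (ns_analytic ns nLz).
have d' : is_derive (-1 * - z + 0) (1 : C) h (h1 z) by rewrite mulN1r opprK addr0.
apply: is_derive1E; have := deriveC_opp (is_derive_affine d').
rewrite mulN1r opprK; apply: is_derive_near; near=> w.
by rewrite mulN1r addr0 (ns_odd ns) opprK.
Unshelve. all: by end_near. Qed.

(** The covering involution is induced by [a |-> be - a]. *)
Lemma h_reflect a : h (be - a) = h a.
Proof. by rewrite addrC (ns_be ns) (ns_odd ns) opprK. Qed.

Lemma h1_reflect a : ~ L a -> h1 (be - a) = - h1 a.
Proof.
move=> nLa; have nLa' : ~ L (- a) by move/spanN; rewrite opprK.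
rewrite addrC (@h1_translate _ al be k0 h P ns be (-1))//.
- by rewrite mulN1r h1_even.
- exact: span_r.
- by move=> z; rewrite (ns_be ns) mulN1r.
Qed.

Lemma notin_reflect a : ~ L a -> ~ L (be - a).
Proof.
move=> nLa Lb; apply: nLa; have -> : a = be - (be - a) by ring.
by apply: spanB => //; exact: span_r.
Qed.

Lemma reflectY s : exists2 s', T s' = T s & W s' = - W s.
Proof.
have sa := relP s; have nL := rel_notin sa.
have [s' s'b] := rel_onto (notin_reflect nL).
exists s'; first by rewrite (TE s'b) (TE sa) h_reflect.
by rewrite (WE s'b) (WE sa) h1_reflect.
Qed.

Lemma same_fiber s s' : T s = T s' -> W s = W s' \/ W s = - W s'.
Proof.
move=> tt; have ww : W s ^+ 2 = W s' ^+ 2.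
  exact: etrans (W_sqr s) (etrans (congr1 (horner p) tt) (esym (W_sqr s'))).
move: (W s) (W s') ww => w w' /eqP; rewrite eqf_sqr => /orP[/eqP|/eqP]; by [left|right].
Qed.

Lemma T_surj t : exists s, T s = t.
Proof.
have [a nLa ha] := h_surjective ns (2 * t); have [s sa] := rel_onto nLa.
by exists s; rewrite (TE sa) ha mulrC mulKf// pnatr_eq0.
Qed.

Lemma WT_surj w t : w ^+ 2 = p.[t] -> exists2 s, W s = w & T s = t.
Proof.
move=> wt; have [s st] := T_surj t.
have : w ^+ 2 = W s ^+ 2 by rewrite W_sqr st.
move=> /eqP; rewrite eqf_sqr => /orP[/eqP ->|/eqP ->]; first by exists s.
by have [s' e1 e2] := reflectY s; exists s'; rewrite ?e1.
Qed.

Lemma rel_gap : exists2 d : R, 0 < d & forall s a b, rel s a -> rel s b ->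
  md (b - a) < d -> a = b.
Proof.
have [d d0 hd] := span_gap (ns_coords_le ns); exists d => // s a b sa sb ab.
have /L2_L/hd/(_ ab)/eqP := (rel_coset b sa).1 sb.
by rewrite subr_eq0 => /eqP.
Qed.

Lemma near_rel (V : set Y) s a : nbhs s V -> rel s a ->
  \forall a' \near a, ~ L a' /\ forall s', rel s' a' -> V s'.
Proof.
rewrite nbhsE => -[U [oU Us] UV] sa.
apply: filterS2 (notin_span_open (ns_coords_le ns) (rel_notin sa)) (rel_continuous oU Us sa).
by move=> a' nL hU; split=> // s' /hU /UV.
Qed.

Lemma cover_chart c : atlas cover_curve c -> is_chart c.
Proof.
move=> [oc cc rc]; split=> //.
  move=> s s'; rewrite !inE => ds ds' e.
  by apply: (rel_inj (rc _ ds)); rewrite e; exact: rc.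
move=> U oU Udom; apply: openC => _ [s Us <-].
have ds := Udom _ Us; have sa := rc _ ds.
have [d d0 gap] := rel_gap; have d2 : 0 < d / 2 by lra.
have cs := open_within_cont oc cc ds.
have /continuousC/(_ _ d2) n1 := cs.
have n2 : nbhs s U by apply: open_nbhs_nbhs.
have n3 : nbhs s ([set y | md (coord c y - coord c s) < d / 2] `&` U).
  by apply: filterI; [exact: n1|exact: n2].
have /nbhsC[e e0 he] := near_rel n3 sa.
exists (Num.min e (d / 2)) => [|a']; first by rewrite lt_min e0.
rewrite lt_min => /andP[a'e a'd]; have [nL hs] := he _ a'e.
have [s' s'a] := rel_onto nL; have [/= h3 Us'] := hs _ s'a.
exists s' => //; apply: (gap s') => //; first exact/rc/Udom.
have := md_tri a' (coord c s) (coord c s').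
by rewrite (mdBC (coord c s) (coord c s')); lra.
Qed.

Definition ev (s : cover_curve) : C * C := (W s, T s).

Lemma derive1_half a : ~ L a -> is_derive a (1 : C) (fun z => h z / 2) (h1 a / 2).
Proof.
move=> nLa; apply: deriveC_eq (deriveC_mul (analytic_is_derive (ns_analytic ns nLa)) (deriveC_cst 2^-1 a)) _.
by ring.
Qed.

Lemma regular_pair a : ~ L a -> (derive1 h1 a, derive1 (fun z => h z / 2) a) != 0.
Proof.
move=> nLa; rewrite (is_derive1E (derive1_half nLa)).
apply/eqP => -[h2a /eqP]; rewrite mulf_eq0 invr_eq0 pnatr_eq0 orbF => /eqP h1a.
by have := h_regular ns nLa h1a; rewrite h2a eqxx.
Qed.

Lemma cover_immersed : immersed ev.
Proof.
split; first exact: cover_chart.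
move=> c [oc cc rc]; exists h1, (fun z => h z / 2) => s /rc sa.
have nL := rel_notin sa; split.
- by rewrite /ev (WE sa) (TE sa).
- by have [] := analytic_is_derive (h1_analytic ns nL).
- by have [] := derive1_half nL.
- exact: regular_pair.
Qed.

(** In a disc smaller than the gap of the lattice the representative of a point of
    [Y] is unique; choosing it is a continuous local section. *)
Lemma cover_charts_exist s : exists2 c, atlas cover_curve c & dom c s.
Proof.
have [d d0 gap] := rel_gap; have d2 : 0 < d / 2 by lra.
pose D (a : C) : Prop := md (a - rep s) < d / 2.
pose c := @Chart R Y [set s' | exists2 a, D a & rel s' a]
   (fun s' => xget 0 [set a | D a /\ rel s' a]).
have cE s' a : D a -> rel s' a -> coord c s' = a.
  move=> Da s'a; rewrite /c /=; case: xgetP => [b _ [Db s'b]|/(_ a)[]//].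
  apply: (gap s') => //; have := md_tri a (rep s) b.
  by rewrite (mdBC (rep s) b); rewrite /D in Da Db; lra.
have oD : open D by exact: openC_ball.
have oc : open (dom c) by exact: rel_open.
exists c; last by exists (rep s); rewrite /D ?subrr ?md0//; exact: relP.
split=> //; last by move=> s' [a Da s'a]; rewrite (cE _ _ Da s'a).
rewrite continuous_open_subspace// => s'; rewrite inE => -[a Da s'a].
move=> N; rewrite (cE _ _ Da s'a) => Na.
have : nbhs a (N `&` D) by apply: filterI => //; apply: open_nbhs_nbhs.
rewrite nbhsE => -[U [oU Ua] UN].
have : nbhs s' [set s' | exists2 a, U a & rel s' a].
  by apply: open_nbhs_nbhs; split; [exact: rel_open|exists a].
apply: filterS => s2 [b Ub s2b]; have [Nb Db] := UN _ Ub.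
by change (N (coord c s2)); rewrite (cE _ _ Db s2b).
Qed.

Lemma cover_is_curve : is_complex_curve cover_curve.
Proof.
split.
- apply: (@hausdorff_separating R) => s s' ss.
  have [w|w] := pselect (W s = W s'); last first.
    by exists W; [exact: W_continuous|exact: w].
  exists T; first exact: T_continuous.
  by move=> t; apply: ss; exact: WT_inj.
- exact: cover_charts_exist.
- exact: cover_chart.
move=> c d s ac ad ds ds'.
apply: (@immersed_holomorphic R cover_curve cover_curve ev ev id c d s
  cover_immersed cover_immersed ac ad ds ds'); [exact: cvg_id|by []].
Qed.

Lemma T_holomorphic : @holomorphic R cover_curve (affine_line R) T.
Proof.
split; first exact: T_continuous.
move=> c d s [oc cc rc] -> ds _; have sa := rc _ ds.
exists (fun z => h z / 2); split; first by have [] := derive1_half (rel_notin sa).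
have : nbhs s (dom c) by apply: open_nbhs_nbhs.
by apply: filterS => s' /rc /TE.
Qed.

(** The preimage of a compact set [K] is the image of the part of a fundamental
    parallelogram where [h / 2] lies in [K]; this part is closed because [h] is
    unbounded near [L]. *)
Lemma T_proper : proper_map T.
Proof.
move=> K cK.
have clK : closed K by apply: compact_closed => //; exact: norm_hausdorff.
have [M hM] : exists M : R, forall t, K t -> md t <= M.
  have [K0|/set0P K0] := eqVneq K set0; first by exists 0 => t; rewrite K0.
  have cm : {within K, continuous (md : C -> R)}.
    by apply: continuous_subspaceT => z; exact: continuous_md.
  have [c _ hc] := compact_EVT_max K0 cK cm.
  by exists (md c) => t Kt; apply: hc; rewrite inE.
pose A := [set z | exists q : R * R,
    [/\ - 1 <= q.1 <= 1, - 1 <= q.2 <= 1 & z = al * q.1%:C%C + (2 * be) * q.2%:C%C]].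
have cA : compact A by exact: compact_parallelogram.
have clA : closed A by apply: compact_closed => //; exact: norm_hausdorff.
pose B := [set a | [/\ A a, ~ L a & K (h a / 2)]].
have clB : closed B.
  move=> a ha.
  have ca (e : R) : 0 < e -> exists2 b, B b & md (b - a) < e.
    move=> e0; have [b [Bb be']] := ha _ ((nbhsC a [set v | md (v - a) < e]).2
      (ex_intro2 _ _ e e0 (fun v h => h))).
    by exists b.
  have nLa : ~ L a.
    move=> La; have /dnbhsC[e e0 he] := h_blowup ns (2 * M) La.
    have [b [_ nLb Kb] bae] := ca _ e0.
    have ba : b != a by apply/eqP => e1; apply: nLb; rewrite e1.
    by have := hM _ Kb; rewrite mdM mdV md_nat; have := he _ ba bae; lra.
  split=> //.
    by apply: clA => N Na; have [b [[Ab _ _] Nb]] := ha N Na; exists b.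
  apply: clK => N Na.
  have ch : {for a, continuous (fun z => h z / 2)}.
    apply: analytic_cont; apply: analyticM; last exact: analytic_cst.
    exact: ns_analytic ns _ nLa.
  by have [b [[_ _ Kb] Nb]] := ha _ (ch _ Na); exists (h b / 2).
have cB : compact B.
  by apply: (subclosed_compact clB cA) => a [].
have [a0 nLa0 _] := h_surjective ns 0; have [s0 _] := rel_onto nLa0.
pose pi a := xget s0 [set s | rel s a].
have piE s a : rel s a -> pi a = s.
  move=> sa; rewrite /pi; case: xgetP => [s' _ s'a|/(_ s)//]; exact: rel_inj s'a sa.
have -> : T @^-1` K = pi @` B.
  apply/seteqP; split=> [s Ks|_ [a [Aa nLa Ka] <-]]; last first.
    by have [s sa] := rel_onto nLa; rewrite (piE _ _ sa) /= (TE sa).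
  have sa := relP s.
  have [x [y E]] := ns_coords ns (rep s).
  pose m := Num.floor x; pose n := Num.floor (y / 2).
  pose b := al * (x - m%:~R)%:C%C + (2 * be) * (y / 2 - n%:~R)%:C%C.
  have sb : rel s b.
    apply/(rel_coset _ sa); exists (- m), (- n); rewrite /b E.
    by rewrite !rmorphB rmorphM fmorphV rmorph_nat /= !rmorph_int !rmorphN /=; field.
  exists b; last exact: piE.
  split; last 2 first.
  - exact: rel_notin sb.
  - by rewrite -(TE sb).
  exists (x - m%:~R, y / 2 - n%:~R); split=> //=.
    by have := floor_le_tmp x; have := floorD1_gt x; rewrite intrD -/m; lra.
  by have := floor_le_tmp (y / 2); have := floorD1_gt (y / 2); rewrite intrD -/n; lra.
apply: continuous_compact cB.
apply: continuous_in_subspaceT => a; rewrite inE => -[_ nLa _] N.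
have [s sa] := rel_onto nLa; rewrite (piE _ _ sa) => Ns.
apply: filterS (near_rel Ns sa) => a' [nLa' hN].
by have [s' s'a] := rel_onto nLa'; rewrite /= (piE _ _ s'a); exact: hN.
Qed.

(** The two signs, indexed as the sheets have to be. *)
Definition side (i : 'I_2) (x : R) := 0 < (if (i : nat) == 0%N then 1 else -1) * x.

Lemma side_ex x : x != 0 -> exists i, side i x.
Proof.
rewrite neq_lt /side => /orP[] hx; first by exists (@Ordinal 2 1 isT) => /=; lra.
by exists (@Ordinal 2 0 isT) => /=; lra.
Qed.

Lemma side_uniq i j x : side i x -> side j x -> i = j.
Proof.
move=> h3 h4; apply/val_inj => /=; move: h3 h4; rewrite /side.
by case: i j => [[|[|i]] hi] [[|[|j]] hj] //= h3 h4;
  (suff : 0 < (0 : R) by rewrite ltxx); lra.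
Qed.

Lemma side_opp i x : x != 0 -> ~ side i x -> side i (- x).
Proof.
rewrite /side neq_lt => hx /negP; rewrite -leNgt.
by case: ((i : nat) == 0%N); move: hx => /orP[] hx; lra.
Qed.

Lemma side_not_opp i x : side i x -> side i (- x) -> False.
Proof.
by rewrite /side; case: ((i : nat) == 0%N) => h3 h4;
  (suff : 0 < (0 : R) by rewrite ltxx); lra.
Qed.

Lemma side_open i : open [set x | side i x].
Proof.
rewrite /side; apply: (@open_comp _ _ (fun x : R => (if (i : nat) == 0%N then 1 else -1) * x) [set y : R | 0 < y]).
  by move=> x _; apply: cvgM; [exact: cvg_cst|exact: cvg_id].
exact: open_gt.
Qed.

(** Where [md (p.[u] - p.[t]) < md p.[t]], the quotient [p.[u] / p.[t]] is not a
    nonpositive real number, so its square roots have nonzero real parts of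
    opposite signs. *)
Definition sheet (t : C) (i : 'I_2) : set Y :=
  [set s | md (p.[T s] - p.[t]) < md p.[t] /\
    side i (complex.Re (W s / sqrtC p.[t]))].

Lemma horner_continuous (q : {poly C}) : continuous (fun z => q.[z]).
Proof.
move=> z; apply: analytic_cont; exists 1 => //.
have := @approx_poly R z 1 (q \Po ('X + z%:P)); apply: approx_eq => u _.
by rewrite horner_comp hornerD hornerX hornerC subrK.
Qed.

Lemma Re_continuous : continuous (@complex.Re R : C -> R).
Proof.
move=> z A /nbhs_ballP[e /= e0 hA]; apply: (nearC e0) => w hw; apply: hA.
rewrite -ball_normE /= -raddfB; apply: le_lt_trans (md_Re _) _.
by rewrite mdBC.
Qed.

Lemma sheet_open t i : open (sheet t i).
Proof.
have o1 : open [set s | md (p.[T s] - p.[t]) < md p.[t]].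
  apply: (@open_comp _ _ T [set u | md (p.[u] - p.[t]) < md p.[t]]).
    by move=> s _; exact: T_continuous.
  apply: (@open_comp _ _ (fun u : C => p.[u]) [set v | md (v - p.[t]) < md p.[t]]).
    by move=> s _; exact: horner_continuous.
  exact: openC_ball.
have o2 : open [set s | side i (complex.Re (W s / sqrtC p.[t]))].
  apply: (@open_comp _ _ W [set w : C | side i (complex.Re (w / sqrtC p.[t]))]).
    by move=> s _; exact: W_continuous.
  apply: (@open_comp _ _ (fun w : C => w / sqrtC p.[t]) [set v : C | side i (complex.Re v)]).
    move=> w _; apply: analytic_cont.
    by apply: analyticM; [exact: analytic_id|exact: analytic_cst].
  apply: (@open_comp _ _ (@complex.Re R : C -> R) [set x : R | side i x]).
    by move=> w _; exact: Re_continuous.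
  exact: side_open.
exact: openI o1 o2.
Qed.

(** The square of an imaginary number is at distance at least 1 from 1. *)
Lemma Re_neq0_of_sqr (x : C) : md (x ^+ 2 - 1) < 1 -> complex.Re x != 0.
Proof.
case: x => a b hx; apply/eqP => /= a0; move: hx; apply/negP; rewrite -leNgt.
have -> : ((a +i* b)%C : C) ^+ 2 - 1 = (- (b ^+ 2 + 1))%:C%C.
  by rewrite a0; apply/eqP; rewrite eq_complex /=; apply/andP; split; apply/eqP; ring.
rewrite md_real normrN ger0_norm; have := sqr_ge0 b; lra.
Qed.

Lemma sheet_cover t s : p.[t] != 0 -> md (p.[T s] - p.[t]) < md p.[t] ->
  complex.Re (W s / sqrtC p.[t]) != 0.
Proof.
move=> pt hs; apply: Re_neq0_of_sqr.
rewrite expr_div_n sqrtCK W_sqr.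
have -> : p.[T s] / p.[t] - 1 = (p.[T s] - p.[t]) / p.[t] by field.
by rewrite mdM mdV ltr_pdivrMr ?md_gt0// mul1r.
Qed.

Lemma sheet_inj t i s s' : sheet t i s -> sheet t i s' -> T s = T s' -> s = s'.
Proof.
move=> [_ h1s] [_ h2s] tt.
have [ww|ww] := same_fiber tt; first exact: WT_inj ww tt.
exfalso; apply: side_not_opp h2s _.
by rewrite -raddfN -mulNr -ww.
Qed.

Lemma fiber_finite_tube (O : set Y) s : open O ->
  (forall s', T s' = T s -> O s') -> \forall t \near T s, forall s', T s' = t -> O s'.
Proof.
by move=> oO hO; apply: (proper_tube T_continuous T_proper oO) => s' /= /hO.
Qed.

(** On a sheet [T] is open: the other points of the fibre of [s] lie in the other
    sheet, so by properness the fibres close to it lie in the union of [U] and the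
    other sheet, and their point in the sheet of [s] is in [U]. *)
Lemma T_evenly_covered t : p.[t] != 0 ->
  exists V : set C, [/\ open V, V t & @evenly_covered 2 Y C T V].
Proof.
move=> pt; pose V := [set u | md (p.[u] - p.[t]) < md p.[t]].
have oV : open V.
  apply: (@open_comp _ _ (fun u : C => p.[u]) [set v | md (v - p.[t]) < md p.[t]]).
    by move=> s _; exact: horner_continuous.
  exact: openC_ball.
exists V; split=> //; first by rewrite /V /= subrr md0 md_gt0.
have other s : exists s', T s' = T s /\ complex.Re (W s' / sqrtC p.[t]) = - complex.Re (W s / sqrtC p.[t]).
  have [s' e1 e2] := reflectY s; exists s'; split=> //.
  by rewrite e2 mulNr raddfN.
have bij i : set_bij (sheet t i) V T.
  split; first by move=> s [].
    by move=> s s' /set_mem h3 /set_mem h4; exact: sheet_inj h3 h4.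
  move=> u Vu; have [s su] := T_surj u.
  have hs : md (p.[T s] - p.[t]) < md p.[t] by rewrite su.
  have x0 := sheet_cover pt hs; have [s' [e1 e2]] := other s.
  have [hx|hx] := pselect (side i (complex.Re (W s / sqrtC p.[t]))); first by exists s.
  exists s'; last exact: etrans e1 su.
  by split; [rewrite e1|rewrite e2; exact: side_opp].
exists (sheet t); split.
- exact: sheet_open.
- by move=> i j _ _ [s [[_ h3] [_ h4]]]; exact: side_uniq h3 h4.
- apply/seteqP; split=> [s Vs|s [i _ [Vs _]]]; last exact: Vs.
  by have [i hi] := side_ex (sheet_cover pt Vs); exists i.
move=> i; split; first exact: bij.
move=> U oU US; apply: openC => _ [s Us <-].
pose O := U `|` [set s' | exists2 j, j != i & sheet t j s'].
have oO : open O.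
  apply: openU => //.
  rewrite (_ : mkset _ = \bigcup_(j in [set j | j != i]) sheet t j).
    by apply: bigcup_open => j _; exact: sheet_open.
  by apply/seteqP; split=> s' [j]; exists j.
have [Vs hsi] := US _ Us.
have fib : forall s', T s' = T s -> O s'.
  move=> s' e; have Vs' : md (p.[T s'] - p.[t]) < md p.[t] by rewrite e.
  have [j hj] := side_ex (sheet_cover pt Vs').
  have [ji|ji] := eqVneq j i; last by right; exists j.
  have s's : sheet t i s' by split; [exact: Vs'|rewrite -ji; exact: hj].
  by left; rewrite (sheet_inj s's (US _ Us) e); exact: Us.
have nV : \forall u \near T s, V u by apply: open_nbhs_nbhs.
have ft := fiber_finite_tube oO fib.
have /nbhsC[e e0 he] : \forall u \near T s, (forall s', T s' = u -> O s') /\ V u.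
  by apply: filterI; [exact: ft|exact: nV].
exists e => // u /he[hu Vu].
have [_ _ sur] := bij i; have [s' s'i s'u] := sur _ Vu.
have [Us'|[j ji [_ hj]]] := hu _ s'u; first by exists s'.
by case: s'i => _ /(side_uniq hj) ji'; rewrite ji' eqxx in ji.
Qed.

(** Off the zeros of [W] the sheets are neighbourhoods where [T] is injective. If [W]
    vanishes at the class of [a], then [a] and [be - a] are congruent, and [a + x] and
    [a - x] are points with the same value of [T]. *)
Lemma ramifiedE s : ramified_at T s <-> W s = 0.
Proof.
split=> [ram|W0].
  apply: contrapT => /eqP W0; apply: ram.
  have pt : p.[T s] != 0 by rewrite -W_sqr expf_neq0.
  have Vs : md (p.[T s] - p.[T s]) < md p.[T s] by rewrite subrr md0 md_gt0.
  have : exists i, sheet (T s) i s.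
    by have [i hi] := side_ex (sheet_cover pt Vs); exists i.
  move=> [i si]; exists (sheet (T s) i).
    by apply: open_nbhs_nbhs; split=> //; exact: sheet_open.
  by move=> x y /set_mem hx /set_mem hy; exact: sheet_inj hx hy.
move=> [U Us injU]; have sa := relP s; set a := rep s in sa.
have nLa := rel_notin sa; rewrite (WE sa) in W0.
have La : L2 (be - a - a).
  apply: (h_injective ns nLa (notin_reflect nLa) (esym (h_reflect a))).
  exact: etrans W0 (esym (etrans (h1_reflect nLa) (etrans (congr1 (@GRing.opp C) W0) (oppr0 C)))).
have /nbhsC[e e0 he] := near_rel Us sa; have [d d0 gap] := span_gap (ns_coords_le ns).
pose x : R := Num.min (e / 2) (d / 4).
have x0 : 0 < x by rewrite lt_min !divr_gt0.
have xe : x <= e / 2 by rewrite ge_min lexx.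
have xd : x <= d / 4 by rewrite ge_min lexx orbT.
have mx : md x%:C%C = x by rewrite md_real gtr0_norm.
have [|n1 u1] := he (a + x%:C%C); first by rewrite addrAC subrr add0r mx; lra.
have [|n2 u2] := he (a - x%:C%C); first by rewrite addrAC subrr add0r mdN mx; lra.
have [s1 r1] := rel_onto n1; have [s2 r2] := rel_onto n2.
have T12 : T s1 = T s2.
  rewrite (TE r1) (TE r2) -[h (a - _)]h_reflect.
  have -> : be - (a - x%:C%C) = (a + x%:C%C) + (be - a - a) by ring.
  by rewrite (h_L2 ns _ La).
have s12 : s1 = s2 by exact: (injU s1 s2 (mem_set (u1 _ r1)) (mem_set (u2 _ r2)) T12).
rewrite -s12 in r2; have /L2_L Lx := (rel_coset _ r2).1 r1.
have xx : a + x%:C%C - (a - x%:C%C) = 2 * x%:C%C by ring.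
rewrite xx in Lx; have m2x : md (2 * x%:C%C) = 2 * x by rewrite mdM md_nat mx.
have /(congr1 md) : 2 * x%:C%C = 0 :> C by apply: gap Lx _; rewrite m2x; lra.
rewrite m2x md0 => h2x; suff : x < x by rewrite ltxx.
lra.
Qed.

Lemma branch_pointsE : branch_points T = [set t | root p t].
Proof.
apply/seteqP; split=> [_ [s /ramifiedE W0 <-]|t /eqP pt] /=.
  by rewrite rootE -W_sqr W0 expr0n.
have [s st] := T_surj t; exists s => //; apply/ramifiedE/eqP.
by have := W_sqr s; rewrite st pt => /eqP; rewrite expf_eq0.
Qed.

Theorem cover_branched : @branched_covering R 2 cover_curve (affine_line R) T.
Proof.
split.
- by split; [exact: cover_is_curve|exact: affine_line_curve].
- exact: T_holomorphic.
- exact: T_proper.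
- rewrite [branch_points _]branch_pointsE; exact: limit_point_roots.
move=> t; rewrite [branch_points _]branch_pointsE /= rootE => /negP pt.
exact: T_evenly_covered.
Qed.

Definition sigma : set (C * C) := [set q | q.1 ^+ 2 = p.[q.2]].
Local Notation Sigma := (embedded_curve sigma).

Definition toSigma (s : Y) : Sigma := exist _ (W s, T s) (mem_set (W_sqr s)).

Lemma fromSigma_ex (x : Sigma) : exists s, W s = (val x).1 /\ T s = (val x).2.
Proof.
case: x => -[w t] /= /[dup] hx /set_mem /= /WT_surj[s sw st].
by exists s.
Qed.

Definition fromSigma (x : Sigma) : Y := projT1 (cid (fromSigma_ex x)).

Lemma fromSigmaP x : W (fromSigma x) = (val x).1 /\ T (fromSigma x) = (val x).2.
Proof. by rewrite /fromSigma; case: cid. Qed.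

Lemma toSigmaK : cancel toSigma fromSigma.
Proof. by move=> s; have [w t] := fromSigmaP (toSigma s); exact: WT_inj. Qed.

Lemma fromSigmaK : cancel fromSigma toSigma.
Proof.
move=> x; apply: val_inj; rewrite /=; have [-> ->] := fromSigmaP x.
exact/esym/surjective_pairing.
Qed.

Lemma toSigma_continuous : continuous toSigma.
Proof.
suff H : continuous ((val : set_type sigma -> (C * C)%type) \o toSigma).
  exact: (@continuous_comp_initial (set_type sigma) Y (C * C)%type val toSigma H).
move=> s; apply: (@cvg_pair _ _ _ (nbhs s) (nbhs (W s)) (nbhs (T s)) _ _ _ W T).
  exact: (@W_continuous s).
exact: (@T_continuous s).
Qed.

Lemma val_sigma_continuous : continuous (val : Sigma -> C * C).
Proof. exact: initial_continuous. Qed.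

(** Two points of a fibre of [T] are told apart by the sign of [W]; with
    properness of [T] this makes the inverse map continuous. *)
Lemma fromSigma_continuous : continuous fromSigma.
Proof.
move=> x N Nx; set s := fromSigma x in Nx.
have [ws ts] := fromSigmaP x; rewrite -/s in ws ts.
move: Nx; rewrite nbhsE => -[U [oU Us] UN].
pose O := U `|` [set s' | W s != 0 /\ md (W s) < md (W s' - W s)].
have oO : open O.
  apply: openU => //; have [W0|W0] := eqVneq (W s) 0.
    rewrite (_ : mkset _ = set0); first exact: open0.
    by apply/seteqP; split=> // s' [].
  rewrite (_ : mkset _ = W @^-1` [set w | md (W s) < md (w - W s)]); last first.
    by apply/seteqP; split=> s' // [].
  apply: open_comp; first by move=> s' _; exact: W_continuous.
  apply: openC => w /= hw; exists (md (w - W s) - md (W s)); first lra.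
  by move=> v; have := md_tri w v (W s); rewrite (mdBC w v); lra.
have fib s' : T s' = T s -> O s'.
  move=> e; have [ww|ww] := same_fiber e; first by left; rewrite (WT_inj ww e).
  have [W0|W0] := eqVneq (W s) 0.
    left; suff -> : s' = s by exact: Us.
    by apply: WT_inj e; rewrite ww W0 oppr0.
  right; split=> //; rewrite ww; have -> : - W s - W s = - (2 * W s) by ring.
  by rewrite mdN mdM md_nat; have : 0 < md (W s) by [rewrite md_gt0]; lra.
have nT := fiber_finite_tube oO fib.
have c1 : {for x, continuous (fun x : Sigma => (val x).1 : C)}.
  by apply: continuous_comp; [exact: val_sigma_continuous|exact: cvg_fst].
have c2 : {for x, continuous (fun x : Sigma => (val x).2 : C)}.
  by apply: continuous_comp; [exact: val_sigma_continuous|exact: cvg_snd].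
have n2 : \forall x' \near x, forall s', T s' = (val x').2 -> O s'.
  apply: (c2 [set t | forall s', T s' = t -> O s']).
  by move: nT; rewrite ts.
have n1 : \forall x' \near x, W s != 0 -> md ((val x').1 - W s) < md (W s).
  have [W0|W0] := eqVneq (W s) 0; first by near=> x'.
  have /continuousC/(_ (md (W s))) := c1; rewrite md_gt0 -ws => /(_ W0).
  by apply: filterS => x' + _.
apply: filterS2 n1 n2 => x' h3 h4; apply: UN.
have [w' t'] := fromSigmaP x'.
have [//|[W0 hW]] := h4 _ t'.
by have := h3 W0; rewrite -w'; lra.
Unshelve. all: by end_near. Qed.

Lemma sigma_chart c : atlas Sigma c -> is_chart c.
Proof.
move=> [oc cc oi [g1 [g2 hg]]]; split=> //.
  move=> x y; rewrite !inE => dx dy e; apply: val_inj.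
  by have [-> _ _ _] := hg _ dx; have [-> _ _ _] := hg _ dy; rewrite e.
move=> U oU Udom; apply: openC => _ [x Ux <-]; have dx := Udom _ Ux.
have [vx d1 d2 _] := hg _ dx.
have nU : nbhs x U by apply: open_nbhs_nbhs.
have [V nV VU] : exists2 V : set (C * C), nbhs (val x) V & forall y : Sigma, V (val y) -> U y.
  move: nU; rewrite nbhsE => -[U' [[V oV VU'] U'x] U'U].
  exists V; first by apply: open_nbhs_nbhs; split=> //; move: U'x; rewrite -VU'.
  by move=> y Vy; apply: U'U; rewrite -VU'.
have cg : {for coord c x, continuous (fun t => (g1 t, g2 t))}.
  apply: (@cvg_pair _ _ _ (nbhs (coord c x)) (nbhs (g1 (coord c x)))
      (nbhs (g2 (coord c x))) _ _ _ g1 g2).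
    exact: (derivable_cont d1).
  exact: (derivable_cont d2).
rewrite vx in nV.
have n1 : \forall t \near coord c x, V (g1 t, g2 t) by exact: cg.
have n2 : \forall t \near coord c x, (coord c @` dom c) t.
  by apply: open_nbhs_nbhs; split=> //; exists x.
have /nbhsC[e e0 he] : \forall t \near coord c x, V (g1 t, g2 t) /\ (coord c @` dom c) t.
  by apply: filterI; [exact: n1|exact: n2].
exists e => // t /he[Vt [y dy yt]].
exists y => //; apply: VU; have [-> _ _ _] := hg _ dy.
by rewrite yt.
Qed.

Lemma sigma_immersed : @immersed R Sigma val.
Proof.
split; first exact: sigma_chart.
move=> c [oc cc oi [g1 [g2 hg]]]; exists g1, g2 => x dx; exact: hg.
Qed.

(** A chart of [Y] read on [Sigma] through the homeomorphism [fromSigma]. *)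
Lemma sigma_charts_exist (x : Sigma) : exists2 c, atlas Sigma c & dom c x.
Proof.
have [c ac ds] := cover_charts_exist (fromSigma x).
have ic := cover_chart ac; have [_ hg] := cover_immersed.
have [g1 [g2 {}hg]] := hg _ ac.
have [oc cc _ opc] := ic.
have od : open (fromSigma @^-1` dom c).
  by apply: open_comp => // y _; exact: fromSigma_continuous.
exists (@Chart R Sigma (fromSigma @^-1` dom c) (coord c \o fromSigma)) => //.
split; [exact: od| | |].
- suff : {in fromSigma @^-1` dom c, continuous (coord c \o fromSigma)}.
    by rewrite -continuous_open_subspace.
  move=> y /set_mem dy.
  by apply: continuous_comp; [exact: fromSigma_continuous|exact: chart_cont ic dy].
- rewrite (_ : _ @` _ = coord c @` dom c); first exact: opc.
  apply/seteqP; split=> [_ [y dy <-]|_ [s dsc <-]]; first by exists (fromSigma y).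
  by exists (toSigma s); rewrite /= toSigmaK.
exists g1, g2 => y dy; have [e d1 d2 nz] := hg _ dy.
split; [|exact: d1|exact: d2|exact: nz].
have [e1 e2] := fromSigmaP y; rewrite -e /ev e1 e2.
exact: surjective_pairing.
Qed.

Lemma sigma_is_curve : is_complex_curve Sigma.
Proof.
split.
- apply: (@hausdorff_separating R) => x y xy.
  have [e1|e1] := pselect ((val x).1 = (val y).1); last first.
    exists (fun x : Sigma => (val x).1) => // z.
    by apply: continuous_comp; [exact: val_sigma_continuous|exact: cvg_fst].
  exists (fun x : Sigma => (val x).2) => [z|e2].
    by apply: continuous_comp; [exact: val_sigma_continuous|exact: cvg_snd].
  by apply: xy; apply: val_inj; case: (val x) (val y) e1 e2 => [? ?] [? ?] /= -> ->.
- exact: sigma_charts_exist.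
- exact: sigma_chart.
move=> c d s ac ad ds ds'.
apply: (@immersed_holomorphic R Sigma Sigma val val id c d s
  sigma_immersed sigma_immersed ac ad ds ds'); [exact: cvg_id|by []].
Qed.

Theorem cover_biholomorphic : biholomorphic cover_curve Sigma.
Proof.
split; [exact: cover_is_curve|exact: sigma_is_curve|].
exists toSigma, fromSigma; split; [exact: toSigmaK|exact: fromSigmaK| |].
  split; first exact: toSigma_continuous.
  move=> c d s ac ad ds dfs.
  apply: (@immersed_holomorphic R cover_curve Sigma ev val toSigma c d s
    cover_immersed sigma_immersed ac ad ds dfs); [exact: toSigma_continuous|by []].
split; first exact: fromSigma_continuous.
move=> c d x ac ad dx dfx.
apply: (@immersed_holomorphic R Sigma cover_curve val ev fromSigma c d x
    sigma_immersed cover_immersed ac ad dx dfx); first exact: fromSigma_continuous.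
by move=> y; have [e1 e2] := fromSigmaP y; rewrite /ev e1 e2; exact/esym/surjective_pairing.
Qed.

End Cover.

(** * Unordered pairs of points of the torus *)

Section SymmetricSquareTopology.
Local Open Scope quotient_scope.
Local Open Scope ring_scope.
Variable X : topologicalType.

Lemma upair_eqP (x y x' y' : X) :
  upair x y = upair x' y' <-> (x = x' /\ y = y') \/ (x = y' /\ y = x').
Proof.
split=> [/eqmodP|h]; last apply/eqmodP; rewrite /= /swap_rel.
  by case/orP=> /eqP[-> ->]; [left|right].
by case: h => -[-> ->]; rewrite eqxx ?orbT.
Qed.

Lemma upairC (x y : X) : upair x y = upair y x.
Proof. by apply/upair_eqP; right. Qed.

Lemma upair_open (U : set X) : open U ->
  open [set s : Sym2 X | exists x y, U x /\ s = upair x y].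
Proof.
move=> oU; rewrite /open /= /quotient_open.
rewrite (_ : _ @^-1` _ = (fst @^-1` U) `|` (snd @^-1` U) :> set (X * X)).
  by apply: openU; apply: open_comp => // ? _; [exact: cvg_fst|exact: cvg_snd].
apply/seteqP; split=> -[x y] /=.
  by move=> [x' [y' [Ux' /upair_eqP[[-> _]|[_ ->]]]]]; [left|right].
case=> [Ux|Uy]; first by exists x, y.
by exists y, x; split; [exact: Uy|exact: upairC].
Qed.

Lemma upair_near (V : set (Sym2 X)) (x y : X) : open V -> V (upair x y) ->
  exists U1 U2 : set X, [/\ nbhs x U1, nbhs y U2 &
    forall x' y', U1 x' -> U2 y' -> V (upair x' y')].
Proof.
rewrite /open /= /quotient_open => oV Vxy.
have : nbhs (x, y) (\pi_(Sym2 X) @^-1` V) by apply: open_nbhs_nbhs.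
move=> -[[U1 U2] /= [n1 n2] sub]; exists U1, U2; split=> // x' y' h1 h2.
exact: (sub (x', y')).
Qed.

End SymmetricSquareTopology.

Lemma nbhs_set_val (X : topologicalType) (A : set X) (x : A) (N : set A) : nbhs x N ->
  exists2 O : set X, nbhs (val x) O & forall y : A, O (val y) -> N y.
Proof.
rewrite nbhsE => -[U' [[V oV VU'] U'x] U'U].
have Vx : V (set_val x) by move: U'x; rewrite -VU'.
exists V; first by exists V.
by move=> y Vy; apply: U'U; rewrite -VU'.
Qed.

Lemma translate_continuous (R : realType) (w : CC R) : continuous (fun z : CC R => z + w).
Proof. by move=> z; apply: (@cvgD _ (CC R) (CC R) (nbhs z) _ (fun y => y) (fun=> w)); [exact: cvg_id|exact: cvg_cst]. Qed.

Section PairsOfPoints.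
Local Open Scope quotient_scope.
Local Open Scope ring_scope.
Variables (R : realType) (tau : CC R).
Hypothesis tau_gt0 : 0 < complex.Im tau.
Variable l : nat.
Hypothesis hl : (1 <= l <= 3)%N.
Local Notation C := (CC R).
Local Notation Lam := (lattice tau).
Local Notation al := (ns_period tau l).
Local Notation be := (ns_half_period tau l).
Local Notation twisted_zeta := (twisted_zeta tau l).
Local Notation L := (span_int al be).
Local Notation L2 := (span_int al (2 * be)).
Local Notation X := (set_type (@torus_minus_2tors R tau)).
Local Notation Y := (set_type (@Y_set R tau l)).
Local Notation toT := (@toT R tau).

Definition rel (s : Y) (a : C) := represents l (val s) a.

Lemma al2_lattice : 2 * al \in Lam.
Proof.
have [q e] := @omega_lattice_point R tau l; apply/latticeE; exists q.1, q.2.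
by rewrite /ns_period mulrC divfK ?pnatr_eq0.
Qed.

Lemma toT_continuous : continuous toT.
Proof. exact: pi_continuous. Qed.

(** The preimage of the image is a union of translates. *)
Lemma toT_open (U : set C) : open U -> open (toT @` U).
Proof.
move=> oU; rewrite /open /= /quotient_open.
rewrite (_ : _ @^-1` _ = \bigcup_(w in [set w | w \in Lam]) ((fun z => z + w) @^-1` U)).
  apply: bigcup_open => w _; apply: open_comp => // z _.
  exact: (@translate_continuous R w z).
apply/seteqP; split=> z /=.
  move=> [u Uu /toTE uz]; exists (u - z) => //=.
  by rewrite addrC subrK.
by move=> [w /= wL Uw]; exists (z + w) => //; apply/toTE; rewrite addrC addKr.
Qed.

Lemma represents_coset (s : Sym2 X) (a b : C) :
  represents l s a -> (represents l s b <-> L2 (b - a)).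
Proof.
move=> [x [y [xa ya ->]]]; split.
  move=> [x' [y' [xb yb /upair_eqP[[xx _]|[xy _]]]]]; apply/(L2_lattice _ hl).
    by left; apply/toTE; rewrite -xa -xb xx.
  right; rewrite (_ : b - a - al = b - al - a); last by ring.
  by apply/toTE; rewrite -xa -yb xy.
move/(L2_lattice _ hl) => [ba|ba].
  exists x, y; split=> //; first by rewrite xa; apply/esym/toTE.
  rewrite ya; apply/esym/toTE; rewrite -/al (_ : _ - _ = b - a)//; ring.
exists y, x; split; last exact: upairC.
  rewrite ya; apply/esym/toTE; rewrite -/al.
  by rewrite (_ : _ - _ = b - a - al + 2 * al); [apply: rpredD => //; exact: al2_lattice|ring].
rewrite xa; apply/esym/toTE; rewrite -/al.
by rewrite (_ : _ - _ = b - a - al)//; ring.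
Qed.

Lemma rel_notin s a : rel s a -> ~ L a.
Proof.
move=> [x [_ [xa _ _]]] /(two_torsionE _ hl).
by rewrite -xa; exact: (set_mem (valP x)).
Qed.

Lemma rel_onto a : ~ L a -> exists s, rel s a.
Proof.
move=> La; have La' : ~ L (a - al).
  by move=> h; apply: La; have := spanB h (spanN (span_l al be)); rewrite opprK subrK.
have n1 : torus_minus_2tors (toT a) by move=> /(two_torsionE _ hl).
have n2 : torus_minus_2tors (toT (a - al)) by move=> /(two_torsionE _ hl).
pose x : X := SigSub (mem_set n1); pose y : X := SigSub (mem_set n2).
have r : represents l (upair x y) a by exists x, y.
have Yxy : @Y_set R tau l (upair x y) by exists a.
by exists (SigSub (mem_set Yxy)).
Qed.

Lemma rel_inj s s' a : rel s a -> rel s' a -> s = s'.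
Proof.
move=> [x [y [xa ya e]]] [x' [y' [xa' ya' e']]]; apply: val_inj.
rewrite e e'; congr upair; apply: val_inj; first exact: etrans xa (esym xa').
exact: etrans ya (esym ya').
Qed.

Lemma rel_total s : exists a, rel s a.
Proof. exact: (set_mem (valP s)). Qed.

Lemma rel_open (U : set C) : open U -> open [set s | exists2 a, U a & rel s a].
Proof.
move=> oU.
pose U1 : set X := val @^-1` (toT @` U).
have oU1 : open U1.
  apply: open_comp; last exact: toT_open.
  by move=> x _; exact: (@initial_continuous X _ set_val).
have oA := upair_open oU1.
rewrite (_ : mkset _ = val @^-1` [set s | exists x y, U1 x /\ s = upair x y]).
  by apply: open_comp oA => s _; exact: (@initial_continuous Y _ set_val).
apply/seteqP; split=> s /=.
  move=> [a Ua [x [y [xa ya e]]]]; exists x, y; split=> //.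
  by exists a.
move=> [x [y [[a Ua ax] e]]]; exists a => //.
have [b sb] := rel_total s; apply/(represents_coset _ sb)/(L2_lattice _ hl).
have [x' [y' [xb yb e']]] := sb.
move: e; rewrite e' => /upair_eqP[[xx _]|[_ yx]].
  by left; apply/toTE; rewrite ax -xx.
right; rewrite (_ : a - b - al = (a - (b - al)) - 2 * al); last by ring.
apply: rpredB; last exact: al2_lattice.
by apply/toTE; rewrite ax -yx.
Qed.

Lemma rel_continuous (V : set Y) : open V -> forall s a, V s -> rel s a ->
  \forall a' \near a, forall s', rel s' a' -> V s'.
Proof.
move=> [V' oV' <-] s a /= V's [x [y [xa ya e]]].
have {}V's : V' (upair x y) by rewrite -e.
have [U1 [U2 [n1 n2 sub]]] := upair_near oV' V's.
have [N1 o1 s1] := nbhs_set_val n1; have [N2 o2 s2] := nbhs_set_val n2.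
rewrite xa in o1; rewrite ya in o2.
have m1 : \forall a' \near a, N1 (toT a') by exact: (@toT_continuous a).
have m2 : \forall a' \near a, N2 (toT (a' - al)).
  have c : {for a, continuous (fun z : C => toT (z - al))}.
    apply: (@continuous_comp _ _ _ (fun z : C => z - al) toT); last exact: toT_continuous.
    exact: (@translate_continuous R (- al) a).
  exact: (c N2).
apply: filterS2 m1 m2 => a' h1 h2 s' [x' [y' [xa' ya' e']]].
suff : V' (val s') by []; rewrite e'; apply: sub; [apply: s1|apply: s2]; first by rewrite xa'.
by rewrite ya'.
Qed.

Lemma Y_quotient : quotient_param L L2 rel.
Proof.
split; [exact: rel_notin|by move=> s a b; exact: represents_coset|exact: rel_total|exact: rel_onto|
  exact: rel_inj|exact: rel_open|exact: rel_continuous].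
Qed.

Lemma T_mapE (s : Y) a : rel s a -> @T_map R tau l s = twisted_zeta a / 2.
Proof.
move=> sa; rewrite /T_map; case: xgetP => [b _ sb|/(_ a)[]//].
rewrite (twisted_zeta_half tau_gt0 hl (rel_notin sb)); congr (_ / _).
have /(represents_coset _ sa) ba : represents l (val s) b := sb.
by rewrite -(subrK a b) addrC (h_L2 (twisted_zeta_ns tau_gt0 hl)).
Qed.


Lemma spectral_poly_neq0 : spectral_poly tau l != 0.
Proof.
have [A [D [-> _ _]]] := spectral_polyE tau_gt0 hl.
apply/eqP => /(congr1 (fun q : {poly C} => q`_4)).
rewrite !coefD !coefZ !coefXn coefC coef0 /= mulr1 mulr0 !addr0 => /eqP.
by rewrite pnatr_eq0.
Qed.

Lemma spectral_poly_derive z : ~ L z ->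
  derive1 twisted_zeta z ^+ 2 = (spectral_poly tau l).[twisted_zeta z / 2].
Proof.
have [A [D [-> h1 _]]] := spectral_polyE tau_gt0 hl.
move=> /h1 ->; rewrite !hornerD !hornerZ !hornerXn hornerC; by field.
Qed.

End PairsOfPoints.

Theorem theorem1p3 (R : realType) (tau : CC R) (htau : 0 < 'Im tau)
    (l : nat) (hl : (1 <= l <= 3)%N) :
  [/\ @branched_covering R 2 (Y_curve tau l) (affine_line R) (@T_map R tau l),
      @branch_points (Y_curve tau l) (affine_line R) (@T_map R tau l) =
        [set T | root (spectral_poly tau l) T] &
      biholomorphic (Y_curve tau l) (Sigma_curve tau l)].
Proof.
have tau_gt0 : 0 < complex.Im tau by move: htau; rewrite -complexIm ltcR.
have ns := twisted_zeta_ns tau_gt0 hl.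
have p0 := spectral_poly_neq0 tau_gt0 hl.
have hp := spectral_poly_derive tau_gt0 hl.
have YQ := Y_quotient tau hl.
have TE := T_mapE tau_gt0 hl.
split.
- exact: (cover_branched ns p0 hp YQ TE).
- exact: (branch_pointsE ns hp YQ TE).
exact: (cover_biholomorphic ns hp YQ TE).
Qed.
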